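(* Let $X$ be a complex Banach space, let $T\in B(X)$ with $\sigma(T)\subset\overline{\mathbb{D}}$, and let $m\ge1$ be an integer. The following assertions are equivalent: (i) $T$ has property $(\gamma\text{-}GFS)_m$; (ii) $T$ has $1$-derivative $\gamma$-bounded functional calculus; (iii) $T$ has $m$-derivative $\gamma$-bounded functional calculus.
   Context: $\overline{\mathbb{D}}$ is the closed unit disc, $r\mathbb{D}$ the open disc of radius $r$ centred at $0$, $\sigma(T)$ the spectrum, $R(\lambda,T)=(\lambda I_X-T)^{-1}$. $H^\infty(r\mathbb{D})$ is the space of bounded analytic functions on $r\mathbb{D}$ with the sup norm. For $r>1$ and $\phi\in H^\infty(r\mathbb{D})$, $\phi^{(m)}(T)=\frac{1}{2\pi}\int_0^{2\pi}\rho e^{it}\phi^{(m)}(\rho e^{it})R(\rho e^{it},T)\,dt$ for any $1<\rho<r$ (Riesz–Dunford calculus). Let $(\gamma_k)_{k\ge1}$ be independent complex standard Gaussian variables on a probability space $\Sigma$, and for $x_1,\dots,x_N\in X$ put $\|\sum_k\gamma_k\otimes x_k\|_{G(X)}=\big(\int_\Sigma\|\sum_k\gamma_k(\lambda)x_k\|^2d\lambda\big)^{1/2}$. A set $\mathcal{T}\subset B(X)$ is $\gamma$-bounded if there is $C\ge0$ such that $\|\sum_{n=1}^N\gamma_n\otimes T_nx_n\|_{G(X)}\le C\|\sum_{n=1}^N\gamma_n\otimes x_n\|_{G(X)}$ for all $N$, all $T_1,\dots,T_N\in\mathcal{T}$ and $x_1,\dots,x_N\in X$. Write $\mathbb{N}_N=\{1,\dots,N\}$,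 $\|(x_k)_{k\in\mathbb{N}_N}\|_{\gamma(\mathbb{N}_N;X)}=\|\sum_{k=1}^N\gamma_k\otimes x_k\|_{G(X)}$, and for $x_1^*,\dots,x_N^*\in X^*$, $$\|(x_k^* )_{k\in\mathbb{N}_N}\|_{\gamma'(\mathbb{N}_N;X^* )}=\sup\Big\{\Big|\sum_{k=1}^N\langle x_k,x_k^*\rangle\Big|:\ x_k\in X,\ \|(x_k)_{k\in\mathbb{N}_N}\|_{\gamma(\mathbb{N}_N;X)}\le1\Big\}.$$ Property $(\gamma\text{-}GFS)_m$: $\sigma(T)\subset\overline{\mathbb{D}}$ and there is $C>0$ such that for all $N\ge1$, $r_1,\dots,r_N>1$, $x_1,\dots,x_N\in X$, $x_1^*,\dots,x_N^*\in X^*$, $$\sum_{k=1}^N\int_0^{2\pi}|\langle(r_k+1)(r_k-1)^mR(r_ke^{it},T)^{m+1}x_k,x_k^*\rangle|\,dt\le C\|(x_k)\|_{\gamma(\mathbb{N}_N;X)}\|(x_k^* )\|_{\gamma'(\mathbb{N}_N;X^* )}.$$ $m$-derivative $\gamma$-bounded functional calculus: the set $\{(r-1)^m\phi^{(m)}(T):r>1,\ \phi\in H^\infty(r\mathbb{D}),\ \|\phi\|_{H^\infty(r\mathbb{D})}\le1\}$ is $\gamma$-bounded. *)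

(* Defs.v *)
From HB Require Import structures.
From mathcomp Require Import all_boot all_order all_algebra complex.
From mathcomp Require Import all_classical all_reals all_analysis.

Set Implicit Arguments.
Unset Strict Implicit.
Unset Printing Implicit Defensive.

Import Order.TTheory GRing.Theory Num.Theory.
Import numFieldNormedType.Exports.

Local Open Scope classical_set_scope.
Local Open Scope complex_scope.
Local Open Scope ring_scope.

(* A complex Banach space is a [completeNormedModType R[i]]; its norm [`|x|]
   takes values in R[i] (with zero imaginary part), [rnorm x] is the same
   number seen in R. *)
Definition rnorm (R : realType) (V : normedModType R[i]) (x : V) : R :=
  complex.Re `|x|.

Definition expi (R : realType) (t : R) : R[i] := cos t +i* sin t.

(* B(X) is [bounded_linear (Y := X)], X^* is [bounded_linear (Y := R[i]^o)]. *)
Definition bounded_linear (R : realType) (X Y : normedModType R[i])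
    (A : X -> Y) : Prop :=
  linear A /\ exists M : R, forall x, rnorm (A x) <= M * rnorm x.

Section operators.
Context {R : realType} {X : normedModType R[i]}.
Implicit Types (A S T : X -> X) (lambda : R[i]).

Definition opnorm A : \bar R :=
  ereal_sup [set (rnorm (A x))%:E | x in [set x : X | rnorm x <= 1]].

Definition bounded_inverse A S : Prop :=
  [/\ bounded_linear S, forall x, S (A x) = x & forall x, A (S x) = x].

Definition spectrum T : set R[i] :=
  [set lambda | ~ exists S, bounded_inverse (fun x => lambda *: x - T x) S].

(* R(lambda, T); an unspecified value when lambda is in the spectrum. *)
Definition resolvent lambda T : X -> X :=
  get [set S | bounded_inverse (fun x => lambda *: x - T x) S].

(* Riemann integral over [a, b] of an operator-valued function, the tagged
   Riemann sums converging in operator norm as the mesh goes to 0. *)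
Definition tagged_partition (a b delta : R) (n : nat) (s xi : nat -> R) :
    Prop :=
  [/\ s 0%N = a, s n = b &
      forall i, (i < n)%N ->
        s i <= xi i <= s i.+1 /\ s i.+1 - s i < delta].

Definition riemann_sum (F : R -> X -> X) (n : nat) (s xi : nat -> R) :
    X -> X :=
  fun x => \sum_(i < n) (s i.+1 - s i)%:C *: F (xi i) x.

Definition is_op_integral (F : R -> X -> X) (a b : R) A : Prop :=
  bounded_linear A /\
  forall eps : R, 0 < eps -> exists2 delta : R, 0 < delta &
    forall n s xi, tagged_partition a b delta n s xi ->
      (opnorm (fun x => riemann_sum F n s xi x - A x)%R <= eps%:E)%E.

Definition op_integral (F : R -> X -> X) (a b : R) : X -> X :=
  get [set A | is_op_integral F a b A].

End operators.

Definition disc (R : realType) (r : R) : set R[i] :=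
  [set z | `|z| < r%:C].

Definition closed_unit_disc {R : realType} : set R[i] := [set z | `|z| <= 1].

(* Only the values of phi on r D matter. *)
Definition Hinfty (R : realType) (r : R) (phi : R[i]^o -> R[i]^o) : Prop :=
  (forall z, disc r z -> derivable phi z 1) /\
  exists M : R, forall z, disc r z -> rnorm (phi z) <= M.

Definition Hinfty_norm (R : realType) (r : R) (phi : R[i]^o -> R[i]^o) : \bar R :=
  ereal_sup [set (rnorm (phi z))%:E | z in disc r].

(* phi^(m)(T), computed on the circle of radius rho; for phi in Hinfty r and
   spectrum T in the closed unit disc it does not depend on 1 < rho < r. *)
Definition derivative_calculus (R : realType) (X : normedModType R[i])
    (T : X -> X) (m : nat) (rho : R) (phi : R[i]^o -> R[i]^o) : X -> X :=
  fun x => ((2 * pi)^-1)%:C *: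
    op_integral
      (fun t y => (rho%:C * expi t * (phi^`(m))%classic (rho%:C * expi t)) *:
                  resolvent (rho%:C * expi t) T y)
      0 (2 * pi) x.

Section gaussian.
Context {d : measure_display} {Sigma : measurableType d} {R : realType}.
Variable P : probability Sigma R.

Definition mutually_independent (I : eqType) (d' : measure_display)
    (T' : measurableType d') (Y : I -> Sigma -> T') : Prop :=
  forall (J : seq I) (B : I -> set T'), uniq J ->
    (forall j, j \in J -> measurable (B j)) ->
    P (\big[setI/setT]_(j <- J) (Y j @^-1` B j)) =
    (\prod_(j <- J) P (Y j @^-1` B j))%E.

(* Real and imaginary parts are independent centred real Gaussian variables of
   variance 1/2, so that E |g|^2 = 1; the second argument of [normal_prob] is
   the standard deviation. *)
Definition complex_standard_gaussian (g : Sigma -> R[i]) : Prop :=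
  let parts (b : bool) (w : Sigma) : R :=
    if b then complex.Im (g w) else complex.Re (g w) in
  [/\ forall b, measurable_fun setT (parts b),
      forall b B, measurable B ->
        P (parts b @^-1` B) = normal_prob 0 (Num.sqrt 2^-1) B &
      mutually_independent parts].

(* The index k = 1, 2, ... is shifted to start at 0. Borel sets of C are those
   of R * R. *)
Definition gaussian_sequence (g : nat -> Sigma -> R[i]) : Prop :=
  (forall k, complex_standard_gaussian (g k)) /\
  mutually_independent
    (fun k w => (complex.Re (g k w), complex.Im (g k w)) : (R * R)%type).

Variable g : nat -> Sigma -> R[i].
Context {X : normedModType R[i]}.

Definition gamma_norm (N : nat) (x : 'I_N -> X) : \bar R :=
  sqrte (\int[P]_w ((rnorm (\sum_(k < N) g k w *: x k)) ^+ 2)%R%:E)%E.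

Definition gamma'_norm (N : nat) (xs : 'I_N -> X -> R[i]^o) : \bar R :=
  ereal_sup [set (rnorm (\sum_(k < N) xs k (x k) : R[i]^o))%:E |
              x in [set x : 'I_N -> X | (gamma_norm x <= 1)%E]].

Definition gamma_bounded (TT : set (X -> X)) : Prop :=
  exists2 C : R, 0 <= C &
    forall (N : nat) (T : 'I_N -> X -> X) (x : 'I_N -> X),
      (forall n, TT (T n)) ->
      (gamma_norm (fun n => T n (x n)) <= C%:E * gamma_norm x)%E.

Definition gamma_GFS (m : nat) (T : X -> X) : Prop :=
  spectrum T `<=` closed_unit_disc /\
  exists2 C : R, 0 < C &
    forall (N : nat) (r : 'I_N -> R) (x : 'I_N -> X) (xs : 'I_N -> X -> R[i]^o),
      (1 <= N)%N -> (forall k, 1 < r k) ->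
      (forall k, bounded_linear (xs k)) ->
      (\sum_(k < N) \int[lebesgue_measure]_(t in `[0%R, (2 * pi)%R])
          (rnorm (xs k (((r k + 1) * (r k - 1) ^+ m)%:C *:
             iter m.+1 (resolvent ((r k)%:C * expi t) T) (x k))))%R%:E
       <= C%:E * gamma_norm x * gamma'_norm xs)%E.

Definition derivative_gamma_bounded_calculus (m : nat) (T : X -> X) : Prop :=
  gamma_bounded [set A | exists (r rho : R) (phi : R[i]^o -> R[i]^o),
    [/\ 1 < r, 1 < rho < r, Hinfty r phi, (Hinfty_norm r phi <= 1)%E &
        A = (fun x => ((r - 1) ^+ m)%:C *:
                      derivative_calculus T m rho phi x)]].

End gaussian.

(* Main.v *)
(* Write cal_m for assertion (iii) and GFS_m for (i). The equivalence follows
   from the three implications GFS_m => cal_m, cal_m => GFS_(m+1) and, for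
   m >= 1, GFS_(m+1) => GFS_m.

   GFS_m => cal_m: by Cauchy's formula and the resolvent identity,
   phi^(m)(T) = m!/(2 pi) int z phi(z) R(z, T)^(m+1) dt over any circle of radius
   s between 1 and r. With s = (rho + r)/2 and |phi| <= 1 the integrals in
   GFS_m bound the pairing of the vectors (r_k - 1)^m phi_k^(m)(T) x_k with
   functionals x_k^*; these are chosen by the Hahn-Banach theorem for the
   seminorm gamma on X^N.

   cal_m => GFS_(m+1): for n points z_j equally spaced on the circle of radius
   r, the mean of |z_j - z|^-2 tends to (r^2 - |z|^2)^-1, so that
   phi(z) = c (r^2 - 1)/n sum_j eps_j (z_j - z)^-2, |eps_j| = 1, is bounded by 1
   on the disc of radius (1 + r)/2. As phi^(m)(T) is a combination of the
   R(z_j, T)^(m+2), suitable phases eps_j make <phi^(m)(T) x, x^*> a Riemann sum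
   for the integral in GFS_(m+1).

   GFS_(m+1) => GFS_m: R(r e^it)^(m+1) is the integral of
   (m+1) e^it R(s e^it)^(m+2) over s > r, and 1/(s - 1)^(m+1) is integrable
   there. *)

From HB Require Import structures.
Require Import Defs.
From mathcomp Require Import all_boot all_order all_algebra complex ring lra.
From mathcomp Require Import measurable_realfun.
From mathcomp Require Import all_classical all_reals all_analysis.

Set Implicit Arguments.
Unset Strict Implicit.
Unset Printing Implicit Defensive.

Import Order.TTheory GRing.Theory Num.Theory.
Import numFieldNormedType.Exports.
Local Open Scope classical_set_scope.
Local Open Scope complex_scope.
Local Open Scope ring_scope.

(** * Norms *)

(** The integrals of [gamma_GFS] are traded for sums over n equally spaced points, with one n common
    to all k. At finitely many nodes the phases that make a pairing a sum of moduli are chosen one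
    by one, without measurable selection, and the test function is a finite combination of kernels
    (z_j - z)^-2 whose calculus is explicit. The radii r_k are unrelated, yet the hypothesis on
    GFS_(m+1) bounds only a sum over all k. In the descent to GFS_m one therefore writes s - 1 =
    (r_k - 1)(1 + tau): the weight becomes (1 + tau)^-(m+1), the same for every k, and for each tau
    the hypothesis applies to the N radii together. Summability in tau asks for m + 1 >= 2, whence m
    >= 1. The operator integral in the calculus converges in operator norm, so it is first
    identified with a pointwise vector integral; the complex analysis needed there is derived from
    Goursat's bisection in polar coordinates, where circles and annuli are rectangles. On the
    Gaussian side two facts matter: gamma is finite on X^N, and it vanishes only at 0. *)

Notation cabs z := (@rnorm _ (GRing.regular _) z).

Section RealNorm.
Context {R : realType}.
Implicit Types V : normedModType R[i].

Lemma half_gt0 (e : R) : 0 < e -> 0 < e / 2.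
Proof. by move=> ?; rewrite divr_gt0. Qed.

Lemma normE V (x : V) : `|x| = (rnorm x)%:C.
Proof. by rewrite /rnorm RRe_real. Qed.

Lemma rnorm_ge0 V (x : V) : 0 <= rnorm x.
Proof. by rewrite -ler0c -normE. Qed.

Lemma rnorm0 V : rnorm (0 : V) = 0.
Proof. by rewrite /rnorm normr0. Qed.

Lemma rnorm_eq0 V (x : V) : rnorm x = 0 -> x = 0.
Proof. by move=> h; apply/normr0_eq0; rewrite normE h. Qed.

Lemma rnormN V (x : V) : rnorm (- x) = rnorm x.
Proof. by rewrite /rnorm normrN. Qed.

Lemma rnormD V (x y : V) : rnorm (x + y) <= rnorm x + rnorm y.
Proof. by rewrite -lecR rmorphD /= -!normE ler_normD. Qed.

Lemma rnormB V (x y : V) : rnorm (x - y) <= rnorm x + rnorm y.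
Proof. by rewrite -(rnormN y) rnormD. Qed.

Lemma rdistC V (x y : V) : rnorm (x - y) = rnorm (y - x).
Proof. by rewrite -rnormN opprB. Qed.

Lemma rdistD V (z x y : V) : rnorm (x - y) <= rnorm (x - z) + rnorm (z - y).
Proof. by rewrite -[x - y](subrKA z) rnormD. Qed.

Lemma rnorm_sub V (x y : V) : rnorm x - rnorm y <= rnorm (x - y).
Proof. by have := rnormD (x - y) y; rewrite subrK; lra. Qed.

Lemma rnorm_sub_abs V (x y : V) : `|rnorm x - rnorm y| <= rnorm (x - y).
Proof.
have := rnorm_sub x y; have := rnorm_sub y x; rewrite (rdistC y x).
by rewrite ler_norml; lra.
Qed.

Lemma rnormZ V (a : R[i]) (x : V) : rnorm (a *: x) = cabs a * rnorm x.
Proof. by apply: complexI; rewrite rmorphM /= -!normE normrZ. Qed.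

Lemma cabsM (a b : R[i]) : cabs (a * b) = cabs a * cabs b.
Proof. exact: (@rnormZ R[i]^o a b). Qed.

Lemma cabsC (a : R) : cabs a%:C = `|a|.
Proof.
apply: complexI; rewrite -normE normc_def /= expr0n /= addr0.
by rewrite sqrtr_sqr.
Qed.

Lemma cabsD (a b : R[i]) : cabs (a + b) <= cabs a + cabs b.
Proof. exact: (@rnormD R[i]^o a b). Qed.

Lemma cabsN (a : R[i]) : cabs (- a) = cabs a.
Proof. exact: (@rnormN R[i]^o a). Qed.

Lemma cdistC (a b : R[i]) : cabs (a - b) = cabs (b - a).
Proof. exact: (@rdistC R[i]^o a b). Qed.

Lemma cdistD (c a b : R[i]) : cabs (a - b) <= cabs (a - c) + cabs (c - b).
Proof. exact: (@rdistD R[i]^o c a b). Qed.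

Lemma cabs_sub (a b : R[i]) : cabs a - cabs b <= cabs (a - b).
Proof. exact: (@rnorm_sub R[i]^o a b). Qed.

Lemma cabs1 : cabs (1 : R[i]) = 1.
Proof. by rewrite (cabsC 1) normr1. Qed.

Lemma cabsX (a : R[i]) n : cabs (a ^+ n) = cabs a ^+ n.
Proof.
by elim: n => [|n IH]; rewrite ?expr0 ?cabs1 // !exprS cabsM IH.
Qed.

Lemma cabs_sqr (a : R[i]) : cabs a ^+ 2 = complex.Re a ^+ 2 + complex.Im a ^+ 2.
Proof. by apply: complexI; rewrite rmorphXn /= -normE add_Re2_Im2. Qed.

Lemma cabs_eq0 (a : R[i]) : (cabs a == 0) = (a == 0).
Proof.
apply/eqP/eqP => [|->]; last exact: rnorm0.
exact: (@rnorm_eq0 R[i]^o).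
Qed.

Lemma cabs_gt0 (a : R[i]) : a != 0 -> 0 < cabs a.
Proof. by move=> a0; rewrite lt0r cabs_eq0 a0 rnorm_ge0. Qed.

Lemma cabsV (a : R[i]) : cabs a^-1 = (cabs a)^-1.
Proof.
have [->|a0] := eqVneq a 0; first by rewrite invr0 rnorm0 invr0.
have := cabsM a a^-1; rewrite mulfV // cabs1 => /esym h.
by apply: (mulfI (lt0r_neq0 (cabs_gt0 a0))); rewrite h mulfV // cabs_eq0.
Qed.

Lemma rnormZr V (a : R) (x : V) : 0 <= a -> rnorm (a%:C *: x) = a * rnorm x.
Proof. by move=> a0; rewrite rnormZ cabsC ger0_norm. Qed.

Lemma cabs_Re (a : R[i]) : `|complex.Re a| <= cabs a.
Proof. by rewrite -lecR -normE normc_ge_Re. Qed.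

Lemma cabs_Im (a : R[i]) : `|complex.Im a| <= cabs a.
Proof.
rewrite -(@ler_pXn2r _ 2) ?nnegrE ?rnorm_ge0 //.
by rewrite cabs_sqr -normrX ger0_norm ?sqr_ge0 // lerDr sqr_ge0.
Qed.

Lemma cabs_leD (a : R[i]) : cabs a <= `|complex.Re a| + `|complex.Im a|.
Proof.
rewrite -(@ler_pXn2r _ 2) ?nnegrE ?rnorm_ge0 ?addr_ge0 //.
rewrite cabs_sqr sqrrD !real_normK ?num_real //.
have := mulr_ge0 (normr_ge0 (complex.Re a)) (normr_ge0 (complex.Im a)).
by rewrite mulr2n; lra.
Qed.

Lemma rnorm_sum V (I : Type) (s : seq I) (Q : pred I) (F : I -> V) :
  rnorm (\sum_(i <- s | Q i) F i) <= \sum_(i <- s | Q i) rnorm (F i).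
Proof.
elim/big_rec2 : _ => [|i y x _ h]; first by rewrite rnorm0.
by rewrite (le_trans (rnormD _ _)) // lerD2l.
Qed.

Lemma rnorm_le0 V (x : V) : (forall e : R, 0 < e -> rnorm x <= e) -> x = 0.
Proof.
move=> h; apply/rnorm_eq0/eqP; rewrite eq_le rnorm_ge0 andbT.
by apply/ler_addgt0Pr => e e0; rewrite add0r h.
Qed.

(** A property of a bare [normedModType], so that one integral serves both for X and for the scalars
    [R[i]^o]. *)
Definition seq_complete V := forall u : nat -> V,
  (forall e : R, 0 < e -> exists N, forall n m, (N <= n)%N -> (N <= m)%N ->
     rnorm (u n - u m) <= e) ->
  exists l, forall e : R, 0 < e -> exists N, forall n, (N <= n)%N ->
     rnorm (u n - l) <= e.

Lemma complete_seq_complete (X : completeNormedModType R[i]) : seq_complete X.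
Proof.
move=> u cu.
have cu' : cauchy (u @ \oo).
  apply/cauchy_ballP => /= e e0.
  have [N hN] : exists N, forall n m, (N <= n)%N -> (N <= m)%N ->
      rnorm (u n - u m) <= complex.Re e / 2.
    by apply: cu; move: e0; rewrite ltcE /= => /andP[_ ?]; rewrite divr_gt0.
  exists ([set x | exists2 n, (N <= n)%N & u n = x],
          [set x | exists2 n, (N <= n)%N & u n = x]).
    split; exists N => // n /= Nn; exists n => //.
  move=> [_ _] [/= [n Nn <-] [m Nm <-]].
  rewrite -ball_normE /= normE; move: e0; rewrite ltcE /= => /andP[/eqP ei er].
  rewrite ltcE /= ei eqxx /=; apply: (le_lt_trans (hN _ _ Nn Nm)).
  by rewrite ltr_pdivrMr // ltr_pMr // ltr1n.
have /cvg_ex[l ul] : cvg (u @ \oo) by exact: cauchy_cvg.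
exists l => e e0; move/cvgrPdist_le : ul => /(_ e%:C).
rewrite ltcR => /(_ e0)[N _ hN]; exists N => n Nn.
by have := hN n Nn; rewrite /= normE lecR rdistC.
Qed.

Lemma real_seq_complete (u : nat -> R) :
  (forall e : R, 0 < e -> exists N, forall n m, (N <= n)%N -> (N <= m)%N ->
     `|u n - u m| <= e) ->
  exists l, forall e : R, 0 < e -> exists N, forall n, (N <= n)%N ->
     `|u n - l| <= e.
Proof.
move=> cu.
have cu' : cauchy (u @ \oo).
  apply/cauchy_ballP => /= e e0.
  have [N hN] := cu (e / 2) (half_gt0 e0).
  exists ([set x | exists2 n, (N <= n)%N & u n = x],
          [set x | exists2 n, (N <= n)%N & u n = x]).
    split; exists N => // n /= Nn; exists n => //.
  move=> [_ _] [/= [n Nn <-] [m Nm <-]].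
  rewrite -ball_normE /=; apply: (le_lt_trans (hN _ _ Nn Nm)).
  by rewrite ltr_pdivrMr // ltr_pMr // ltr1n.
have /cvg_ex[l ul] : cvg (u @ \oo) by exact: cauchy_cvg.
exists l => e e0; move/cvgrPdist_le : ul => /(_ e e0)[N _ hN].
by exists N => n Nn; have := hN n Nn; rewrite /= distrC.
Qed.

Lemma scalar_seq_complete : seq_complete (GRing.regular R[i]).
Proof.
move=> u cu.
have [a ha] : exists l, forall e : R, 0 < e -> exists N, forall n, (N <= n)%N ->
    `|complex.Re (u n) - l| <= e.
  apply: real_seq_complete => e /cu[N hN]; exists N => n m Nn Nm.
  have := hN n m Nn Nm; apply: le_trans.
  by have := cabs_Re (u n - u m : R[i]); case: (u n); case: (u m).
have [b hb] : exists l, forall e : R, 0 < e -> exists N, forall n, (N <= n)%N ->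
    `|complex.Im (u n) - l| <= e.
  apply: real_seq_complete => e /cu[N hN]; exists N => n m Nn Nm.
  have := hN n m Nn Nm; apply: le_trans.
  by have := cabs_Im (u n - u m : R[i]); case: (u n); case: (u m).
exists (a +i* b) => e e0.
have [N1 h1] := ha (e / 2) (half_gt0 e0).
have [N2 h2] := hb (e / 2) (half_gt0 e0).
exists (maxn N1 N2) => n; rewrite geq_max => /andP[n1 n2].
apply: (le_trans (cabs_leD _)).
have := h1 n n1; have := h2 n n2; case: (u n) => x y /=; lra.
Qed.

End RealNorm.

(** * A Riemann integral for vector-valued functions *)

Section BoxInduction.
Context {R : realType}.
Implicit Types P : R -> R -> R -> R -> Prop.

(** A quarter on which P fails. The fourth is the default: it is reached when P holds on the other
    three, so that P must fail there if it fails on the whole. *)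
Let quarter P (q : R * R * R * R) : R * R * R * R :=
  let: (a, b, c, d) := q in
  let m := (a + b) / 2 in let n := (c + d) / 2 in
  if pselect (P a m c n) is right _ then (a, m, c, n) else
  if pselect (P m b c n) is right _ then (m, b, c, n) else
  if pselect (P a m n d) is right _ then (a, m, n, d) else (m, b, n, d).

Lemma nested_point (a b : nat -> R) : (forall n, a n <= b n) ->
  (forall n, a n <= a n.+1) -> (forall n, b n.+1 <= b n) ->
  exists x, forall n, a n <= x <= b n.
Proof.
move=> ab ai bd.
have ai' n k : a n <= a (n + k)%N.
  by elim: k => [|k IH]; rewrite ?addn0 // addnS (le_trans IH).
have bd' n k : b (n + k)%N <= b n.
  by elim: k => [|k IH]; rewrite ?addn0 // addnS (le_trans _ IH).
have anb n m : a n <= b m.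
  by rewrite (le_trans (ai' n m)) // (le_trans (ab _)) // addnC bd'.
exists (sup (range a)) => n; apply/andP; split.
  apply: ub_le_sup; last by exists n.
  by exists (b 0%N) => _ [k _ <-].
apply: ge_sup; first by exists (a 0%N), 0%N.
by move=> _ [k _ <-].
Qed.

(** If P failed, it would fail on a nested sequence of quarters; these shrink to a point (x, y), and
    the local hypothesis at that point is contradicted by a small enough box. The local hypothesis
    concerns only boxes that contain (x, y) and stay in the given one. *)
Lemma box_ind P (a b c d : R) : a <= b -> c <= d ->
  (forall a b c d, a <= b -> c <= d ->
    P a ((a + b) / 2) c ((c + d) / 2) -> P ((a + b) / 2) b c ((c + d) / 2) ->
    P a ((a + b) / 2) ((c + d) / 2) d -> P ((a + b) / 2) b ((c + d) / 2) d ->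
    P a b c d) ->
  (forall x y, a <= x <= b -> c <= y <= d -> exists2 e : R, 0 < e &
    forall a' b' c' d', a <= a' -> a' <= x <= b' -> b' <= b ->
      c <= c' -> c' <= y <= d' -> d' <= d ->
      b' - a' < e -> d' - c' < e -> P a' b' c' d') ->
  P a b c d.
Proof.
move=> ab cd Pq Pl; apply: contrapT => nP.
pose Q n := iter n (quarter P) (a, b, c, d).
pose An n := (Q n).1.1.1; pose Bn n := (Q n).1.1.2.
pose Cn n := (Q n).1.2; pose Dn n := (Q n).2.
have QE n : Q n = (An n, Bn n, Cn n, Dn n).
  by rewrite /An /Bn /Cn /Dn; case: (Q n) => [[[]]].
have step n : [/\ An n <= Bn n, Cn n <= Dn n & ~ P (An n) (Bn n) (Cn n) (Dn n)] ->
   [/\ ~ P (An n.+1) (Bn n.+1) (Cn n.+1) (Dn n.+1),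
      An n <= An n.+1, Bn n.+1 <= Bn n, Cn n <= Cn n.+1 & Dn n.+1 <= Dn n] /\
    (Bn n.+1 - An n.+1 = (Bn n - An n) / 2 /\
     Dn n.+1 - Cn n.+1 = (Dn n - Cn n) / 2).
  move=> [abn cdn nPn].
  have : Q n.+1 = quarter P (Q n) by [].
  rewrite [Q n]QE [Q n.+1]QE /quarter.
  case: pselect => h1; last by case=> -> -> -> ->; split; split => //; lra.
  case: pselect => h2; last by case=> -> -> -> ->; split; split => //; lra.
  case: pselect => h3; last by case=> -> -> -> ->; split; split => //; lra.
  case: (pselect (P ((An n + Bn n) / 2) (Bn n) ((Cn n + Dn n) / 2) (Dn n))) => h4.
    by exfalso; apply: nPn; apply: Pq.
  by case=> -> -> -> ->; split; split => //; lra.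
have inv n : [/\ An n <= Bn n, Cn n <= Dn n & ~ P (An n) (Bn n) (Cn n) (Dn n)].
  elim: n => [//|n IH]; have [[? ? ? ? ?] [? ?]] := step n IH.
  by case: IH => ? ? ?; split => //; lra.
have st n := step n (inv n).
have [x hx] : exists x, forall n, An n <= x <= Bn n.
  by apply: nested_point => n; [case: (inv n) | case: (st n) => -[] | case: (st n) => -[]].
have [y hy] : exists x, forall n, Cn n <= x <= Dn n.
  by apply: nested_point => n; [case: (inv n) | case: (st n) => -[] | case: (st n) => -[]].
have [e e0 he] := Pl x y (hx 0%N) (hy 0%N).
have len n : Bn n - An n = (b - a) / 2 ^+ n /\ Dn n - Cn n = (d - c) / 2 ^+ n.
  elim: n => [|n [IH1 IH2]]; first by rewrite expr0 !divr1.
  have [_ [-> ->]] := st n; rewrite IH1 IH2 exprS invfM.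
  by split; ring.
have mon n : [/\ a <= An n, Bn n <= b, c <= Cn n & Dn n <= d].
  elim: n => [|n [? ? ? ?]]; first by rewrite /An /Bn /Cn /Dn /=.
  by have [[_ ? ? ? ?] _] := st n; split; lra.
have [n hn] : exists n, (b - a + (d - c) + 1) / 2 ^+ n < e.
  have p0 : 0 < b - a + (d - c) + 1 by lra.
  have [n hn] : exists n : nat, (b - a + (d - c) + 1) / e < n%:R.
    by exists (Num.bound ((b - a + (d - c) + 1) / e)); apply: archi_boundP;
       rewrite divr_ge0 // ltW.
  exists n; rewrite ltr_pdivrMr ?exprn_gt0 // mulrC -ltr_pdivrMr //.
  by rewrite (lt_trans hn) // -natrX ltr_nat ltn_expl.
have [m1 m2 m3 m4] := mon n; have [l1 l2] := len n.
have i0 : 0 < (2 ^+ n)^-1 :> R by rewrite invr_gt0 exprn_gt0.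
have ba : 0 <= (b - a) / 2 ^+ n by rewrite mulr_ge0 ?subr_ge0 // ltW.
have dc : 0 <= (d - c) / 2 ^+ n by rewrite mulr_ge0 ?subr_ge0 // ltW.
rewrite 2!mulrDl mul1r in hn.
by have [_ _ []] := inv n; apply: he => //; rewrite ?l1 ?l2; lra.
Qed.

End BoxInduction.

(** * Primitives, Riemann sums and existence of the integral *)

Section Integral.
Context {R : realType} {V : normedModType R[i]}.
Implicit Types (f g : R -> V) (H K : R -> V) (a b e : R).

(* [H] is a primitive of [f] up to uniformly small increments: telescoping it
   over any fine tagged partition controls the Riemann sums of [f]. *)
Definition near_prim f a b (e dl : R) H := forall u x w, a <= u -> u <= x ->
  x <= w -> w <= b -> w - u < dl ->
  rnorm (H w - H u - (w - u)%:C *: f x) <= e * (w - u).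

Definition is_prim f a b H :=
  forall e, 0 < e -> exists2 dl, 0 < dl & near_prim f a b e dl H.

Definition ucont f a b := forall e, 0 < e -> exists2 dl, 0 < dl &
  forall u w, a <= u <= b -> a <= w <= b -> `|u - w| < dl -> rnorm (f u - f w) <= e.

Definition rsum f n (s xi : nat -> R) : V :=
  \sum_(i < n) (s i.+1 - s i)%:C *: f (xi i).

Lemma partition_bounds a b dl n s xi k : tagged_partition a b dl n s xi ->
  (k <= n)%N -> a <= s k <= b.
Proof.
move=> [s0 sn st] kn; have step i : (i < n)%N -> s i <= s i.+1.
  by move=> /st[/andP[h1 h2] _]; exact: le_trans h2.
apply/andP; split.
  elim: k kn => [|k IH] kn; first by rewrite s0.
  exact: le_trans (IH (ltnW kn)) (step k kn).
rewrite -(subKn kn); elim: (n - k)%N (leq_subr k n) => [|j IH] jn.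
  by rewrite subn0 sn.
by apply: le_trans (IH (ltnW jn)); rewrite -[in leRHS]subSS subSn // step // ltn_subrL (leq_trans _ jn).
Qed.

Lemma near_prim_rsum f a b e dl H n s xi : near_prim f a b e dl H ->
  tagged_partition a b dl n s xi ->
  rnorm (H b - H a - rsum f n s xi) <= e * (b - a).
Proof.
move=> hH tp; have [s0 sn st] := tp.
have -> : H b - H a - rsum f n s xi = \sum_(0 <= i < n)
    (H (s i.+1) - H (s i) - (s i.+1 - s i)%:C *: f (xi i)).
  by rewrite sumrB telescope_sumr // s0 sn /rsum big_mkord.
have -> : e * (b - a) = \sum_(0 <= i < n) e * (s i.+1 - s i).
  by rewrite -mulr_sumr telescope_sumr // s0 sn.
apply: (le_trans (rnorm_sum _ _ _)); rewrite !big_mkord.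
apply: ler_sum => -[i ilt] _ /=.
have [/andP[h1 h2] h3] := st i ilt.
apply: hH => //; first by have /andP[] := partition_bounds tp (ltnW ilt).
by have /andP[] := partition_bounds tp ilt.
Qed.

Definition upt a b (n : nat) (i : nat) : R := a + i%:R * ((b - a) / n%:R).

Lemma upt_partition a b dl n : a <= b -> (0 < n)%N -> (b - a) / n%:R < dl ->
  tagged_partition a b dl n (upt a b n) (upt a b n).
Proof.
move=> ab n0 hn; rewrite /upt; split => [||i ilt].
- by rewrite mul0r addr0.
- by rewrite mulrC divfK ?pnatr_eq0 ?lt0n_neq0 // addrC subrK.
- have h0 : 0 <= (b - a) / n%:R by rewrite divr_ge0 ?subr_ge0.
  move: hn h0; set h := (b - a) / n%:R => hn h0.
  by rewrite -natr1 mulrDl mul1r; split; [apply/andP; split|]; lra.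
Qed.

Lemma upt_itv a b n i : a <= b -> (0 < n)%N -> (i <= n)%N ->
  a <= upt a b n i <= b.
Proof.
move=> ab n0 ilen; have l0 : 0 <= b - a by rewrite subr_ge0.
rewrite /upt lerDl mulr_ge0 ?divr_ge0 //= -lerBrDl mulrCA ler_piMr //.
by rewrite ler_pdivrMr ?ltr0n // mul1r ler_nat.
Qed.

Lemma ex_fine_mesh (c dl : R) : 0 <= c -> 0 < dl -> exists N, forall n,
  (N <= n)%N -> (0 < n)%N /\ c / n%:R < dl.
Proof.
move=> c0 dl0; exists (Num.bound (c / dl)).+1 => n hn.
have n0 : (0 < n)%N by apply: leq_trans hn.
split => //; rewrite ltr_pdivrMr ?ltr0n // mulrC -ltr_pdivrMr //.
rewrite (lt_le_trans (archi_boundP _)) ?divr_ge0 ?(ltW dl0) //.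
by rewrite ler_nat ltnW.
Qed.

Lemma near_primW f a b e dl dl' H : dl' <= dl ->
  near_prim f a b e dl H -> near_prim f a b e dl' H.
Proof. by move=> h hH u x w *; apply: hH => //; exact: lt_le_trans h. Qed.

Lemma near_prim_sub f a b c d e dl H : a <= c -> d <= b ->
  near_prim f a b e dl H -> near_prim f c d e dl H.
Proof.
by move=> ac db hH u x w cu ux xw wd; apply: hH => //; [exact: le_trans cu | exact: le_trans db].
Qed.

Lemma is_prim_sub f a b c d H : a <= c -> d <= b ->
  is_prim f a b H -> is_prim f c d H.
Proof.
by move=> ac db hH e /hH[dl dl0 h]; exists dl => //; exact: near_prim_sub h.
Qed.

(** Both increments are compared with one and the same Riemann sum. *)
Lemma near_prim_close f a b e dl H K : 0 < dl -> a <= b ->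
  near_prim f a b e dl H -> near_prim f a b e dl K ->
  rnorm (H b - H a - (K b - K a)) <= 2 * e * (b - a).
Proof.
move=> dl0 ab hH hK.
have [|N /(_ N (leqnn _))[N0 hN]] := @ex_fine_mesh (b - a) dl _ dl0.
  by rewrite subr_ge0.
have tp := upt_partition ab N0 hN.
have h1 := near_prim_rsum hH tp; have h2 := near_prim_rsum hK tp.
apply: (le_trans (rdistD (rsum f N (upt a b N) (upt a b N)) _ _)).
by rewrite (rdistC (rsum _ _ _ _)); lra.
Qed.

Lemma is_prim_unique f a b H K : a <= b -> is_prim f a b H -> is_prim f a b K ->
  H b - H a = K b - K a.
Proof.
move=> ab hH hK; apply/eqP; rewrite -subr_eq0; apply/eqP/rnorm_le0 => e e0.
pose e' := e / (2 * (b - a + 1)).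
have e'0 : 0 < e' by rewrite divr_gt0 // mulr_gt0 //; lra.
have [d1 d10 h1] := hH _ e'0; have [d2 d20 h2] := hK _ e'0.
pose dl := Num.min d1 d2.
have dl0 : 0 < dl by rewrite lt_min d10.
have := near_prim_close dl0 ab (near_primW _ h1) (near_primW _ h2).
rewrite !ge_min !lexx orbT => /(_ isT isT) /le_trans; apply.
have : 2 * e' * (b - a + 1) = e by rewrite /e'; field; lra.
by rewrite mulrDr mulr1; lra.
Qed.

(** Taking the increment of a primitive instead of a limit of sums makes linearity and additivity in
    the interval immediate; Riemann sums enter by telescoping. Without a primitive the value is
    unspecified. *)
Definition integ f a b : V :=
  get [set v | exists2 H, is_prim f a b H & v = H b - H a].

Definition has_integ f a b := exists H, is_prim f a b H.

Lemma integE f a b H : a <= b -> is_prim f a b H -> integ f a b = H b - H a.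
Proof.
move=> ab hH; rewrite /integ; have := @getPex V [set v | exists2 H, is_prim f a b H & v = H b - H a].
case; first by exists (H b - H a), H.
by move=> K hK ->; exact: is_prim_unique hK hH.
Qed.

(** The quantity [Num.min t s' - Num.min t s] is the length of the part of [s, s'] to the left of t,
    hence nondecreasing in t. *)
Lemma min_incr_ge0 (s s' u w : R) : s <= s' -> u <= w ->
  0 <= Num.min w s' - Num.min w s - (Num.min u s' - Num.min u s).
Proof.
move=> ss uw; rewrite /Num.min.
by case: (ltP w s); case: (ltP w s'); case: (ltP u s); case: (ltP u s'); lra.
Qed.

Lemma min_incr_eq0 (s s' u w : R) : s <= s' -> u <= w -> w <= s \/ s' <= u ->
  Num.min w s' - Num.min w s - (Num.min u s' - Num.min u s) = 0.
Proof.
move=> ss uw [ws|su].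
  by rewrite (min_idPl ws) !(min_idPl _) ?(le_trans uw) ?(le_trans ws) //; lra.
by rewrite (min_idPr su) !(min_idPr _) ?(le_trans _ uw) ?(le_trans ss su) //; lra.
Qed.

(* [stepprim f a b n] is the primitive vanishing at [a] of the step function
   with value [f] at the left end of each cell of the uniform mesh. *)
Definition stepprim f a b n (t : R) : V := \sum_(j < n)
  (Num.min t (upt a b n j.+1) - Num.min t (upt a b n j))%:C *: f (upt a b n j).

(** The increment over [u, w] is distributed over the cells that meet ]u, w[. The left end of such a
    cell is at distance less than [2 * dl] from x: one [dl] for the cell, one for [u, w]. *)
Lemma stepprim_near f a b e dl n : a <= b -> (0 < n)%N -> (b - a) / n%:R < dl ->
  (forall u w, a <= u <= b -> a <= w <= b -> `|u - w| < 2 * dl ->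
     rnorm (f u - f w) <= e) ->
  near_prim f a b e dl (stepprim f a b n).
Proof.
move=> ab n0 hn hf u x w au ux xw wb wu.
have [p0 pn pt] := upt_partition ab n0 hn.
pose c t j := Num.min t (upt a b n j.+1) - Num.min t (upt a b n j).
have cs t : a <= t <= b -> \sum_(j < n) c t j = t - a.
  move=> /andP[at_ tb]; rewrite -(big_mkord xpredT (c t)) telescope_sumr //.
  by rewrite p0 pn (min_idPr at_) (min_idPl tb).
have uw : u <= w by exact: le_trans xw.
have sw : w - u = \sum_(j < n) (c w j - c u j).
  by rewrite sumrB !cs //; [lra|apply/andP; split; lra|apply/andP; split; lra].
have -> : stepprim f a b n w - stepprim f a b n u - (w - u)%:C *: f x =
   \sum_(j < n) (c w j - c u j)%:C *: (f (upt a b n j) - f x).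
  rewrite sw rmorph_sum scaler_suml -!sumrB; apply: eq_bigr => j _.
  by rewrite -scalerBl -rmorphB -scalerBr.
rewrite sw mulr_sumr; apply: (le_trans (rnorm_sum _ _ _)).
apply: ler_sum => -[j jn] _ /=.
have [/andP[h0 h1] h2] := pt j jn.
have cge : 0 <= c w j - c u j.
  by apply: min_incr_ge0 => //; exact: le_trans h1.
rewrite rnormZr // mulrC; have [c0|c0] := eqVneq (c w j - c u j) 0.
  by rewrite c0 !mulr0.
apply: ler_wpM2r => //; apply: hf; first exact: upt_itv (ltnW jn).
  by apply/andP; split; lra.
have /andP[lo hi] : (upt a b n j < w) && (u < upt a b n j.+1).
  apply: contra_neqT c0; rewrite negb_and -!leNgt => /orP h.
  by apply: min_incr_eq0 => //; exact: le_trans h1.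
by rewrite ltr_norml; lra.
Qed.

End Integral.

Section IntegralTheory.
Context {R : realType} {V : normedModType R[i]}.
Implicit Types (f g : R -> V) (H K : R -> V) (a b e : R).

Lemma stepprim_a f a b n : a <= b -> stepprim f a b n a = 0.
Proof.
move=> ab; rewrite /stepprim big1 // => j _.
have up k : a <= upt a b n k.
  by rewrite /upt lerDl mulr_ge0 ?divr_ge0 ?subr_ge0.
by rewrite !(min_idPl (up _)) subrr scale0r.
Qed.

(** The step primitives vanish at a and are all near-primitives of f, so by [near_prim_close] they
    form a Cauchy sequence at every t; the pointwise limit inherits the estimate of [near_prim] with
    the same [dl]. *)
Lemma ucont_has_integ f a b : seq_complete V -> a <= b -> ucont f a b ->
  has_integ f a b.
Proof.
move=> cV ab uf.
have ba : 0 <= b - a by rewrite subr_ge0.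
have near e : 0 < e -> exists2 dl, 0 < dl & exists N, forall n, (N <= n)%N ->
    near_prim f a b e dl (stepprim f a b n).
  move=> e0; have [dl dl0 hdl] := uf e e0.
  exists (dl / 2); first exact: half_gt0.
  have [N hN] := ex_fine_mesh ba (half_gt0 dl0).
  exists N => n /hN[n0 hn]; apply: stepprim_near => // u w uab wab uw.
  by apply: hdl => //; apply: lt_le_trans uw _; rewrite mulrC divfK.
have cl t : a <= t <= b -> exists l, forall e, 0 < e -> exists N, forall n,
    (N <= n)%N -> rnorm (stepprim f a b n t - l) <= e.
  move=> /andP[at_ tb]; apply: cV => e e0.
  pose e' := e / (2 * (t - a + 1)).
  have e'0 : 0 < e' by rewrite divr_gt0 // mulr_gt0 //; lra.
  have [dl dl0 [N hN]] := near e' e'0; exists N => n m nN mN.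
  have := near_prim_close dl0 at_ (near_prim_sub (lexx a) tb (hN n nN))
     (near_prim_sub (lexx a) tb (hN m mN)).
  rewrite !stepprim_a // !subr0 => /le_trans; apply.
  have : 2 * e' * (t - a + 1) = e by rewrite /e'; field; lra.
  by rewrite mulrDr mulr1; lra.
pose lim_at t l := forall e, 0 < e -> exists N, forall n,
    (N <= n)%N -> rnorm (stepprim f a b n t - l) <= e.
pose H t := get (lim_at t).
have HP t : a <= t <= b -> lim_at t (H t) by move=> /cl; exact: getPex.
exists H => e e0; have [dl dl0 [N hN]] := near e e0; exists dl => //.
move=> u x w au ux xw wb wu; apply/ler_addgt0Pr => r r0.
have uab : a <= u <= b by rewrite au (le_trans ux) // (le_trans xw).
have wab : a <= w <= b by rewrite wb (le_trans au) // (le_trans ux).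
have [N1 h1] := HP u uab (r / 2) (half_gt0 r0).
have [N2 h2] := HP w wab (r / 2) (half_gt0 r0).
pose n := maxn N (maxn N1 N2).
have := h1 n; rewrite !leq_max leqnn orbT => /(_ isT) {}h1.
have := h2 n; rewrite !leq_max leqnn !orbT => /(_ isT) {}h2.
have := hN n; rewrite leq_max leqnn => /(_ isT _ x _ au ux xw wb wu) {}hN.
set Hn := stepprim f a b n in h1 h2 hN.
have -> : H w - H u - (w - u)%:C *: f x =
   (Hn w - Hn u - (w - u)%:C *: f x) - (Hn w - H w) + (Hn u - H u).
  by rewrite opprB [RHS](AC (3*2*2) ((4*7*3)*(1*5)*(2*6)))/= subrr addNr !addr0.
have := rnormD (Hn w - Hn u - (w - u)%:C *: f x - (Hn w - H w)) (Hn u - H u).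
have := rnormB (Hn w - Hn u - (w - u)%:C *: f x) (Hn w - H w).
lra.
Qed.

Lemma integ_split f a b c : a <= c -> c <= b -> has_integ f a b ->
  integ f a b = integ f a c + integ f c b.
Proof.
move=> ac cb [H hH].
rewrite (integE (le_trans ac cb) hH) (integE ac (is_prim_sub (lexx _) cb hH)).
by rewrite (integE cb (is_prim_sub ac (lexx _) hH)) [RHS]addrC subrKA.
Qed.

Lemma integ_riemann f a b e : a <= b -> has_integ f a b -> 0 < e ->
  exists2 dl, 0 < dl & forall n s xi, tagged_partition a b dl n s xi ->
    rnorm (integ f a b - rsum f n s xi) <= e.
Proof.
move=> ab [H hH] e0.
pose e' := e / (b - a + 1).
have e'0 : 0 < e' by rewrite divr_gt0 //; lra.
have [dl dl0 h] := hH _ e'0; exists dl => // n s xi tp.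
rewrite (integE ab hH) (le_trans (near_prim_rsum h tp)) //.
have : e' * (b - a + 1) = e by rewrite /e'; field; lra.
by rewrite mulrDr mulr1; lra.
Qed.

Lemma partition_inside a b dl n s xi i : tagged_partition a b dl n s xi ->
  (i < n)%N -> a <= xi i <= b.
Proof.
move=> tp ilt; have [_ _ /(_ i ilt)[/andP[h1 h2] _]] := tp.
have /andP[lo _] := partition_bounds tp (ltnW ilt).
have /andP[_ hi] := partition_bounds tp ilt.
by rewrite (le_trans lo h1) (le_trans h2).
Qed.

Lemma rsum_norm_le f a b dl M n s xi : tagged_partition a b dl n s xi ->
  (forall t, a <= t <= b -> rnorm (f t) <= M) ->
  rnorm (rsum f n s xi) <= M * (b - a).
Proof.
move=> tp hM; have [s0 sn st] := tp.
have -> : M * (b - a) = \sum_(i < n) M * (s i.+1 - s i).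
  rewrite -(big_mkord xpredT (fun i => M * (s i.+1 - s i))).
  by rewrite -mulr_sumr telescope_sumr // s0 sn.
apply: (le_trans (rnorm_sum _ _ _)); apply: ler_sum => -[i ilt] _ /=.
have [/andP[h1 h2] _] := st i ilt.
have h : 0 <= s i.+1 - s i by rewrite subr_ge0 (le_trans h1).
by rewrite rnormZr // mulrC ler_wpM2r // hM // (partition_inside tp).
Qed.

Lemma ex_partition a b dl : a <= b -> 0 < dl ->
  exists n s xi, tagged_partition a b dl n s xi.
Proof.
move=> ab dl0; have ba : 0 <= b - a by rewrite subr_ge0.
have [N /(_ N (leqnn _))[N0 hN]] := ex_fine_mesh ba dl0.
by exists N, (upt a b N), (upt a b N); exact: upt_partition.
Qed.

Lemma integ_norm_le f a b M : a <= b -> has_integ f a b ->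
  (forall t, a <= t <= b -> rnorm (f t) <= M) ->
  rnorm (integ f a b) <= M * (b - a).
Proof.
move=> ab hf hM; apply/ler_addgt0Pr => e e0.
have [dl dl0 h] := integ_riemann ab hf e0.
have [n [s [xi tp]]] := ex_partition ab dl0.
have := h n s xi tp; have := rsum_norm_le tp hM.
by have := rnorm_sub (integ f a b) (rsum f n s xi); lra.
Qed.

Lemma is_primD f g a b H K : is_prim f a b H -> is_prim g a b K ->
  is_prim (fun t => f t + g t) a b (fun t => H t + K t).
Proof.
move=> hH hK e e0.
have [d1 d10 h1] := hH _ (half_gt0 e0); have [d2 d20 h2] := hK _ (half_gt0 e0).
exists (Num.min d1 d2); first by rewrite lt_min d10.
move=> u x w au ux xw wb; rewrite lt_min => /andP[w1 w2].
have -> : H w + K w - (H u + K u) - (w - u)%:C *: (f x + g x) =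
  (H w - H u - (w - u)%:C *: f x) + (K w - K u - (w - u)%:C *: g x).
  by rewrite scalerDr opprD addrACA opprD (addrACA (H w - H u)).
have := h1 u x w au ux xw wb w1; have := h2 u x w au ux xw wb w2.
have := rnormD (H w - H u - (w - u)%:C *: f x) (K w - K u - (w - u)%:C *: g x).
have -> : e * (w - u) = e / 2 * (w - u) + e / 2 * (w - u) by field.
lra.
Qed.

Lemma eq_is_prim f g a b H : (forall t, a <= t <= b -> f t = g t) ->
  is_prim f a b H -> is_prim g a b H.
Proof.
move=> fg hH e /hH[dl dl0 h]; exists dl => // u x w au ux xw wb wu.
by rewrite -fg; [exact: h|rewrite (le_trans au ux) (le_trans xw wb)].
Qed.

Lemma eq_integ f g a b : a <= b -> (forall t, a <= t <= b -> f t = g t) ->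
  integ f a b = integ g a b.
Proof.
move=> ab fg; rewrite /integ; congr get; apply/seteqP; split => v [H hH ->];
  exists H => //; apply: eq_is_prim hH => // t tab; exact/esym/fg.
Qed.

Lemma is_prim_cst c a b : is_prim (fun _ : R => c : V) a b (fun t => t%:C *: c).
Proof.
move=> e e0; exists 1 => // u x w au ux xw wb wu.
rewrite -scalerBl rmorphB /= subrr rnorm0 mulr_ge0 ?(ltW e0) //.
by rewrite subr_ge0 (le_trans ux).
Qed.

Lemma integ_cst c a b : a <= b -> integ (fun _ : R => c : V) a b = (b - a)%:C *: c.
Proof. by move=> ab; rewrite (integE ab (is_prim_cst _ _ _)) -scalerBl rmorphB. Qed.

End IntegralTheory.

Section IntegralMaps.
Context {R : realType} {V W : normedModType R[i]}.

Lemma bounded_linear0 (A : V -> W) : linear A -> A 0 = 0.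
Proof.
move=> lA; pose LA := GRing.isLinear.Build _ _ _ _ A lA.
by have := linear0 (HB.pack A LA : {linear V -> W}).
Qed.

Lemma linear_sub (A : V -> W) : linear A -> forall x y, A (x - y) = A x - A y.
Proof.
move=> lA; pose LA := GRing.isLinear.Build _ _ _ _ A lA.
exact: (linearB (HB.pack A LA : {linear V -> W})).
Qed.

Lemma linear_add (A : V -> W) : linear A -> forall x y, A (x + y) = A x + A y.
Proof.
move=> lA; pose LA := GRing.isLinear.Build _ _ _ _ A lA.
exact: (linearD (HB.pack A LA : {linear V -> W})).
Qed.

Lemma linear_scale (A : V -> W) : linear A -> forall c x, A (c *: x) = c *: A x.
Proof. by move=> lA c x; rewrite -[c *: x]addr0 lA bounded_linear0 // addr0. Qed.

Lemma linear_bigsum (A : V -> W) : linear A -> forall (I : Type) (s : seq I) (F : I -> V),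
  A (\sum_(i <- s) F i) = \sum_(i <- s) A (F i).
Proof.
move=> lA; pose LA := GRing.isLinear.Build _ _ _ _ A lA.
move=> I s F; exact: (linear_sum (HB.pack A LA : {linear V -> W})).
Qed.

Lemma is_prim_comp (A : V -> W) (f H : R -> V) (a b : R) :
  bounded_linear A -> is_prim f a b H -> is_prim (A \o f) a b (A \o H).
Proof.
move=> [lA [M hM]] hH e e0.
pose M' := `|M| + 1.
have M'0 : 0 < M' by rewrite /M'; have := normr_ge0 M; lra.
have [dl dl0 h] := hH (e / M') (divr_gt0 e0 M'0).
exists dl => // u x w au ux xw wb wu.
have -> : (A \o H) w - (A \o H) u - (w - u)%:C *: (A \o f) x =
    A (H w - H u - (w - u)%:C *: f x).
  by rewrite /= !linear_sub // linear_scale.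
apply: le_trans (hM _) _.
have := h u x w au ux xw wb wu; set z := rnorm _ => hz.
have z0 : 0 <= z := rnorm_ge0 _.
have MM : M <= M' by rewrite /M'; have := ler_norm M; lra.
apply: le_trans (ler_wpM2r z0 MM) _.
by rewrite -ler_pdivlMl // mulrC mulrAC.
Qed.

Lemma has_integ_comp (A : V -> W) (f : R -> V) (a b : R) :
  bounded_linear A -> has_integ f a b -> has_integ (A \o f) a b.
Proof. by move=> bA [H hH]; exists (A \o H); exact: is_prim_comp. Qed.

Lemma integ_comp (A : V -> W) (f : R -> V) (a b : R) : a <= b ->
  bounded_linear A -> has_integ f a b -> integ (A \o f) a b = A (integ f a b).
Proof.
move=> ab bA [H hH]; rewrite (integE ab hH) (integE ab (is_prim_comp bA hH)).
by rewrite linear_sub //; case: bA.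
Qed.

End IntegralMaps.

Section IntegralLinear.
Context {R : realType} {V : normedModType R[i]}.
Implicit Types (f g : R -> V) (a b : R).

Lemma scale_bounded_linear (c : R[i]) : bounded_linear (fun x : V => c *: x).
Proof.
split=> [k x y|]; first by rewrite scalerDr !scalerA mulrC.
by exists (cabs c) => x; rewrite rnormZ.
Qed.

Lemma has_integZ f a b c : has_integ f a b -> has_integ (fun t => c *: f t) a b.
Proof. exact: has_integ_comp (scale_bounded_linear c). Qed.

Lemma has_integD f g a b : has_integ f a b -> has_integ g a b ->
  has_integ (fun t => f t + g t) a b.
Proof. by move=> [H hH] [K hK]; exists (fun t => H t + K t); exact: is_primD. Qed.

Lemma integZ f a b c : a <= b -> has_integ f a b ->
  integ (fun t => c *: f t) a b = c *: integ f a b.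
Proof. move=> ab; exact: (integ_comp ab (scale_bounded_linear c)). Qed.

Lemma integD f g a b : a <= b -> has_integ f a b -> has_integ g a b ->
  integ (fun t => f t + g t) a b = integ f a b + integ g a b.
Proof.
move=> ab [H hH] [K hK]; rewrite (integE ab hH) (integE ab hK).
by rewrite (integE ab (is_primD hH hK)) opprD addrACA.
Qed.

Lemma has_integB f g a b : has_integ f a b -> has_integ g a b ->
  has_integ (fun t => f t - g t) a b.
Proof.
move=> hf /(has_integZ (-1)) hg.
have -> : (fun t => f t - g t) = (fun t => f t + -1 *: g t).
  by apply/funext => t; rewrite scaleN1r.
exact: has_integD.
Qed.

Lemma integB f g a b : a <= b -> has_integ f a b -> has_integ g a b ->
  integ (fun t => f t - g t) a b = integ f a b - integ g a b.
Proof.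
move=> ab hf hg.
have -> : (fun t => f t - g t) = (fun t => f t + -1 *: g t).
  by apply/funext => t; rewrite scaleN1r.
by rewrite integD ?integZ ?scaleN1r //; exact: has_integZ.
Qed.

End IntegralLinear.

(** * Cauchy's theorem in polar coordinates *)

Section Expi.
Context {R : realType}.
Implicit Types (a b h t : R).

(** Box induction whose second side is the degenerate interval [0, 0]. *)
Lemma seg_ind (Q : R -> R -> Prop) a b : a <= b ->
  (forall a b, a <= b -> Q a ((a + b) / 2) -> Q ((a + b) / 2) b -> Q a b) ->
  (forall x, a <= x <= b -> exists2 e : R, 0 < e &
    forall a' b', a <= a' -> a' <= x <= b' -> b' <= b -> b' - a' < e -> Q a' b') ->
  Q a b.
Proof.
move=> ab Qm Ql.
apply: (@box_ind _ (fun c d _ _ => Q c d) a b 0 0 ab (lexx _)).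
- by move=> c d _ _ cd _ q1 q2 _ _; exact: Qm.
- move=> x y xab _; have [e e0 h] := Ql x xab.
  by exists e => // *; exact: h.
Qed.

Lemma expiD a b : expi (a + b) = expi a * expi b.
Proof.
rewrite /expi cosD sinD; apply/eqP; rewrite eq_complex /=.
by rewrite eqxx /= addrC eqxx.
Qed.

Lemma expi0 : expi 0 = 1 :> R[i].
Proof. by rewrite /expi cos0 sin0. Qed.

Lemma expi2pi : expi (2 * pi) = 1 :> R[i].
Proof. by rewrite /expi mulr_natl cos2pi sin2pi. Qed.

Lemma cabs_expi t : cabs (expi t) = 1.
Proof.
apply/eqP; rewrite -(@eqrXn2 _ 2) ?rnorm_ge0 //.
by rewrite cabs_sqr /= cos2Dsin2 expr1n.
Qed.

Lemma expi_neq0 t : expi t != 0.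
Proof. by rewrite -cabs_eq0 cabs_expi oner_eq0. Qed.

Lemma sin_abs_le h : `|sin h| <= `|h|.
Proof.
have key (x : R) : 0 <= x -> `|sin x| <= x.
  move=> x0; have [|c _] := @MVT_segment R sin cos 0 x x0.
    by apply: continuous_subspaceT => y; exact: continuous_sin.
  rewrite sin0 !subr0 => ->; rewrite normrM (ger0_norm x0) ler_piMl //.
  exact: cos_max.
have [h0|h0] := leP 0 h; first by rewrite (ger0_norm h0) key.
by rewrite -normrN -sinN -[leRHS]normrN (ger0_norm (_ : 0 <= - h)) ?key //; lra.
Qed.

Lemma cos_sub1_le h : `|cos h - 1| <= h ^+ 2 / 2.
Proof.
have -> : cos h - 1 = - (sin (h / 2) ^+ 2 *+ 2).
  by rewrite {1}(splitr h) cosD -!expr2; have := cos2Dsin2 (h / 2); lra.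
rewrite normrN ger0_norm ?mulrn_wge0 ?sqr_ge0 //.
have : `|sin (h / 2)| ^+ 2 <= `|h / 2| ^+ 2.
  by rewrite ler_pXn2r ?nnegrE // sin_abs_le.
rewrite !real_normK ?num_real // => hh.
by apply: le_trans (_ : (h / 2) ^+ 2 *+ 2 <= _); [rewrite lerMn2r hh orbT|lra].
Qed.

Lemma sin_sub_le h : `|sin h - h| <= h ^+ 2.
Proof.
have key (x : R) : 0 <= x -> `|sin x - x| <= x ^+ 2.
  move=> x0; pose F := fun y : R => sin y - y.
  have [|c] := @MVT_segment R F (fun y => cos y - 1) 0 x x0.
    apply: continuous_subspaceT => y.
    by apply: cvgB; [exact: continuous_sin|exact: cvg_id].
  rewrite in_itv /= => /andP[c0 cx]; rewrite /F sin0 !subr0 => ->.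
  rewrite normrM (ger0_norm x0) expr2 ler_wpM2r //.
  have [x2|x2] := leP x 2.
    apply: (le_trans (cos_sub1_le c)).
    by apply: (@le_trans _ _ (x * x / 2)); [rewrite ler_wpM2r // expr2 ler_pM|nra].
  have := cos_max c; rewrite ler_norml => /andP[h1 h2].
  by rewrite ler_norml; lra.
have [h0|h0] := leP 0 h; first exact: key.
have := key (- h); rewrite sinN sqrrN -opprD normrN; apply; lra.
Qed.

Lemma expi_diff2 h : cabs (expi h - 1 - 'i%C * h%:C) <= 2 * h ^+ 2.
Proof.
apply: (le_trans (cabs_leD _)).
have -> : complex.Re (expi h - 1 - 'i%C * h%:C) = cos h - 1.
  by rewrite /expi; simpc.
have -> : complex.Im (expi h - 1 - 'i%C * h%:C) = sin h - h.
  by rewrite /expi; simpc.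
have := sin_sub_le h; have := cos_sub1_le h; have := sqr_ge0 h; lra.
Qed.

(** With h = a - b, |expi h - 1|^2 = 2 (1 - cos h) <= h^2. *)
Lemma expi_lip a b : cabs (expi a - expi b) <= `|a - b|.
Proof.
have -> : expi a - expi b = expi b * (expi (a - b) - 1).
  by rewrite mulrBr mulr1 -expiD [b + _]addrC subrK.
rewrite cabsM cabs_expi mul1r -(@ler_pXn2r _ 2) ?nnegrE ?rnorm_ge0 //.
rewrite cabs_sqr real_normK ?num_real //; set h := a - b.
have -> : complex.Re (expi h - 1) = cos h - 1 by rewrite /expi; simpc.
have -> : complex.Im (expi h - 1) = sin h by rewrite /expi; simpc.
have := cos2Dsin2 h; have := cos_sub1_le h; rewrite ler_norml => /andP[h1 h2].
rewrite sqrrB1; lra.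
Qed.

End Expi.

(** * Continuity, complex differentiability and integrals along curves *)

Section Curves.
Context {R : realType} {V : normedModType R[i]}.
Implicit Types (f : R[i] -> V).

Definition ccont f (z : R[i]) := forall e : R, 0 < e -> exists2 dl : R, 0 < dl &
  forall w, cabs (w - z) < dl -> rnorm (f w - f z) <= e.

Definition cdiff f (z : R[i]) := exists B : V, forall e : R, 0 < e ->
  exists2 dl : R, 0 < dl & forall w, cabs (w - z) < dl ->
    rnorm (f w - f z - (w - z) *: B) <= e * cabs (w - z).

Lemma cdiff_ccont f z : cdiff f z -> ccont f z.
Proof.
move=> [B hB] e e0; have [dl dl0 h] := hB 1 ltr01.
pose K := rnorm B + 1; have K0 : 0 < K.
  by rewrite /K; have := rnorm_ge0 B; lra.
exists (Num.min dl (e / K)); first by rewrite lt_min dl0 divr_gt0.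
move=> w; rewrite lt_min => /andP[w1 w2].
have := h w w1; rewrite mul1r => h1.
have := rnormD (f w - f z - (w - z) *: B) ((w - z) *: B); rewrite subrK rnormZ.
move: w2; rewrite ltr_pdivlMr // /K mulrDr mulr1; lra.
Qed.

(** Box induction on the set of pairs (u, w). Near a diagonal point continuity gives the estimate;
    near an off-diagonal point no pair is close together, so a third of |x - y| serves as
    modulus. *)
Lemma cont_ucont (f : R -> V) (a b : R) : a <= b ->
  (forall x, a <= x <= b -> forall e : R, 0 < e -> exists2 dl : R, 0 < dl &
     forall u, a <= u <= b -> `|u - x| < dl -> rnorm (f u - f x) <= e) ->
  ucont f a b.
Proof.
move=> ab hf e e0.
pose P (a1 b1 c1 d1 : R) := exists2 dl : R, 0 < dl & forall u w,
   a1 <= u <= b1 -> c1 <= w <= d1 -> `|u - w| < dl -> rnorm (f u - f w) <= e.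
suff : P a b a b by [].
apply: box_ind => // [a1 b1 c1 d1 ab1 cd1|x y xab yab].
  move=> [d2 p2 h2] [d3 p3 h3] [d4 p4 h4] [d5 p5 h5].
  exists (Num.min (Num.min d2 d3) (Num.min d4 d5)); first by rewrite !lt_min p2 p3 p4.
  move=> u w /andP[u1 u2] /andP[w1 w2]; rewrite !lt_min => /andP[/andP[k2 k3] /andP[k4 k5]].
  have [um|um] := leP u ((a1 + b1) / 2); have [wm|wm] := leP w ((c1 + d1) / 2).
  - by apply: h2; rewrite ?u1 ?w1.
  - by apply: h4; rewrite ?u1 ?w2 ?(ltW wm).
  - by apply: h3; rewrite ?u2 ?w1 ?(ltW um).
  - by apply: h5; rewrite ?u2 ?w2 ?(ltW um) ?(ltW wm).
have [->|xy] := eqVneq x y.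
  have [dl dl0 h] := hf y yab (e / 2) (half_gt0 e0).
  exists dl => // a' b' c' d' aa /andP[ya yb] bb cc /andP[yc yd] dd b1 d1.
  exists 1 => // u w /andP[ua ub] /andP[wc wd] _.
  have {}ua : a <= u <= b /\ `|u - y| < dl.
    by split; [rewrite (le_trans aa ua) (le_trans ub)|rewrite ltr_norml; lra].
  have {}wc : a <= w <= b /\ `|w - y| < dl.
    by split; [rewrite (le_trans cc wc) (le_trans wd)|rewrite ltr_norml; lra].
  have := h u ua.1 ua.2; have := h w wc.1 wc.2.
  by have := rdistD (f y) (f u) (f w); rewrite (rdistC (f y)); lra.
have xy0 : 0 < `|x - y| by rewrite normr_gt0 subr_eq0.
have dl0 : 0 < `|x - y| / 3 by rewrite divr_gt0.
exists (`|x - y| / 3) => // a' b' c' d' aa /andP[ya yb] bb cc /andP[yc yd] dd b1 d1.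
exists (`|x - y| / 3) => // u w /andP[ua ub] /andP[wc wd]; set D := `|x - y| in xy0 dl0 b1 d1 *.
rewrite ltr_norml => /andP[k1 k2].
have : D < D; last by rewrite ltxx.
by rewrite {1}/D ltr_norml; lra.
Qed.

(* A C^2 curve [c] with derivative [c'], with quantitative constants. *)
Definition curve (c c' : R -> R[i]) (K a b : R) := [/\ 0 <= K,
  forall u, a <= u <= b -> cabs (c u) <= K /\ cabs (c' u) <= K,
  forall u w, a <= u -> u <= w -> w <= b ->
    cabs (c w - c u) <= K * (w - u) /\ cabs (c' w - c' u) <= K * (w - u) &
  forall u x w, a <= u -> u <= x -> x <= w -> w <= b ->
    cabs (c w - c u - (w - u)%:C * c' x) <= K * (w - u) ^+ 2].

Definition cint (c c' : R -> R[i]) f (a b : R) := integ (fun t => c' t *: f (c t)) a b.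

Lemma curve_lip c c' K a b u w : curve c c' K a b -> a <= u <= b -> a <= w <= b ->
  cabs (c u - c w) <= K * `|u - w| /\ cabs (c' u - c' w) <= K * `|u - w|.
Proof.
move=> [K0 _ h2 _] /andP[u1 u2] /andP[w1 w2].
have [uw|uw] := leP u w.
  rewrite distrC ger0_norm ?subr_ge0 // (cdistC (c u)) (cdistC (c' u)).
  exact: h2.
rewrite ger0_norm ?subr_ge0 ?(ltW uw) //.
by apply: h2 => //; exact: ltW.
Qed.

Lemma curve_ucont f c c' K a b : a <= b ->
  curve c c' K a b -> (forall t, a <= t <= b -> ccont f (c t)) ->
  ucont (fun t => c' t *: f (c t)) a b.
Proof.
move=> ab hc hf; apply: cont_ucont => // x xab e e0.
have [K0 h1 _ _] := hc; have [_ c'x] := h1 x xab.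
pose M := rnorm (f (c x)) + 1; pose L := K + 1.
have M0 : 0 < M by rewrite /M; have := rnorm_ge0 (f (c x)); lra.
have L0 : 0 < L by rewrite /L; lra.
have [dl dl0 hdl] := hf x xab (e / 2 / L) (divr_gt0 (half_gt0 e0) L0).
have LM0 : 0 < L * M by rewrite mulr_gt0.
exists (Num.min (dl / L) (e / 2 / (L * M))).
  by rewrite lt_min !divr_gt0.
move=> u uab; rewrite lt_min (ltr_pdivlMr _ _ L0) (ltr_pdivlMr _ _ LM0) => /andP[u1 u2].
have [k1 k2] := curve_lip hc uab xab; have [_ c'u] := h1 u uab.
have KL : K <= L by rewrite /L; lra.
have h : rnorm (f (c u) - f (c x)) <= e / 2 / L.
  apply: hdl; apply: le_lt_trans k1 (le_lt_trans _ u1).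
  by rewrite mulrC ler_wpM2l.
have -> : c' u *: f (c u) - c' x *: f (c x) =
    c' u *: (f (c u) - f (c x)) + (c' u - c' x) *: f (c x).
  by rewrite scalerBr scalerBl addrA subrK.
apply: le_trans (rnormD _ _) _; rewrite !rnormZ.
have p1 : cabs (c' u) * rnorm (f (c u) - f (c x)) <= e / 2.
  have -> : e / 2 = L * (e / 2 / L) by rewrite [RHS]mulrC divfK // lt0r_neq0.
  by apply: ler_pM => //; rewrite ?rnorm_ge0 // (le_trans c'u).
have p2 : cabs (c' u - c' x) * rnorm (f (c x)) <= e / 2.
  apply: (le_trans _ (ltW u2)); rewrite mulrA; apply: ler_pM; rewrite ?rnorm_ge0 //.
    by apply: le_trans k2 _; rewrite mulrC ler_wpM2l.
  by rewrite /M lerDl.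
lra.
Qed.

Lemma curve_has_integ f c c' K a b : seq_complete V -> a <= b ->
  curve c c' K a b -> (forall t, a <= t <= b -> ccont f (c t)) ->
  has_integ (fun t => c' t *: f (c t)) a b.
Proof. by move=> cV ab hc hf; apply: ucont_has_integ => //; exact: curve_ucont hc hf. Qed.

Lemma ucont_bounded (f : R -> V) a b : a <= b -> ucont f a b ->
  exists2 M : R, 0 <= M & forall t, a <= t <= b -> rnorm (f t) <= M.
Proof.
move=> ab uf; have [dl dl0 h] := uf 1 ltr01.
pose Q (c d : R) := a <= c -> d <= b ->
  exists2 M : R, 0 <= M & forall t, c <= t <= d -> rnorm (f t) <= M.
suff : Q a b by apply.
apply: seg_ind => // [c d cd h1 h2 ac db|x xab].
  have [|M1 M10 {}h1] := h1 ac; first lra.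
  have [|M2 M20 {}h2] := h2 _ db; first lra.
  exists (M1 + M2); first exact: addr_ge0.
  move=> t /andP[ct td]; have [tm|tm] := leP t ((c + d) / 2).
    by apply: le_trans (h1 t _) _; rewrite ?ct // lerDl.
  by apply: le_trans (h2 t _) _; rewrite ?td ?(ltW tm) // lerDr.
exists dl => // c d ac /andP[cx xd] db cd _ _; exists (rnorm (f x) + 1).
  by have := rnorm_ge0 (f x); lra.
move=> t /andP[ct td]; have := h t x; rewrite xab.
have -> : a <= t <= b by rewrite (le_trans ac ct) (le_trans td).
have -> : `|t - x| < dl by rewrite ltr_norml; apply/andP; split; lra.
by move=> /(_ isT isT isT); have := rnorm_sub (f t) (f x); lra.
Qed.

(** Along any curve A + z B has the primitive z A + (z^2 / 2) B. This evaluates the affine part that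
    is split off in Goursat's theorem. *)
Lemma cint_affine (A B : V) c c' K a b : a <= b -> curve c c' K a b ->
  cint c c' (fun z => A + z *: B) a b =
  (c b *: A + (c b ^+ 2 / 2) *: B) - (c a *: A + (c a ^+ 2 / 2) *: B).
Proof.
move=> ab [K0 h1 h2 h3]; apply: (integE (H := fun t => c t *: A + (c t ^+ 2 / 2) *: B)) => // e e0.
pose M := K * (rnorm A + K * rnorm B + K * rnorm B) + 1.
have M0 : 0 < M.
  by rewrite /M ltr_pwDr // !(mulr_ge0, addr_ge0) ?rnorm_ge0.
exists (e / M); first by rewrite divr_gt0.
move=> u x w au ux xw wb; rewrite ltr_pdivlMr // => wu.
have uw : u <= w := le_trans ux xw.
have uab : a <= u <= b by rewrite au (le_trans uw).
have wab : a <= w <= b by rewrite wb (le_trans au).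
have xab : a <= x <= b by rewrite (le_trans au ux) (le_trans xw).
set D := c w - c u - (w - u)%:C * c' x.
have -> : c w *: A + (c w ^+ 2 / 2) *: B - (c u *: A + (c u ^+ 2 / 2) *: B) -
   (w - u)%:C *: (c' x *: (A + c x *: B)) =
   D *: A + (D * ((c w + c u) / 2) + (w - u)%:C * (c' x * ((c w - c x) + (c u - c x)) / 2)) *: B.
  rewrite opprD addrACA -(scalerBl _ _ A) -(scalerBl _ _ B) !scalerDr !scalerA.
  rewrite opprD addrACA -(scalerBl _ _ A) -(scalerBl _ _ B).
  by congr (_ *: _ + _ *: _); rewrite /D; field.
have hD : cabs D <= K * (w - u) ^+ 2 := h3 _ _ _ au ux xw wb.
have wu0 : 0 <= w - u by rewrite subr_ge0.
have c1 := (h1 _ uab).1; have c2 := (h1 _ wab).1; have c3 := (h1 _ xab).2.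
have l1 := (h2 _ _ (le_trans au ux) xw wb).1.
have l2 := (h2 _ _ au ux (le_trans xw wb)).1.
have half2 : cabs (2^-1 : R[i]) = 2^-1.
  by rewrite cabsV -(rmorph_nat (real_complex R) 2) cabsC ger0_norm.
have e1 : cabs (D * ((c w + c u) / 2)) <= K * (w - u) ^+ 2 * K.
  rewrite cabsM; apply: ler_pM => //; rewrite ?rnorm_ge0 //.
  by rewrite cabsM half2; have := cabsD (c w) (c u); lra.
have e2 : cabs ((w - u)%:C * (c' x * (c w - c x + (c u - c x)) / 2)) <=
    (w - u) * (K * (K * (w - u))).
  rewrite !cabsM cabsC ger0_norm // half2 -!mulrA; apply: ler_wpM2l => //.
  apply: ler_pM => //; rewrite ?mulr_ge0 ?rnorm_ge0 //.
  have := cabsD (c w - c x) (c u - c x); rewrite (cdistC (c u)) => tr.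
  have k1 : K * (w - x) <= K * (w - u) by rewrite ler_wpM2l //; lra.
  have k2 : K * (x - u) <= K * (w - u) by rewrite ler_wpM2l //; lra.
  lra.
apply: le_trans (rnormD _ _) _; rewrite !rnormZ.
have tr := cabsD (D * ((c w + c u) / 2))
   ((w - u)%:C * (c' x * (c w - c x + (c u - c x)) / 2)).
have t1 : cabs D * rnorm A <= K * (w - u) ^+ 2 * rnorm A.
  by rewrite ler_wpM2r ?rnorm_ge0.
have t2 := ler_wpM2r (rnorm_ge0 B) (le_trans tr (lerD e1 e2)).
apply: le_trans (lerD t1 t2) _.
have -> : K * (w - u) ^+ 2 * rnorm A + (K * (w - u) ^+ 2 * K + (w - u) * (K * (K * (w - u)))) * rnorm B
  = (w - u) * ((w - u) * (M - 1)) by rewrite /M; ring.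
rewrite [leRHS]mulrC; apply: ler_wpM2l => //; apply: (le_trans _ (ltW wu)).
by rewrite ler_wpM2l //; lra.
Qed.

Lemma cint_le f c c' K M a b : a <= b -> curve c c' K a b ->
  has_integ (fun t => c' t *: f (c t)) a b -> 0 <= M ->
  (forall t, a <= t <= b -> rnorm (f (c t)) <= M) ->
  rnorm (cint c c' f a b) <= K * M * (b - a).
Proof.
move=> ab [K0 h1 _ _] hf M0 hM; apply: integ_norm_le => // t tab.
by rewrite rnormZ ler_pM ?rnorm_ge0 ?hM //; case: (h1 t tab).
Qed.

End Curves.

Section Goursat.
Context {R : realType} {V : normedModType R[i]}.
Implicit Types (f : R[i] -> V) (a b c d r t K : R).

Definition pol r t : R[i] := r%:C * expi t.

Lemma cabs_pol r t : 0 <= r -> cabs (pol r t) = r.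
Proof. by move=> r0; rewrite /pol cabsM cabs_expi mulr1 cabsC ger0_norm. Qed.

Lemma pol2pi r : pol r (2 * pi) = pol r 0.
Proof. by rewrite /pol expi2pi expi0. Qed.

Lemma cabs_i : cabs ('i%C : R[i]) = 1.
Proof.
apply/eqP; rewrite -(@eqrXn2 _ 2) ?rnorm_ge0 //.
by rewrite cabs_sqr /= expr0n add0r expr1n.
Qed.

Lemma rad_curve t K a b : 0 <= a -> b <= K -> 1 <= K ->
  curve (fun r => pol r t) (fun=> expi t) K a b.
Proof.
move=> a0 bK K1; have K0 : 0 <= K by lra.
split => // [u /andP[au ub]|u w au uw wb|u x w au ux xw wb].
- by rewrite cabs_pol ?cabs_expi; last exact: le_trans au; split => //; exact: le_trans bK.
- rewrite subrr rnorm0 -mulrBl -rmorphB /= -/(pol _ _) cabs_pol ?subr_ge0 //.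
  by split; [rewrite ler_peMl ?subr_ge0|rewrite mulr_ge0 ?subr_ge0].
- by rewrite -mulrBl -rmorphB /= subrr rnorm0 mulr_ge0 // sqr_ge0.
Qed.

Lemma arc_curve r K a b : 0 <= r -> 2 * r <= K ->
  curve (pol r) (fun t => 'i%C * pol r t) K a b.
Proof.
move=> r0 rK; have K0 : 0 <= K by lra.
have rK1 : r <= K by lra.
split => // [u _|u w au uw wb|u x w au ux xw wb].
- by rewrite cabsM cabs_i mul1r cabs_pol.
- rewrite -[X in _ /\ cabs X <= _]mulrBr -mulrBr !cabsM cabs_i mul1r cabsC ger0_norm //.
  have wu : 0 <= w - u by rewrite subr_ge0.
  by have := expi_lip w u; rewrite (ger0_norm wu) => h; split; rewrite ler_pM ?rnorm_ge0.
(* The tangent is taken at x between u and w, so the Taylor remainders of w and of u about x are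
   subtracted; (w - x)^2 + (u - x)^2 <= (w - u)^2 then leaves the factor 2 of [expi_diff2]. *)
- have -> : pol r w - pol r u - (w - u)%:C * ('i%C * pol r x) =
    r%:C * (expi x * ((expi (w - x) - 1 - 'i%C * (w - x)%:C) -
                      (expi (u - x) - 1 - 'i%C * (u - x)%:C))).
    have ew : expi w = expi x * expi (w - x) by rewrite -expiD addrC subrK.
    have eu : expi u = expi x * expi (u - x) by rewrite -expiD addrC subrK.
    by rewrite /pol ew eu !rmorphB /=; ring.
  rewrite !cabsM cabs_expi mul1r cabsC ger0_norm //.
  have := @rnormB _ R[i]^o (expi (w - x) - 1 - 'i%C * (w - x)%:C)
    (expi (u - x) - 1 - 'i%C * (u - x)%:C).
  have := expi_diff2 (w - x); have := expi_diff2 (u - x).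
  set S := cabs _ => h1; set S' := cabs _ => h2 h3.
  apply: (@le_trans _ _ (r * (2 * (w - u) ^+ 2))).
    rewrite ler_wpM2l // (le_trans h3) //.
    have : 0 <= (w - x) * (x - u) by rewrite mulr_ge0 ?subr_ge0.
    have -> : (w - u) ^+ 2 = (w - x) ^+ 2 + (u - x) ^+ 2 + 2 * ((w - x) * (x - u)).
      by ring.
    lra.
  by rewrite mulrA ler_wpM2r ?sqr_ge0 // mulrC.
Qed.

Lemma pol_dist K r r' t t' : 0 <= r -> r <= K -> 1 <= K ->
  cabs (pol r t - pol r' t') <= K * (`|r - r'| + `|t - t'|).
Proof.
move=> r0 rK K1.
have -> : pol r t - pol r' t' = r%:C * (expi t - expi t') + (r - r')%:C * expi t'.
  by rewrite /pol rmorphB /=; ring.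
apply: (le_trans (cabsD _ _)); rewrite !cabsM cabs_expi !cabsC mulr1 (ger0_norm r0).
rewrite addrC mulrDr lerD //; first by rewrite ler_peMl.
by rewrite ler_pM ?rnorm_ge0 // expi_lip.
Qed.

Definition rad_int f t a b := cint (fun r => pol r t) (fun=> expi t) f a b.
Definition arc_int f r c d := cint (pol r) (fun t => 'i%C * pol r t) f c d.

(** The contour integral of f over the boundary of the polar rectangle a <= r <= b, c <= t <= d,
    counterclockwise. *)
Definition box_int f a b c d :=
  rad_int f c a b + arc_int f b c d - rad_int f d a b - arc_int f a c d.

Section Annulus.
Variables (f : R[i] -> V) (r1 r2 : R).
Hypothesis cV : seq_complete V.

Lemma rad_has_integ t a b : 0 <= r1 -> r1 <= a -> a <= b -> b <= r2 ->
  (forall r, r1 <= r <= r2 -> ccont f (pol r t)) ->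
  has_integ (fun r => expi t *: f (pol r t)) a b.
Proof.
move=> r10 ra ab br hf; apply: (@curve_has_integ _ _ _ _ _ (b + 1)) => //.
  by apply: rad_curve; lra.
by move=> r /andP[ar rb]; apply: hf; apply/andP; split; lra.
Qed.

Lemma arc_has_integ r c d : 0 <= r -> c <= d ->
  (forall t, ccont f (pol r t)) ->
  has_integ (fun t => ('i%C * pol r t) *: f (pol r t)) c d.
Proof.
move=> rr cd hf; apply: (@curve_has_integ _ _ _ _ _ (2 * r)) => //.
exact: arc_curve.
Qed.

(** Each of the four inner half-sides is traversed twice, in opposite directions; the regrouping by
    [AC] pairs them. *)
Lemma box_int_quarter a b c d : 0 <= r1 ->
  (forall r t, r1 <= r <= r2 -> ccont f (pol r t)) ->
  r1 <= a -> a <= b -> b <= r2 -> c <= d ->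
  let m := (a + b) / 2 in let n := (c + d) / 2 in
  box_int f a b c d = box_int f a m c n + box_int f m b c n +
    (box_int f a m n d + box_int f m b n d).
Proof.
move=> r10 hf ra ab br cd m n.
have am : a <= m by rewrite /m; lra.
have mb : m <= b by rewrite /m; lra.
have cn : c <= n by rewrite /n; lra.
have nd : n <= d by rewrite /n; lra.
have R1 t : rad_int f t a b = rad_int f t a m + rad_int f t m b.
  by apply: integ_split => //; apply: rad_has_integ => // r hr; exact: hf.
have A1 r : r1 <= r <= r2 -> arc_int f r c d = arc_int f r c n + arc_int f r n d.
  move=> hr; apply: integ_split => //; apply: arc_has_integ => //.
    by case/andP: hr; lra.
  by move=> t; exact: hf.
rewrite /box_int !R1 !A1; try by apply/andP; split; lra.
set x1 := rad_int f c a m; set x2 := rad_int f c m b.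
set x3 := rad_int f d a m; set x4 := rad_int f d m b.
set x5 := rad_int f n a m; set x6 := rad_int f n m b.
set y1 := arc_int f a c n; set y2 := arc_int f a n d.
set y3 := arc_int f b c n; set y4 := arc_int f b n d.
set y5 := arc_int f m c n; set y6 := arc_int f m n d.
rewrite !opprD.
rewrite [RHS](AC ((4*4)*(4*4)) (((1*5)*(6*14)*(11*15)*(4*12))*
  ((2*8)*(3*9)*(7*13)*(10*16))))/=.
by rewrite !subrr !addNr !addr0.
Qed.

Lemma box_int_le K M a b c d : 0 <= r1 -> 2 * r2 + 1 <= K -> 0 <= M ->
  (forall r t, r1 <= r <= r2 -> ccont f (pol r t)) ->
  r1 <= a -> a <= b -> b <= r2 -> c <= d ->
  (forall r t, a <= r <= b -> c <= t <= d -> rnorm (f (pol r t)) <= M) ->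
  rnorm (box_int f a b c d) <= 2 * (K * M * (b - a + (d - c))).
Proof.
move=> r10 rK M0 hf ra ab br cd hM.
have h1 t : c <= t <= d -> rnorm (rad_int f t a b) <= K * M * (b - a).
  move=> tcd; apply: cint_le => //; last by move=> r rab; exact: hM.
    by apply: rad_curve; lra.
  by apply: rad_has_integ => // r; exact: hf.
have h2 r : a <= r <= b -> rnorm (arc_int f r c d) <= K * M * (d - c).
  move=> /andP[ar rb]; apply: cint_le => //; last by move=> t tcd; apply: hM; rewrite ?ar.
    by apply: arc_curve; lra.
  by apply: arc_has_integ => // [|t]; [lra|apply: hf; apply/andP; split; lra].
have cc : c <= c <= d by rewrite lexx.
have dd : c <= d <= d by rewrite lexx andbT.
have aa : a <= a <= b by rewrite lexx.
have bb : a <= b <= b by rewrite lexx andbT.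
have := h1 c cc; have := h1 d dd; have := h2 a aa; have := h2 b bb.
rewrite /box_int mulrDr.
set u1 := rad_int f c a b; set u2 := arc_int f b c d.
set u3 := rad_int f d a b; set u4 := arc_int f a c d.
have := rnormB (u1 + u2 - u3) u4; have := rnormB (u1 + u2) u3.
have := rnormD u1 u2; lra.
Qed.

End Annulus.

Lemma box_intD f g (r1 r2 a b c d : R) : seq_complete V -> 0 <= r1 ->
  (forall r t, r1 <= r <= r2 -> ccont f (pol r t)) ->
  (forall r t, r1 <= r <= r2 -> ccont g (pol r t)) ->
  r1 <= a -> a <= b -> b <= r2 -> c <= d ->
  box_int (fun z => f z + g z) a b c d = box_int f a b c d + box_int g a b c d.
Proof.
move=> cV r10 hf hg ra ab br cd.
have R1 t : rad_int (fun z => f z + g z) t a b = rad_int f t a b + rad_int g t a b.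
  rewrite -(integD ab) //; try by apply: (rad_has_integ cV r10 ra ab br) => r /hf.
    by apply: eq_integ => // r _; rewrite scalerDr.
  by apply: (rad_has_integ cV r10 ra ab br) => r /hg.
have A1 r : r1 <= r <= r2 ->
    arc_int (fun z => f z + g z) r c d = arc_int f r c d + arc_int g r c d.
  move=> rr; have r0 : 0 <= r by case/andP: rr; lra.
  rewrite -(integD cd) //; try by apply: (arc_has_integ cV r0 cd) => t; exact: hf.
    by apply: eq_integ => // t _; rewrite scalerDr.
  by apply: (arc_has_integ cV r0 cd) => t; exact: hg.
rewrite /box_int !R1 !A1; try by apply/andP; split; lra.
by rewrite !opprD [LHS](AC (2*2*2*2) ((1*3*5*7)*(2*4*6*8))).
Qed.

Lemma affine_cdiff (A B : V) z : cdiff (fun z => A + z *: B) z.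
Proof.
exists B => e e0; exists 1 => // w _.
rewrite opprD addrACA subrr add0r -scalerBl subrr rnorm0.
by rewrite mulr_ge0 ?rnorm_ge0 // ltW.
Qed.

Lemma box_int_affine (A B : V) a b c d : 0 <= a -> a <= b -> c <= d ->
  box_int (fun z => A + z *: B) a b c d = 0.
Proof.
move=> a0 ab cd; have b0 : 0 <= b by exact: le_trans ab.
rewrite /box_int /rad_int /arc_int.
rewrite !(cint_affine A B ab (K := 2 * b + 1)); try by apply: rad_curve; lra.
rewrite !(cint_affine A B cd (K := 2 * b + 1)); try by apply: arc_curve; lra.
set p1 := _ + (pol b c ^+ 2 / 2) *: B; set p2 := _ + (pol a c ^+ 2 / 2) *: B.
set p3 := _ + (pol b d ^+ 2 / 2) *: B; set p4 := _ + (pol a d ^+ 2 / 2) *: B.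
clearbody p1 p2 p3 p4; rewrite !opprD !opprK [LHS](AC (2*2*2*2) ((1*4)*(2*8)*((3*5)*(6*7))))/=.
by rewrite !subrr !addNr !addr0.
Qed.

(* The inner radius may be 0, where the inner arc degenerates. *)
Lemma goursat_polar f (r1 r2 c d : R) : seq_complete V -> 0 <= r1 -> r1 <= r2 ->
  c <= d -> (forall r t, r1 <= r <= r2 -> cdiff f (pol r t)) ->
  box_int f r1 r2 c d = 0.
Proof.
move=> cV r10 r12 cd hf.
have hc r t : r1 <= r <= r2 -> ccont f (pol r t).
  by move=> hr; apply: cdiff_ccont; exact: hf.
pose K := 2 * r2 + 1.
have K1 : 1 <= K by rewrite /K; lra.
have K0 : 0 < K by lra.
apply: rnorm_le0 => e e0.
pose L0 := (r2 - r1 + (d - c)) ^+ 2 + 1.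
have L00 : 0 < L0 by rewrite /L0 ltr_pwDr // sqr_ge0.
pose e' := e / L0; have e'0 : 0 < e' by rewrite divr_gt0.
(* Halving both sides divides (b - a + (d - c))^2 by 4, so the bounds on the four quarters add up to
   the bound on the whole. *)
pose P a b c d := r1 <= a -> a <= b -> b <= r2 -> c <= d ->
   rnorm (box_int f a b c d) <= e' * (b - a + (d - c)) ^+ 2.
suff /(_ (lexx _) r12 (lexx _) cd)/le_trans : P r1 r2 c d; first apply.
  have : e' * L0 = e by rewrite /e' divfK // lt0r_neq0.
  by rewrite /L0 mulrDr mulr1; lra.
apply: box_ind => // [a b c1 d1 ab cd1 p1 p2 p3 p4|x y xr yc].
  move=> ra _ br _.
  rewrite (box_int_quarter cV r10 hc ra ab br cd1).
  have am : a <= (a + b) / 2 by lra.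
  have mb : (a + b) / 2 <= b by lra.
  have cn : c1 <= (c1 + d1) / 2 by lra.
  have nd : (c1 + d1) / 2 <= d1 by lra.
  have {}p1 := p1 ra am (le_trans mb br) cn.
  have {}p2 := p2 (le_trans ra am) mb br cn.
  have {}p3 := p3 ra am (le_trans mb br) nd.
  have {}p4 := p4 (le_trans ra am) mb br nd.
  move: p1 p2 p3 p4.
  set E1 := box_int _ _ _ _ _; set E2 := box_int _ _ _ _ _.
  set E3 := box_int _ _ _ _ _; set E4 := box_int _ _ _ _ _ => p1 p2 p3 p4.
  have t1 := rnormD (E1 + E2) (E3 + E4).
  have t2 := rnormD E1 E2; have t3 := rnormD E3 E4.
  apply: le_trans t1 (le_trans (lerD t2 t3) _).
  apply: le_trans (lerD (lerD p1 p2) (lerD p3 p4)) _.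
  by rewrite le_eqVlt; apply/orP; left; apply/eqP; field.
have [B hB] := hf x y xr.
(* With L = b - a + (d - c), the remainder of f is at most e2 K L on a small box and its boundary
   integral at most 2 K L times that, which is e' L^2. *)
pose e2 := e' / (2 * K * K); have e20 : 0 < e2 by rewrite divr_gt0 // !mulr_gt0.
have [dl dl0 h] := hB e2 e20.
exists (dl / (2 * K)); first by rewrite divr_gt0 // mulr_gt0.
move=> a b c1 d1 ra /andP[ax xb] br cc /andP[cy yd] dd b1 d2 _ ab _ cd1.
(* The tangent A + z B of f at the limit point has boundary integral 0, so only the remainder g
   contributes. *)
pose A := f (pol x y) - pol x y *: B.
pose g z := f z - (A + z *: B).
have a0 : 0 <= a by lra.
have hg r t : r1 <= r <= r2 -> ccont g (pol r t).
  move=> rr; apply: cdiff_ccont; have [B' hB'] := hf r t rr.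
  exists (B' - B) => e3 e30; have [dl3 dl30 h3] := hB' e3 e30.
  exists dl3 => // w /h3; congr (rnorm _ <= _).
  rewrite /g scalerBr !scalerBl; clearbody A; rewrite !opprD !opprK.
  rewrite [RHS](AC ((1*2)*(1*2)*(2*2)) ((1*4*(7*8))*((2*5)*(3*9)*(6*10))))/=.
  by rewrite subrr !addNr !addr0.
have L : 0 <= b - a + (d1 - c1) by lra.
have fg : (fun z => g z + (A + z *: B)) = f.
  by apply/funext => z; rewrite /g subrK.
have hA r t : r1 <= r <= r2 -> ccont (fun z => A + z *: B) (pol r t).
  by move=> _; apply: cdiff_ccont; exact: affine_cdiff.
have := @box_intD g (fun z => A + z *: B) r1 r2 a b c1 d1 cV r10 hg hA ra ab br cd1.
rewrite fg => ->.
rewrite box_int_affine // addr0.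
have gM r t : a <= r <= b -> c1 <= t <= d1 ->
    rnorm (g (pol r t)) <= e2 * (K * (b - a + (d1 - c1))).
  move=> /andP[ar rb] /andP[ct td].
  have pd : cabs (pol r t - pol x y) <= K * (b - a + (d1 - c1)).
    have rK : r <= K by rewrite /K; lra.
    have r0 : 0 <= r by lra.
    apply: le_trans (@pol_dist K r x t y r0 rK K1) _.
    apply: (ler_wpM2l (ltW K0)); clear - ar rb ct td ax xb cy yd.
    by apply: lerD; rewrite ler_norml; apply/andP; split; lra.
  have -> : g (pol r t) = f (pol r t) - f (pol x y) - (pol r t - pol x y) *: B.
    by rewrite /g /A scalerBl !opprD !opprK [RHS](AC (2*2) (1*(2*4*3))).
  apply: le_trans (h _ _) _; last by rewrite ler_wpM2l // ltW.
  apply: le_lt_trans pd _.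
  have K20 : 0 < 2 * K by rewrite mulr_gt0.
  by move: b1 d2; rewrite !(ltr_pdivlMr _ _ K20); lra.
have M0 : 0 <= e2 * (K * (b - a + (d1 - c1))).
  by apply: mulr_ge0 (ltW e20) (mulr_ge0 (ltW K0) L).
have := box_int_le cV r10 (lexx K) M0 hg ra ab br cd1 gM.
have -> // : 2 * (K * (e2 * (K * (b - a + (d1 - c1)))) * (b - a + (d1 - c1))) =
   e' * (b - a + (d1 - c1)) ^+ 2.
by rewrite /e2; field; rewrite lt0r_neq0.
Qed.
End Goursat.

Section ComplexDiff.
Context {R : realType} {V : normedModType R[i]}.
Implicit Types (k : R[i] -> V) (z w : R[i]).

Definition cdiff_at k z (B : V) := forall e : R, 0 < e ->
  exists2 dl : R, 0 < dl & forall w, cabs (w - z) < dl ->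
    rnorm (k w - k z - (w - z) *: B) <= e * cabs (w - z).

Lemma cdiff_local k1 k2 z (dl : R) B : 0 < dl ->
  (forall w, cabs (w - z) < dl -> k1 w = k2 w) -> cdiff_at k1 z B -> cdiff_at k2 z B.
Proof.
move=> dl0 h hB e /hB[d2 d20 h2].
exists (Num.min dl d2); first by rewrite lt_min dl0.
move=> w; rewrite lt_min => /andP[w1 w2]; rewrite -!h //; first exact: h2.
by rewrite subrr rnorm0.
Qed.

Lemma ccont_local k1 k2 z (dl : R) : 0 < dl ->
  (forall w, cabs (w - z) < dl -> k1 w = k2 w) -> ccont k1 z -> ccont k2 z.
Proof.
move=> dl0 h hB e /hB[d2 d20 h2].
exists (Num.min dl d2); first by rewrite lt_min dl0.
move=> w; rewrite lt_min => /andP[w1 w2]; rewrite -!h //; first exact: h2.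
by rewrite subrr rnorm0.
Qed.

Lemma cdiff_cst (y : V) z : cdiff (fun=> y) z.
Proof.
exists 0 => e e0; exists 1 => // w _.
by rewrite scaler0 subr0 subrr rnorm0 mulr_ge0 ?rnorm_ge0 // ltW.
Qed.

Lemma cdiffB k1 k2 z : cdiff k1 z -> cdiff k2 z -> cdiff (fun w => k1 w - k2 w) z.
Proof.
move=> [B1 h1] [B2 h2]; exists (B1 - B2) => e e0.
have [d1 d10 {}h1] := h1 _ (half_gt0 e0); have [d2 d20 {}h2] := h2 _ (half_gt0 e0).
exists (Num.min d1 d2); first by rewrite lt_min d10.
move=> w; rewrite lt_min => /andP[w1 w2].
have -> : k1 w - k2 w - (k1 z - k2 z) - (w - z) *: (B1 - B2) =
  (k1 w - k1 z - (w - z) *: B1) - (k2 w - k2 z - (w - z) *: B2).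
  by rewrite scalerBr !opprD !opprK [LHS](AC (2*2*2) ((1*3*5)*(2*4*6))).
apply: le_trans (rnormB _ _) _.
have := h1 w w1; have := h2 w w2.
have -> : e * cabs (w - z) = e / 2 * cabs (w - z) + e / 2 * cabs (w - z) by field.
lra.
Qed.

Lemma cdiff_scale (g : R[i] -> R[i]^o) k z : cdiff g z -> cdiff k z ->
  cdiff (fun w => g w *: k w) z.
Proof.
move=> hg hk; have ck := cdiff_ccont hk.
move: hg hk => [g' hg] [k' hk]; exists (g' *: k z + g z *: k') => e e0.
pose M := cabs g' + cabs (g z) + rnorm (k z) + 1.
have M0 : 0 < M.
  by rewrite /M ltr_pwDr // !addr_ge0 // rnorm_ge0.
have M1 : 1 <= M by rewrite /M lerDr !addr_ge0 // rnorm_ge0.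
have eM : 0 < e / 3 / M by rewrite !divr_gt0.
have [d1 d10 h1] := hg _ eM; have [d2 d20 h2] := hk _ eM.
have [d3 d30 h3] := ck _ eM; have [d4 d40 h4] := ck 1 ltr01.
exists (Num.min (Num.min d1 d2) (Num.min d3 d4)); first by rewrite !lt_min d10 d20 d30.
move=> w; rewrite !lt_min => /andP[/andP[w1 w2] /andP[w3 w4]].
have -> : g w *: k w - g z *: k z - (w - z) *: (g' *: k z + g z *: k') =
  (g w - g z - (w - z) *: g') *: k w + ((w - z) * g') *: (k w - k z) +
  g z *: (k w - k z - (w - z) *: k').
  move: (w - z) => h; rewrite -[h *: g']/(h * g').
  rewrite scalerDr !scalerBl !scalerBr !scalerA opprD [g z * h]mulrC.
  rewrite [RHS](AC (3*2*3) ((1*7*(5*8))*((2*6)*(3*4))))/=.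
  by rewrite !addNr !addr0.
have kw : rnorm (k w) <= M.
  have := h4 w w4; have := rnorm_sub (k w) (k z).
  by rewrite /M; have := rnorm_ge0 (g' : R[i]^o); have := rnorm_ge0 (g z); lra.
apply: le_trans (rnormD _ _) _; apply: le_trans (lerD (rnormD _ _) (lexx _)) _.
rewrite !rnormZ ?cabsM.
set D := cabs (w - z); have D0 : 0 <= D := rnorm_ge0 _.
have eq3 : e * D = e / 3 / M * D * M + D * M * (e / 3 / M) + M * (e / 3 / M * D).
  by field; exact: lt0r_neq0.
rewrite eq3; apply: lerD; first apply: lerD; apply: ler_pM; rewrite ?mulr_ge0 ?rnorm_ge0 //.
- exact: h1.
- rewrite ler_wpM2l // /M; have := rnorm_ge0 (k z); have := rnorm_ge0 (g z); lra.
- exact: h3.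
- rewrite /M; have := rnorm_ge0 (k z); have := rnorm_ge0 (g' : R[i]^o); lra.
- exact: h2.
Qed.

End ComplexDiff.

Section Inverses.
Context {R : realType}.
Implicit Types (z w u : R[i]).

Lemma cdiff_atZ (k : R[i] -> R[i]^o) z (B : R[i]^o) (c : R[i]) :
  cdiff_at k z B -> cdiff_at (fun w => c * k w : R[i]^o) z (c * B).
Proof.
move=> hk e e0; have c0 : 0 < cabs c + 1 by have := rnorm_ge0 (c : R[i]^o); lra.
have [dl dl0 h] := hk _ (divr_gt0 e0 c0); exists dl => // w /h hw.
have -> : c * k w - c * k z - (w - z) *: (c * B : R[i]^o) =
  c * (k w - k z - (w - z) *: B) by rewrite /GRing.scale /=; ring.
rewrite cabsM; apply: le_trans (ler_wpM2l (rnorm_ge0 _) hw) _.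
rewrite mulrA ler_wpM2r ?rnorm_ge0 // mulrCA ler_piMr ?(ltW e0) //.
by rewrite ler_pdivrMr // mul1r; lra.
Qed.

Lemma cdiff_inv w z : z != w -> cdiff (fun u => (u - w)^-1 : R[i]^o) z.
Proof.
move=> zw; have zw0 : z - w != 0 by rewrite subr_eq0.
pose D := cabs (z - w); have D0 : 0 < D by exact: cabs_gt0.
exists (- (z - w)^-1 ^+ 2) => e e0.
(* The remainder divided by u - z is (u - z) (u - w)^-1 (z - w)^-2, at most |u - z| (2 / D) /
   D^2. *)
have D30 : 0 < e * D ^+ 3 / 2 by rewrite divr_gt0 // mulr_gt0 // exprn_gt0.
exists (Num.min (D / 2) (e * D ^+ 3 / 2)); first by rewrite lt_min D30 divr_gt0.
move=> u; rewrite lt_min => /andP[u1 u2].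
have uD : D / 2 <= cabs (u - w).
  have := cdistD u z w; rewrite (cdistC z u) -/D; lra.
have uw0 : u - w != 0.
  by rewrite -cabs_eq0 lt0r_neq0 // (lt_le_trans _ uD) // divr_gt0.
have -> : (u - w)^-1 - (z - w)^-1 - (u - z) *: (- (z - w)^-1 ^+ 2 : R[i]^o) =
   (u - z) * ((u - z) * ((u - w)^-1 * (z - w)^-1 ^+ 2)).
  by rewrite /GRing.scale /=; field; rewrite zw0 uw0.
rewrite cabsM mulrC ler_wpM2r ?rnorm_ge0 //.
rewrite (cabsM (u - z)) (cabsM (u - w)^-1) cabsX !cabsV -/D.
apply: (@le_trans _ _ (e * D ^+ 3 / 2 * ((D / 2)^-1 * D^-1 ^+ 2))).
  apply: ler_pM; rewrite ?mulr_ge0 ?exprn_ge0 ?invr_ge0 ?rnorm_ge0 ?(ltW D0) ?(ltW u2) //.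
  rewrite ler_wpM2r ?exprn_ge0 ?invr_ge0 ?(ltW D0) //.
  by rewrite lef_pV2 ?posrE ?divr_gt0 // (lt_le_trans _ uD) // divr_gt0.
by rewrite le_eqVlt; apply/orP; left; apply/eqP; field; exact: lt0r_neq0.
Qed.

Lemma cdiff_invX w z n : z != w -> cdiff (fun u => (u - w)^-1 ^+ n : R[i]^o) z.
Proof.
move=> zw; elim: n => [|n IH]; first exact: cdiff_cst.
have -> : (fun u => (u - w)^-1 ^+ n.+1 : R[i]^o) =
    (fun u => ((u - w)^-1 : R[i]^o) *: ((u - w)^-1 ^+ n : R[i]^o)).
  by apply/funext => u; rewrite exprS.
exact: cdiff_scale (cdiff_inv zw) IH.
Qed.

(* For [a = (z - w)^-1] and [b = (z - (w + h))^-1]. *)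
Lemma pow_first_order (a b h : R[i]) (M : R) n : b - a = h * a * b ->
  cabs a <= M -> cabs b <= M ->
  cabs (b ^+ n - a ^+ n) <= n%:R * (cabs h * M ^+ n.+1) /\
  cabs (b ^+ n - a ^+ n - n%:R * h * a ^+ n.+1) <=
    n%:R ^+ 2 * (cabs h ^+ 2 * M ^+ n.+2).
Proof.
move=> ba aM bM; have M0 : 0 <= M := le_trans (rnorm_ge0 _) aM.
have h0 : 0 <= cabs h := rnorm_ge0 _.
have aX k : cabs (a ^+ k) <= M ^+ k by rewrite cabsX lerXn2r ?nnegrE ?rnorm_ge0.
have bah : cabs (b - a) <= cabs h * M ^+ 2.
  by rewrite ba !cabsM expr2 -mulrA ler_wpM2l // ler_pM ?rnorm_ge0.
elim: n => [|n [IH1 IH2]].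
  rewrite !expr0 subrr !mulr0n; split; first by rewrite rnorm0 mul0r.
  by rewrite !mul0r subr0 rnorm0 expr0n mul0r.
split.
  have -> : b ^+ n.+1 - a ^+ n.+1 = b * (b ^+ n - a ^+ n) + (b - a) * a ^+ n.
    by rewrite !exprS; ring.
  apply: le_trans (cabsD _ _) _; rewrite !cabsM -natr1 mulrDl mul1r.
  apply: lerD.
    have -> : n%:R * (cabs h * M ^+ n.+2) = M * (n%:R * (cabs h * M ^+ n.+1)).
      by rewrite [M ^+ n.+2]exprS; ring.
    by rewrite ler_pM ?rnorm_ge0.
  have -> : cabs h * M ^+ n.+2 = cabs h * M ^+ 2 * M ^+ n.
    by rewrite -mulrA -exprD.
  by rewrite ler_pM ?rnorm_ge0.
have -> : b ^+ n.+1 - a ^+ n.+1 - n.+1%:R * h * a ^+ n.+2 =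
  b * (b ^+ n - a ^+ n - n%:R * h * a ^+ n.+1) + h * (b - a) * a ^+ n.+1 +
  n%:R * h * (b - a) * a ^+ n.+1.
  have e1 : h * (b - a) * a ^+ n.+1 = (b - a - h * a ^+ 2) * a ^+ n.
    by rewrite [in RHS]ba exprS; ring.
  by rewrite e1 -natr1 !exprS; ring.
apply: le_trans (cabsD _ _) _; apply: le_trans (lerD (cabsD _ _) (lexx _)) _.
rewrite !cabsM.
have nn : cabs (n%:R : R[i]) = n%:R.
  by rewrite -(rmorph_nat (real_complex R) n) cabsC ger0_norm.
have t1 : cabs b * cabs (b ^+ n - a ^+ n - n%:R * h * a ^+ n.+1) <=
    M * (n%:R ^+ 2 * (cabs h ^+ 2 * M ^+ n.+2)) by rewrite ler_pM ?rnorm_ge0.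
have t2 : cabs h * cabs (b - a) * cabs (a ^+ n.+1) <=
    cabs h * (cabs h * M ^+ 2) * M ^+ n.+1.
  apply: ler_pM (ler_wpM2l h0 bah) (aX _); last exact: rnorm_ge0.
  exact: mulr_ge0 h0 (rnorm_ge0 _).
have t3 : cabs (n%:R : R[i]) * cabs h * cabs (b - a) * cabs (a ^+ n.+1) <=
    n%:R * (cabs h * (cabs h * M ^+ 2) * M ^+ n.+1).
  by have := ler_wpM2l (ler0n R n) t2; rewrite nn !mulrA.
apply: le_trans (lerD (lerD t1 t2) t3) _.
have -> : M * (n%:R ^+ 2 * (cabs h ^+ 2 * M ^+ n.+2)) +
  cabs h * (cabs h * M ^+ 2) * M ^+ n.+1 +
  n%:R * (cabs h * (cabs h * M ^+ 2) * M ^+ n.+1) =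
  (n%:R ^+ 2 + 1 + n%:R) * (cabs h ^+ 2 * M ^+ n.+3).
  by rewrite !exprS; ring.
apply: ler_wpM2r; first by rewrite mulr_ge0 // exprn_ge0.
by have : 0 <= n%:R :> R by []; rewrite -natr1; nra.
Qed.

End Inverses.

(** * Integrals over circles and Cauchy's formula *)

Section CircleIntegral.
Context {R : realType} {V : normedModType R[i]}.
Implicit Types (f : R[i] -> V) (r t : R).

Lemma twopi_ge0 : 0 <= 2 * pi :> R.
Proof. by rewrite mulr_ge0 // pi_ge0. Qed.

Lemma twopi_gt0 : 0 < 2 * pi :> R.
Proof. by rewrite mulr_gt0 // pi_gt0. Qed.

(** This is -i times the contour integral of f(z) dz, the normalization that occurs in
    [derivative_calculus]. *)
Definition circ f r : V := integ (fun t => pol r t *: f (pol r t)) 0 (2 * pi).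

Hypothesis cV : seq_complete V.

Lemma circ_has_integ f r : 0 <= r -> (forall t, ccont f (pol r t)) ->
  has_integ (fun t => pol r t *: f (pol r t)) 0 (2 * pi).
Proof.
move=> r0 hf.
have := has_integZ (- 'i%C) (arc_has_integ cV r0 twopi_ge0 hf).
congr has_integ; apply/funext => t; rewrite scalerA mulrA mulNr.
by rewrite -expr2 sqr_i opprK mul1r.
Qed.

Lemma arc_circ f r : 0 <= r -> (forall t, ccont f (pol r t)) ->
  arc_int f r 0 (2 * pi) = 'i%C *: circ f r.
Proof.
move=> r0 hf; rewrite -integZ ?twopi_ge0 //; last exact: circ_has_integ.
by apply: eq_integ => [|t _]; rewrite ?twopi_ge0 // scalerA.
Qed.

Lemma i_neq0 : 'i%C != 0 :> R[i].
Proof. by rewrite -cabs_eq0 cabs_i oner_eq0. Qed.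

(** An annulus is a polar rectangle of angular width 2 pi; its two radial sides coincide and cancel,
    leaving the two circles. *)
Lemma circ_const f (r1 r2 : R) : 0 <= r1 -> r1 <= r2 ->
  (forall r t, r1 <= r <= r2 -> cdiff f (pol r t)) -> circ f r1 = circ f r2.
Proof.
move=> r10 r12 hf.
have r20 : 0 <= r2 by lra.
have := goursat_polar cV r10 r12 twopi_ge0 hf.
have -> : box_int f r1 r2 0 (2 * pi) =
    arc_int f r2 0 (2 * pi) - arc_int f r1 0 (2 * pi).
  rewrite /box_int (_ : rad_int f (2 * pi) r1 r2 = rad_int f 0 r1 r2).
    by rewrite [X in X - _ = _]addrAC subrr add0r.
  rewrite /rad_int /cint expi2pi -expi0.
  by congr integ; apply/funext => r; rewrite pol2pi.
have c1 t : ccont f (pol r1 t) by apply/cdiff_ccont/hf; rewrite lexx.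
have c2 t : ccont f (pol r2 t) by apply/cdiff_ccont/hf; rewrite lexx andbT.
rewrite !arc_circ // -scalerBr => /eqP; rewrite scaler_eq0 (negbTE i_neq0) /=.
by rewrite subr_eq0 => /eqP.
Qed.

(** Compare with the circle of radius 0, where the factor [pol 0 t] makes the integrand vanish. *)
Lemma circ0 f r : 0 <= r ->
  (forall s t, 0 <= s <= r -> cdiff f (pol s t)) -> circ f r = 0.
Proof.
move=> r0 hf; rewrite -(circ_const (lexx 0) r0 hf) /circ.
rewrite (_ : (fun t => _) = fun=> 0).
  by rewrite integ_cst ?twopi_ge0 // scaler0.
by apply/funext => t; rewrite /pol mul0r scale0r.
Qed.

(** The circle is moved out to a radius at which z f(z) is uniformly within e of y: y plays the part
    of the residue at infinity. *)
Lemma circ_infty f r (y : V) : 0 <= r ->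
  (forall s t, r <= s -> cdiff f (pol s t)) ->
  (forall e : R, 0 < e -> exists2 s, r <= s & forall t,
     rnorm (pol s t *: f (pol s t) - y) <= e) ->
  circ f r = (2 * pi)%:C *: y.
Proof.
move=> r0 hf hy; apply/eqP; rewrite -subr_eq0; apply/eqP/rnorm_le0 => e e0.
have [s rs hs] := hy (e / (2 * pi)) (divr_gt0 e0 twopi_gt0).
have s0 : 0 <= s by lra.
rewrite (@circ_const f r s) //; last by move=> r' t /andP[h _]; exact: hf.
have hi := circ_has_integ s0 (fun t => cdiff_ccont (hf s t rs)).
have -> : (2 * pi)%:C *: y = integ (fun=> y) 0 (2 * pi).
  by rewrite integ_cst ?twopi_ge0 // subr0.
rewrite -integB ?twopi_ge0 //; last by exists (fun t => t%:C *: y); exact: is_prim_cst.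
apply: (le_trans (@integ_norm_le _ _ _ _ _ (e / (2 * pi)) _ _ _)).
- exact: twopi_ge0.
- by apply: has_integB hi _; exists (fun t => t%:C *: y); exact: is_prim_cst.
- by move=> t _; exact: hs.
by rewrite subr0 divfK // lt0r_neq0 ?twopi_gt0.
Qed.

Lemma circD f (g : R[i] -> V) r : 0 <= r -> (forall t, ccont f (pol r t)) ->
  (forall t, ccont g (pol r t)) ->
  circ (fun z => f z + g z) r = circ f r + circ g r.
Proof.
move=> r0 hf hg; rewrite -integD ?twopi_ge0 //; try exact: circ_has_integ.
by apply: eq_integ => [|t _]; rewrite ?twopi_ge0 // scalerDr.
Qed.

Lemma eq_circ f (g : R[i] -> V) r : (forall t, f (pol r t) = g (pol r t)) ->
  circ f r = circ g r.
Proof. by move=> fg; apply: eq_integ => [|t _]; rewrite ?twopi_ge0 ?fg. Qed.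

(** Lets the radius cross a circle that carries a point where f is only known to be continuous; in
    Cauchy's formula this is the circle through w. *)
Lemma circ_continuous f (r0 : R) : 0 <= r0 -> (forall t, ccont f (pol r0 t)) ->
  forall e : R, 0 < e -> exists2 dl, 0 < dl & forall r, 0 <= r ->
    (forall t, ccont f (pol r t)) -> `|r - r0| < dl ->
    rnorm (circ f r - circ f r0) <= e.
Proof.
move=> r00 hf e e0.
pose e' := e / (2 * pi).
have e'0 : 0 < e' by rewrite divr_gt0 // twopi_gt0.
pose k z := z *: f z.
have hk t : ccont k (pol r0 t).
  move=> e1 e10; set z := pol r0 t; pose M := cabs z + 1 + rnorm (f z).
  have M0 : 0 < M.
    by rewrite /M; have := rnorm_ge0 (z : R[i]^o); have := rnorm_ge0 (f z); lra.
  have [d1 d10 h1] := hf t (e1 / 2 / M) (divr_gt0 (half_gt0 e10) M0).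
  exists (Num.min 1 (Num.min d1 (e1 / 2 / M))).
    by rewrite !lt_min d10 ltr01 !divr_gt0.
  move=> w; rewrite !lt_min => /andP[w1 /andP[w2 w3]].
  have -> : k w - k z = w *: (f w - f z) + (w - z) *: f z.
    by rewrite scalerBr scalerBl addrA subrK.
  apply: le_trans (rnormD _ _) _; rewrite !rnormZ.
  have wM : cabs w <= M.
    by have := cabs_sub w z; rewrite /M; have := rnorm_ge0 (f z); lra.
  have e2 : e1 = M * (e1 / 2 / M) + (e1 / 2 / M) * M by field; exact: lt0r_neq0.
  rewrite [leRHS]e2 lerD // ler_pM ?rnorm_ge0 ?(ltW w3) //; first exact: h1.
  by rewrite /M lerDr; have := rnorm_ge0 (z : R[i]^o); lra.
(* Continuity at each point of the circle becomes uniform in t by bisection of [0, 2 pi]. *)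
have : exists2 dl, 0 < dl & forall t, 0 <= t <= 2 * pi -> forall r, 0 <= r ->
    `|r - r0| < dl -> rnorm (k (pol r t) - k (pol r0 t)) <= e'.
  pose Q (c d : R) := exists2 dl, 0 < dl & forall t, c <= t <= d -> forall r, 0 <= r ->
    `|r - r0| < dl -> rnorm (k (pol r t) - k (pol r0 t)) <= e'.
  suff : Q 0 (2 * pi) by [].
  apply: seg_ind; first exact: twopi_ge0.
    move=> a b ab [d1 d10 h1] [d2 d20 h2].
    exists (Num.min d1 d2); first by rewrite lt_min d10.
    move=> t /andP[at_ tb] r rr; rewrite lt_min => /andP[r1 r2].
    have [tm|tm] := leP t ((a + b) / 2); first by apply: h1; rewrite ?at_.
    by apply: h2; rewrite ?tb ?(ltW tm).
  move=> x _; have [dl dl0 h] := hk x _ (half_gt0 e'0).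
  pose K := r0 + 1; have K0 : 0 < K by rewrite /K; lra.
  exists (dl / (2 * K)); first by rewrite divr_gt0 // mulr_gt0.
  move=> a b _ /andP[ax xb] _ ab; exists (dl / (2 * K)); first by rewrite divr_gt0 // mulr_gt0.
  move=> t /andP[at_ tb] r rr rd.
  have K20 : 0 < 2 * K by rewrite mulr_gt0.
  move: ab rd; rewrite !(ltr_pdivlMr _ _ K20) => ab rd.
  have tx : `|x - t| * (2 * K) < dl.
    apply: le_lt_trans ab; rewrite ler_wpM2r ?(ltW K20) // ler_norml.
    by apply/andP; split; lra.
  have k1 : rnorm (k (pol r t) - k (pol r0 x)) <= e' / 2.
    apply: h; rewrite cdistC.
    apply: le_lt_trans (@pol_dist _ K r0 r x t _ _ _) _; try by rewrite /K; lra.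
    by rewrite (distrC r0); lra.
  have k2 : rnorm (k (pol r0 t) - k (pol r0 x)) <= e' / 2.
    apply: h; rewrite cdistC.
    apply: le_lt_trans (@pol_dist _ K r0 r0 x t _ _ _) _; try by rewrite /K; lra.
    rewrite subrr normr0 add0r mulrC; apply: le_lt_trans tx.
    by rewrite ler_wpM2l //; lra.
  have := rdistD (k (pol r0 x)) (k (pol r t)) (k (pol r0 t)).
  by rewrite (rdistC (k (pol r0 x))); lra.
move=> [dl dl0 h]; exists dl => // r rr hr rd.
rewrite -integB ?twopi_ge0 //; try exact: circ_has_integ.
apply: (le_trans (@integ_norm_le _ _ _ _ _ e' _ _ _)).
- exact: twopi_ge0.
- by apply: has_integB; exact: circ_has_integ.
- by move=> t tpi; exact: h.
by rewrite subr0 /e' divfK // lt0r_neq0 ?twopi_gt0.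
Qed.

Lemma circ_inv (w : R[i]) (y : V) r : cabs w < r ->
  circ (fun z => (z - w)^-1 *: y) r = (2 * pi)%:C *: y.
Proof.
move=> wr; have w0 : 0 <= cabs w := rnorm_ge0 _.
have ne s t : r <= s -> pol s t != w.
  move=> rs; have s0 : 0 <= s by lra.
  by apply: contraTneq wr => <-; rewrite cabs_pol // -leNgt.
apply: circ_infty; first lra.
  by move=> s t rs; apply: cdiff_scale (cdiff_cst _ _); apply: cdiff_inv; exact: ne.
(* The error w / (z - w) y has norm at most |w| |y| / (s - |w|) on the circle of radius s. *)
move=> e e0; pose s := r + cabs w * rnorm y / e.
have q0 : 0 <= cabs w * rnorm y / e by rewrite divr_ge0 ?mulr_ge0 ?rnorm_ge0 // ltW.
have rs : r <= s by rewrite /s; lra.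
have s0 : 0 <= s by lra.
exists s => // t; have zw : pol s t - w != 0 by rewrite subr_eq0 ne.
have -> : pol s t *: ((pol s t - w)^-1 *: y) - y = (w / (pol s t - w)) *: y.
  rewrite scalerA -[X in _ - X]scale1r -scalerBl; congr (_ *: _).
  by field.
rewrite rnormZ cabsM cabsV.
have sw : s - cabs w <= cabs (pol s t - w).
  by have := cabs_sub (pol s t) w; rewrite cabs_pol //; lra.
have sw0 : 0 < s - cabs w by rewrite /s; lra.
rewrite mulrAC ler_pdivrMr; last exact: lt_le_trans sw.
apply: le_trans (_ : e * (s - cabs w) <= _); last by rewrite ler_wpM2l // ltW.
have -> : cabs w * rnorm y = e * (cabs w * rnorm y / e).
  by rewrite [RHS]mulrC divfK // lt0r_neq0.
by rewrite ler_wpM2l ?(ltW e0) // /s; lra.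
Qed.

(** The difference quotient h of f at w, extended by the derivative, is continuous, and
    differentiable off w. Its circle integral is 0 for radii below |w|, hence at |w| by continuity,
    and constant for radii beyond |w|, hence 0 there again by continuity. Adding the integral of (z
    - w)^-1 f(w) gives the formula. *)
Lemma cauchy_formula f (w : R[i]) r : cabs w < r ->
  (forall z, cabs z <= r -> cdiff f z) ->
  circ (fun z => (z - w)^-1 *: f z) r = (2 * pi)%:C *: f w.
Proof.
move=> wr hf; have w0 : 0 <= cabs w := rnorm_ge0 _.
have r0 : 0 < r by lra.
have [B hB] := hf w (ltW wr).
pose h z := if z == w then B else (z - w)^-1 *: (f z - f w).
have hd z : cabs z <= r -> z != w -> cdiff h z.
  move=> zr zw.
  have [D hD] : cdiff (fun z => ((z - w)^-1 : R[i]^o) *: (f z - f w)) z.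
    apply: cdiff_scale; first exact: cdiff_inv.
    by apply: cdiffB (hf _ zr) (cdiff_cst _ _).
  exists D; apply: (cdiff_local (dl := cabs (z - w))) hD.
    by rewrite cabs_gt0 // subr_eq0.
  move=> u uz; rewrite /h; case: eqP => // uw.
  by move: uz; rewrite uw cdistC ltxx.
have hc z : cabs z <= r -> ccont h z.
  move=> zr; have [->|zw] := eqVneq z w; last exact/cdiff_ccont/hd.
  move=> e e0; have [dl dl0 hdl] := hB e e0; exists dl => // u uw.
  rewrite /h eqxx; case: eqP => [_|/eqP une]; first by rewrite subrr rnorm0 ltW.
  have u0 : u - w != 0 by rewrite subr_eq0.
  have -> : (u - w)^-1 *: (f u - f w) - B =
      (u - w)^-1 *: (f u - f w - (u - w) *: B).
    by rewrite [RHS]scalerBr scalerA mulVf // scale1r.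
  by rewrite rnormZ cabsV mulrC ler_pdivrMr ?cabs_gt0 // hdl.
have hcp s t : 0 <= s <= r -> ccont h (pol s t).
  by move=> /andP[s0 sr]; apply: hc; rewrite cabs_pol.
have ne s t : 0 <= s -> s != cabs w -> pol s t != w.
  by move=> s0; apply: contraNneq => <-; rewrite cabs_pol.
have hw : circ h (cabs w) = 0.
  have [wz|wnz] := eqVneq (cabs w) 0.
    rewrite wz /circ (_ : (fun t => _) = fun=> 0).
      by rewrite integ_cst ?twopi_ge0 // scaler0.
    by apply/funext => t; rewrite /pol mul0r scale0r.
  have wp : 0 < cabs w by rewrite lt_neqAle eq_sym wnz.
  apply: rnorm_le0 => e e0.
  have wr' : 0 <= cabs w <= r by rewrite w0 ltW.
  have [dl dl0 hdl] := circ_continuous w0 (fun t => hcp _ t wr') e0.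
  pose s := Num.max 0 (cabs w - dl / 2).
  have s0 : 0 <= s by rewrite le_max lexx.
  have sw : s < cabs w by rewrite gt_max wp /=; lra.
  have ds : `|s - cabs w| < dl.
    have : cabs w - dl / 2 <= s by rewrite le_max lexx orbT.
    by move=> ?; rewrite ltr_norml; apply/andP; split; lra.
  have sr : 0 <= s <= r by rewrite s0 /=; lra.
  have := hdl s s0 (fun t => hcp _ t sr) ds.
  rewrite circ0 //; first by rewrite sub0r rnormN.
  move=> s' t /andP[s'0 s's]; apply: hd; first by rewrite cabs_pol //; lra.
  by apply: ne => //; rewrite lt_eqF // (le_lt_trans s's).
have hr : circ h r = 0.
  apply: rnorm_le0 => e e0.
  have wr' : 0 <= cabs w <= r by rewrite w0 ltW.
  have [dl dl0 hdl] := circ_continuous w0 (fun t => hcp _ t wr') e0.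
  pose s := Num.min r (cabs w + dl / 2).
  have sr : s <= r by rewrite ge_min lexx.
  have sw : cabs w < s by rewrite lt_min wr /=; lra.
  have s0 : 0 <= s by lra.
  have ds : `|s - cabs w| < dl.
    have : s <= cabs w + dl / 2 by rewrite ge_min lexx orbT.
    by move=> ?; rewrite ltr_norml; apply/andP; split; lra.
  have srr : 0 <= s <= r by rewrite s0.
  have := hdl s s0 (fun t => hcp _ t srr) ds.
  rewrite hw subr0 (@circ_const h s r) //.
  move=> s' t /andP[ss s'r]; have s'0 : 0 <= s' by lra.
  apply: hd; first by rewrite cabs_pol.
  by apply: ne => //; rewrite gt_eqF // (lt_le_trans sw).
have rne t : pol r t != w by apply: ne; rewrite ?gt_eqF // ltW.
rewrite -(circ_inv (f w) wr) -[RHS]add0r -hr -circD //; last 2 first.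
- by move=> t; apply: hcp; rewrite lexx ltW.
- move=> t; apply/cdiff_ccont/cdiff_scale/cdiff_cst; exact: cdiff_inv.
apply: eq_circ => t; rewrite /h (negbTE (rne t)) -scalerDr subrK //.
- exact: ltW.
Qed.

End CircleIntegral.

(** * Derivatives and Cauchy kernels *)

Section Derivatives.
Context {R : realType}.
Implicit Types (phi : R[i]^o -> R[i]^o) (z w : R[i]).

Lemma posC_real (e : R[i]) : 0 < e -> e = (complex.Re e)%:C /\ 0 < complex.Re e.
Proof.
by case: e => a b; rewrite ltcE /= => /andP[/eqP -> ?].
Qed.

Lemma derivable_cdiff phi z : derivable phi z 1 -> cdiff phi z.
Proof.
rewrite /derivable => /cvg_ex[/= L hL]; exists L => e e0.
move/cvgrPdist_le : hL => /(_ e%:C); rewrite ltcR => /(_ e0).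
rewrite /nbhs /= => /nbhs_ballP[d /= d0 hd].
have [dE d'0] := posC_real d0; exists (complex.Re d) => // w wz.
have [->|wz0] := eqVneq w z.
  by rewrite !subrr scale0r subrr rnorm0 mulr0.
have h0 : w - z != 0 by rewrite subr_eq0.
have /hd : ball (0 : R[i]^o) d (w - z).
  by rewrite -ball_normE /= sub0r normrN dE normE ltcR.
move=> /(_ h0) /=; rewrite [(w - z) *: 1]mulr1 subrK normE lecR => h.
have -> : phi w - phi z - (w - z) *: L =
   (w - z) *: ((w - z)^-1 *: (phi w - phi z) - L).
  by rewrite scalerBr scalerA mulfV // scale1r.
by rewrite rnormZ mulrC ler_wpM2r ?rnorm_ge0 // rdistC.
Qed.

Lemma cdiff_at_quotient phi z B : cdiff_at phi z B ->
  (fun h : R[i] => h^-1 *: (phi (h + z) - phi z)) @ (0 : R[i]^o)^' --> B.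
Proof.
move=> hB; apply/cvgrPdist_le => e /posC_real[eE e0].
have [d d0 hd] := hB _ e0.
rewrite /nbhs /=; apply/nbhs_ballP; exists d%:C; first by rewrite /= ltcR.
move=> h; rewrite -ball_normE /= sub0r normrN normE ltcR => hd1 h0.
rewrite eE normE lecR.
have := hd (h + z); rewrite addrK => /(_ hd1) hh.
have -> : B - h^-1 *: (phi (h + z) - phi z) =
   - (h^-1 *: (phi (h + z) - phi z - h *: B)).
  have h1 : h != 0 by exact: h0.
  by rewrite /GRing.scale /=; field.
by rewrite rnormN rnormZ cabsV mulrC ler_pdivrMr ?cabs_gt0.
Qed.

Lemma cdiff_at_derive1 phi z B : cdiff_at phi z B -> derive1 phi z = B.
Proof.
by move=> /cdiff_at_quotient; apply: cvg_lim; exact: norm_hausdorff.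
Qed.

Lemma cdiff_at_derivable phi z B : cdiff_at phi z B -> derivable phi z 1.
Proof.
move=> /cdiff_at_quotient hB; rewrite /derivable; apply/cvg_ex; exists B.
apply: cvg_trans hB; apply: near_eq_cvg; near=> h.
by rewrite /= [h *: 1]mulr1.
Unshelve. all: by end_near. Qed.

(** A derivative depends on nearby values only, so agreement with a tower of derivatives G on an
    open disc determines all derivatives there. Used with Cauchy integrals and with rational
    functions. *)
Lemma derive1n_local (r : R) phi (G : nat -> R[i] -> R[i]^o) :
  (forall w, cabs w < r -> phi w = G 0%N w) ->
  (forall n w, cabs w < r -> cdiff_at (G n) w (G n.+1 w)) ->
  forall n w, cabs w < r -> derive1n n phi w = G n w.
Proof.
move=> h0 hG; elim=> [|n IH] w wr; first exact: h0.
rewrite derive1nS; apply: cdiff_at_derive1.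
apply: (@cdiff_local _ _ (G n) _ _ (r - cabs w)) (hG n w wr); first lra.
move=> u uw; rewrite IH //; have := cabs_sub u w; lra.
Qed.

End Derivatives.

Section CauchyDerivative.
Context {R : realType}.
Implicit Types (phi : R[i] -> R[i]^o) (z w : R[i]).

Definition cauchy_kernel phi (r : R) n w : R[i]^o :=
  circ (fun z => ((z - w)^-1 ^+ n.+1 : R[i]^o) *: phi z) r.

Lemma circle_dist (r t : R) w : 0 <= r -> r - cabs w <= cabs (pol r t - w).
Proof. by move=> r0; have := cabs_sub (pol r t) w; rewrite cabs_pol. Qed.

Lemma pol_neq (r t : R) w : cabs w < r -> pol r t != w.
Proof.
move=> wr; have w0 := rnorm_ge0 (w : R[i]^o).
have r0 : 0 <= r by lra.
have := circle_dist t w r0; apply: contraTneq => ->.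
by rewrite subrr rnorm0 -ltNge; lra.
Qed.

Lemma kernel_ccont phi (r : R) n w : cabs w < r ->
  (forall z, cabs z <= r -> cdiff phi z) ->
  forall t, ccont (fun z => ((z - w)^-1 ^+ n : R[i]^o) *: phi z) (pol r t).
Proof.
move=> wr hphi t; have w0 := rnorm_ge0 (w : R[i]^o).
apply: cdiff_ccont; apply: cdiff_scale; last by apply: hphi; rewrite cabs_pol //; lra.
by apply: cdiff_invX; exact: pol_neq.
Qed.

Lemma circle_bound phi (r : R) : 0 <= r ->
  (forall z, cabs z <= r -> cdiff phi z) ->
  exists2 M : R, 0 <= M & forall t, 0 <= t <= 2 * pi -> cabs (phi (pol r t)) <= M.
Proof.
move=> r0 hphi; have hc t : ccont phi (pol r t).
  by apply/cdiff_ccont/hphi; rewrite cabs_pol.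
apply: (@ucont_bounded _ R[i]^o _ _ _ twopi_ge0).
apply: cont_ucont; first exact: twopi_ge0.
move=> x _ e e0; have [dl dl0 h] := hc x e e0.
have r10 : 0 < r + 1 by lra.
exists (dl / (r + 1)) => [|u _]; first by rewrite divr_gt0.
rewrite ltr_pdivlMr // => ux; apply: h.
apply: le_lt_trans (@pol_dist _ (r + 1) r r u x r0 _ _) _; try lra.
by rewrite subrr normr0 add0r mulrC.
Qed.

(** Differentiation under the integral: as long as u stays within D, half the distance from w to the
    circle, both w and u have distance at least D from the circle, and the second-order remainder of
    [pow_first_order] is uniform in z. *)
Lemma cauchy_kernel_diff phi (r : R) n w : cabs w < r ->
  (forall z, cabs z <= r -> cdiff phi z) ->
  cdiff_at (cauchy_kernel phi r n) w (n.+1%:R * cauchy_kernel phi r n.+1 w).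
Proof.
move=> wr hphi; have w0 := rnorm_ge0 (w : R[i]^o).
have r0 : 0 <= r by lra.
have [M0 M00 hM0] := circle_bound r0 hphi.
pose D := (r - cabs w) / 2; have D0 : 0 < D by rewrite divr_gt0 // subr_gt0.
pose M := D^-1.
pose C := r * (n.+1%:R ^+ 2 * M ^+ n.+3 * M0) * (2 * pi) + 1.
have C0 : 0 < C.
  have MX : 0 <= M ^+ n.+3 by rewrite exprn_ge0 // invr_ge0 ltW.
  rewrite ltr_pwDr //; apply: mulr_ge0 twopi_ge0; apply: mulr_ge0 r0 _.
  by apply: mulr_ge0 M00; apply: mulr_ge0 MX; rewrite exprn_ge0.
move=> e e0; exists (Num.min D (e / C)); first by rewrite lt_min D0 divr_gt0.
move=> u; rewrite lt_min (ltr_pdivlMr _ _ C0) => /andP[u1 u2].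
have uD : cabs u < r by have := cabs_sub u w; rewrite /D in u1; lra.
set h := u - w in u1 u2 *.
have cV := @scalar_seq_complete R.
pose F z : R[i]^o := ((z - u)^-1 ^+ n.+1 - (z - w)^-1 ^+ n.+1 -
   n.+1%:R * h * (z - w)^-1 ^+ n.+2) * phi z.
pose G k v t : R[i]^o := pol r t *: (((pol r t - v)^-1 ^+ k.+1 : R[i]^o) *: phi (pol r t)).
have IG k v : cabs v < r -> has_integ (G k v) 0 (2 * pi).
  by move=> vr; have := circ_has_integ cV r0 (kernel_ccont k.+1 vr hphi); exact.
have I1 := IG n u uD; have I2 := IG n w wr; have I3 := IG n.+1 w wr.
have FE : (fun t => pol r t *: F (pol r t)) = (fun t =>
   (G n u t - G n w t) - (n.+1%:R * h) *: G n.+1 w t).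
  by apply/funext => t; rewrite /F /G /GRing.scale /=; ring.
have I12 := has_integB I1 I2; have I3' := has_integZ (n.+1%:R * h) I3.
have IF : has_integ (fun t => pol r t *: F (pol r t)) 0 (2 * pi).
  by rewrite FE; exact: has_integB I12 I3'.
have -> : cauchy_kernel phi r n u - cauchy_kernel phi r n w -
    h *: (n.+1%:R * cauchy_kernel phi r n.+1 w) = circ F r.
  rewrite /circ FE (integB twopi_ge0 I12 I3') (integB twopi_ge0 I1 I2) (integZ _ twopi_ge0 I3).
  by congr (_ - _); rewrite /GRing.scale /= mulrCA mulrA.
apply: (@le_trans _ _ (r * (n.+1%:R ^+ 2 * (cabs h ^+ 2 * M ^+ n.+3) * M0) * (2 * pi - 0))).
  apply: integ_norm_le => //; first exact: twopi_ge0.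
  move=> t tpi; rewrite rnormZ cabs_pol // ler_wpM2l // cabsM.
  have zw := @circle_dist r t w r0; have zu := @circle_dist r t u r0.
  have uw := cabs_sub u w; rewrite -/h in uw.
  have Dw : D <= cabs (pol r t - w) by rewrite /D in u1 *; lra.
  have Du : D <= cabs (pol r t - u) by rewrite /D in u1 *; lra.
  apply: ler_pM; rewrite ?rnorm_ge0 ?hM0 //.
  apply: (@pow_first_order _ _ _ _ _ n.+1 _ _ _).2.
  - have hw : pol r t - w != 0 by rewrite subr_eq0 pol_neq.
    have hu : pol r t - u != 0 by rewrite subr_eq0 pol_neq.
    by rewrite /h; field; rewrite hw hu.
  - by rewrite cabsV lef_pV2 ?posrE // (lt_le_trans D0).
  - by rewrite cabsV lef_pV2 ?posrE // (lt_le_trans D0).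
rewrite subr0; have -> : r * (n.+1%:R ^+ 2 * (cabs h ^+ 2 * M ^+ n.+3) * M0) * (2 * pi) =
  cabs h * (cabs h * (C - 1)) by rewrite /C; ring.
have h0 : 0 <= cabs h := rnorm_ge0 _.
rewrite mulrC ler_wpM2r // (le_trans _ (ltW u2)) // ler_wpM2l //; lra.
Qed.

Definition cauchy_term phi (r : R) n w : R[i]^o :=
  (n`!%:R / (2 * pi)%:C) * cauchy_kernel phi r n w.

Lemma cauchy_term_diff phi (r : R) n w : cabs w < r ->
  (forall z, cabs z <= r -> cdiff phi z) ->
  cdiff_at (cauchy_term phi r n) w (cauchy_term phi r n.+1 w).
Proof.
move=> wr hphi; rewrite /cauchy_term factS natrM -(mulrA n.+1%:R).
rewrite -mulrA mulrCA; apply: cdiff_atZ; exact: cauchy_kernel_diff.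
Qed.

Lemma twopiC_neq0 : (2 * pi)%:C != 0 :> R[i].
Proof. by rewrite -cabs_eq0 cabsC normr_eq0 lt0r_neq0 // twopi_gt0. Qed.

Lemma cauchy_derivative phi (r : R) m w : cabs w < r ->
  (forall z, cabs z <= r -> cdiff phi z) ->
  derive1n m phi w = cauchy_term phi r m w.
Proof.
move=> wr hphi.
apply: (@derive1n_local _ r phi (cauchy_term phi r)) wr => [u ur|n u ur].
  have := cauchy_formula (@scalar_seq_complete R) ur hphi.
  rewrite /cauchy_term /cauchy_kernel fact0 => h.
  have -> : circ (fun z => ((z - u)^-1 ^+ 1 : R[i]^o) *: phi z) r = (2 * pi)%:C *: phi u.
    by rewrite -h; apply: eq_circ => t; rewrite expr1.
  by rewrite /GRing.scale /= mulrA divfK ?mul1r // twopiC_neq0.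
exact: cauchy_term_diff.
Qed.

Lemma derive1n_cdiff phi (r : R) m w : cabs w < r ->
  (forall z, cabs z <= r -> cdiff phi z) -> cdiff (derive1n m phi) w.
Proof.
move=> wr hphi; exists (cauchy_term phi r m.+1 w).
apply: (@cdiff_local _ _ (cauchy_term phi r m) _ _ (r - cabs w)); first lra.
  move=> u uw; rewrite (@cauchy_derivative _ r) //.
  by have := cabs_sub u w; lra.
exact: cauchy_term_diff.
Qed.

End CauchyDerivative.

(** * Resolvents and the functional calculus *)

Section OperatorIntegral.
Context {R : realType} {X : normedModType R[i]}.
Implicit Types (F : R -> X -> X) (a b e : R).

(** The definition of a primitive yields some [dl] that may depend on f. Here [dl] is read off a
    modulus of continuity of f, so it can be shared by a family of functions, such as F(t) x for all
    x or kernels for all w on a circle. *)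
Lemma is_prim_near (f H : R -> X) a b e (dl : R) : is_prim f a b H ->
  (forall u w, a <= u <= b -> a <= w <= b -> `|u - w| < dl ->
     rnorm (f u - f w) <= e) -> near_prim f a b e dl H.
Proof.
move=> hH hf u x w au ux xw wb wu.
have uw := le_trans ux xw.
have hHu := is_prim_sub au wb hH.
have hc := @is_prim_cst R X (- f x) u w.
have hD := is_primD hHu hc.
have xab : a <= x <= b by rewrite (le_trans au ux) (le_trans xw).
have := @integ_norm_le _ _ (fun t => f t + - f x) u w e uw (ex_intro _ _ hD).
rewrite (integE uw hD).
have -> : H w + w%:C *: - f x - (H u + u%:C *: - f x) = H w - H u - (w - u)%:C *: f x.
  rewrite rmorphB /= scalerBl !scalerN opprD !opprK.
  by rewrite opprB [LHS](AC (2*2) ((1*3)*(4*2))).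
apply => t /andP[ut tw].
apply: hf => //; first by rewrite (le_trans au ut) (le_trans tw).
by rewrite ltr_norml; apply/andP; split; lra.
Qed.

Lemma opnorm_le (A : X -> X) e : 0 <= e -> linear A ->
  ((opnorm A <= e%:E)%E <-> forall x, rnorm (A x) <= e * rnorm x).
Proof.
move=> e0 lA; split => [h x|h]; last first.
  apply: ge_ereal_sup => _ [x /= x1 <-]; rewrite lee_fin.
  by apply: le_trans (h x) _; rewrite ler_piMr.
have [->|x0] := eqVneq x 0.
  by rewrite bounded_linear0 // !rnorm0 mulr0.
have nx : 0 < rnorm x.
  rewrite lt0r rnorm_ge0 andbT; apply: contraNneq x0 => /rnorm_eq0 -> //.
pose c := (rnorm x)^-1.
have c0 : 0 <= c by rewrite invr_ge0 ltW.
have : ((rnorm (A (c%:C *: x)))%:E <= e%:E)%E.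
  apply: le_trans h; apply: ereal_sup_ubound; exists (c%:C *: x) => //=.
  by rewrite rnormZr // mulVf // lt0r_neq0.
by rewrite lee_fin linear_scale // rnormZr // mulrC ler_pdivrMr.
Qed.

Lemma riemann_sum_linear F n s xi : (forall t, linear (F t)) ->
  linear (riemann_sum F n s xi).
Proof.
move=> lF k x y; rewrite /riemann_sum scaler_sumr -big_split; apply: eq_bigr => i _ /=.
by rewrite lF scalerDr !scalerA mulrC.
Qed.

(** The pointwise integral is an operator integral because the modulus of F is relative to |x|, so
    that one mesh serves all x; and two operator integrals agree because both are close to a common
    Riemann sum. *)
Lemma op_integral_eq F a b : seq_complete X -> a <= b ->
  (forall t, linear (F t)) ->
  (exists M, forall t, a <= t <= b -> forall x, rnorm (F t x) <= M * rnorm x) ->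
  (forall e, 0 < e -> exists2 dl : R, 0 < dl & forall u w, a <= u <= b ->
     a <= w <= b -> `|u - w| < dl -> forall x, rnorm (F u x - F w x) <= e * rnorm x) ->
  op_integral F a b = (fun x => integ (fun t => F t x) a b).
Proof.
move=> cX ab lF [M hM] hF.
have hi x : has_integ (fun t => F t x) a b.
  apply: ucont_has_integ => // e e0.
  have x1 : 0 < rnorm x + 1 by have := rnorm_ge0 x; lra.
  have [dl dl0 h] := hF (e / (rnorm x + 1)) (divr_gt0 e0 x1).
  exists dl => // u w ua wa uw; apply: le_trans (h u w ua wa uw x) _.
  rewrite mulrAC ler_pdivrMr // ler_wpM2l ?(ltW e0) //.
  by rewrite lerDl.
pose A x := integ (fun t => F t x) a b.
have lA : linear A.
  move=> k x y; rewrite /A -integZ // -integD //; last exact: has_integZ.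
  by apply: eq_integ => // t _; rewrite lF.
have bA : bounded_linear A.
  split=> //; exists (`|M| * (b - a)) => x; rewrite mulrAC.
  apply: integ_norm_le => // t tab; apply: le_trans (hM t tab x) _.
  by rewrite ler_wpM2r ?rnorm_ge0 // ler_norm.
have close e : 0 < e -> exists2 dl : R, 0 < dl & forall n s xi,
    tagged_partition a b dl n s xi ->
    (opnorm (fun x => riemann_sum F n s xi x - A x)%R <= e%:E)%E.
  move=> e0; have ba : 0 < b - a + 1 by lra.
  have [dl dl0 h] := hF (e / (b - a + 1)) (divr_gt0 e0 ba).
  exists dl => // n s xi tp; apply/opnorm_le; first by rewrite ltW.
    have lr := riemann_sum_linear n s xi lF.
    by move=> k x y; rewrite lr lA scalerBr opprD addrACA.
  move=> x; rewrite rdistC; have [H hH] := hi x.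
  rewrite /A (integE ab hH).
  have np := is_prim_near hH (fun u w ua wa uw => h u w ua wa uw x).
  apply: le_trans (near_prim_rsum np tp) _.
  rewrite -!mulrA ler_wpM2l ?(ltW e0) // mulrCA ler_piMr ?rnorm_ge0 //.
  by rewrite ler_pdivrMl // mulr1; lra.
have : is_op_integral F a b (op_integral F a b).
  by rewrite /op_integral; apply: getPex; exists A.
move=> [[lB _] hB]; apply/funext => x.
apply/eqP; rewrite -subr_eq0; apply/eqP/rnorm_le0 => e e0.
pose e' := e / 2 / (rnorm x + 1).
have x1 : 0 < rnorm x + 1 by have := rnorm_ge0 x; lra.
have e'0 : 0 < e' by rewrite divr_gt0 // half_gt0.
have [d1 d10 h1] := hB _ e'0; have [d2 d20 h2] := close _ e'0.
have [n [s [xi tp]]] : exists n s xi, tagged_partition a b (Num.min d1 d2) n s xi.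
  by apply: ex_partition; rewrite // lt_min d10.
have [tp1 tp2] : tagged_partition a b d1 n s xi /\ tagged_partition a b d2 n s xi.
  move: tp => [s0 sn st]; split; split => // i /st[h]; rewrite lt_min => /andP[] //.
have lr := riemann_sum_linear n s xi lF.
have l1 : linear (fun x => riemann_sum F n s xi x - op_integral F a b x).
  by move=> k y z; rewrite lr lB scalerBr opprD addrACA.
have l2 : linear (fun x => riemann_sum F n s xi x - A x).
  by move=> k y z; rewrite lr lA scalerBr opprD addrACA.
have := (opnorm_le (ltW e'0) l1).1 (h1 _ _ _ tp1) x; have := (opnorm_le (ltW e'0) l2).1 (h2 _ _ _ tp2) x.
have := rdistD (riemann_sum F n s xi x) (op_integral F a b x) (A x).
rewrite /= (rdistC (op_integral F a b x) (riemann_sum F n s xi x)).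
have : e' * rnorm x <= e / 2.
  have : e' * (rnorm x + 1) = e / 2 by rewrite /e' divfK // lt0r_neq0.
  by rewrite mulrDr mulr1; lra.
rewrite /A; lra.
Qed.

End OperatorIntegral.

Section OperatorPowers.
Context {R : realType} {X : normedModType R[i]}.

Lemma iter_bound (A : X -> X) (M : R) n x : 0 <= M ->
  (forall y, rnorm (A y) <= M * rnorm y) -> rnorm (iter n A x) <= M ^+ n * rnorm x.
Proof.
move=> M0 hA; elim: n => [|n IH]; first by rewrite expr0 mul1r.
by rewrite iterS (le_trans (hA _)) // exprS -mulrA ler_wpM2l.
Qed.

(** The operator version of [pow_first_order], for resolvents A and B tied by the resolvent
    identity. The induction step needs n^2 + n + 1 <= (n + 1)^2. *)
Lemma op_pow_first_order (A B : X -> X) (h : R[i]) (M : R) n x : linear B ->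
  0 <= M -> (forall y, rnorm (A y) <= M * rnorm y) ->
  (forall y, rnorm (B y) <= M * rnorm y) ->
  (forall y, B y - A y = h *: B (A y)) ->
  rnorm (iter n B x - iter n A x) <= n%:R * (cabs h * M ^+ n.+1) * rnorm x /\
  rnorm (iter n B x - iter n A x - (n%:R * h) *: iter n.+1 A x) <=
    n%:R ^+ 2 * (cabs h ^+ 2 * M ^+ n.+2) * rnorm x.
Proof.
move=> lB M0 hA hB hBA.
have h0 : 0 <= cabs h := rnorm_ge0 _; have x0 : 0 <= rnorm x := rnorm_ge0 _.
have dBA y : rnorm (B y - A y) <= cabs h * M ^+ 2 * rnorm y.
  rewrite hBA rnormZ -mulrA ler_wpM2l // (le_trans (hB _)) //.
  by rewrite expr2 -mulrA ler_wpM2l.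
have aX k : rnorm (iter k A x) <= M ^+ k * rnorm x := iter_bound k x M0 hA.
elim: n => [|n [IH1 IH2]].
  split; rewrite /= subrr; first by rewrite rnorm0 mulr_ge0 ?mulr_ge0 ?exprn_ge0.
  rewrite [0%:R * h](_ : _ = 0) ?scale0r ?subrr ?rnorm0; last by rewrite mul0r.
  by rewrite !mulr_ge0 ?exprn_ge0.
split.
  have -> : iter n.+1 B x - iter n.+1 A x =
      B (iter n B x - iter n A x) + (B (iter n A x) - A (iter n A x)).
    by rewrite !iterS (linear_sub lB) addrA subrK.
  apply: le_trans (rnormD _ _) _.
  have t1 := le_trans (hB (iter n B x - iter n A x)) (ler_wpM2l M0 IH1).
  have t2 := le_trans (dBA (iter n A x))
    (ler_wpM2l (mulr_ge0 h0 (exprn_ge0 2 M0)) (aX n)).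
  apply: le_trans (lerD t1 t2) _.
  rewrite le_eqVlt; apply/orP; left; apply/eqP.
  by rewrite -natr1 !exprS; ring.
have -> : iter n.+1 B x - iter n.+1 A x - (n.+1%:R * h) *: iter n.+2 A x =
  B (iter n B x - iter n A x - (n%:R * h) *: iter n.+1 A x) +
  h *: (B (iter n.+1 A x) - A (iter n.+1 A x)) +
  (n%:R * h) *: (B (iter n.+1 A x) - A (iter n.+1 A x)).
  rewrite -[RHS]addrA -scalerDl !(linear_sub lB) (linear_scale lB).
  have e1 : B (iter n A x) = iter n.+1 A x + h *: B (iter n.+1 A x).
    by rewrite (iterS n A x) -hBA addrC subrK.
  rewrite -(iterS n B) e1 -(iterS n.+1 A x).
  have -> : h + n%:R * h = n.+1%:R * h by rewrite -natr1; ring.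
  have -> : (n.+1%:R * h) *: (B (iter n.+1 A x) - iter n.+2 A x) =
     (n%:R * h) *: B (iter n.+1 A x) + h *: B (iter n.+1 A x)
        - (n.+1%:R * h) *: iter n.+2 A x.
    by rewrite scalerBr -scalerDl -natr1; congr (_ *: _ - _); ring.
  rewrite opprD [RHS](AC (1*2*1*3) ((1*2*7)*((4*5)*(3*6))))/=.
  by rewrite !addNr !addr0.
apply: le_trans (rnormD _ _) _; apply: le_trans (lerD (rnormD _ _) (lexx _)) _.
have nn : cabs (n%:R * h) = n%:R * cabs h.
  by rewrite cabsM -(rmorph_nat (real_complex R) n) cabsC ger0_norm.
rewrite (rnormZ h) (rnormZ (n%:R * h)) nn.
have t1 := le_trans (hB (iter n B x - iter n A x - (n%:R * h) *: iter n.+1 A x))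
  (ler_wpM2l M0 IH2).
have t2 := le_trans (dBA (iter n.+1 A x))
    (ler_wpM2l (mulr_ge0 h0 (exprn_ge0 2 M0)) (aX n.+1)).
have t3 := ler_wpM2l h0 t2.
have t4 := ler_wpM2l (mulr_ge0 (ler0n R n) h0) t2.
apply: le_trans (lerD (lerD t1 t3) t4) _.
have -> : M * (n%:R ^+ 2 * (cabs h ^+ 2 * M ^+ n.+2) * rnorm x) +
  cabs h * (cabs h * M ^+ 2 * (M ^+ n.+1 * rnorm x)) +
  n%:R * cabs h * (cabs h * M ^+ 2 * (M ^+ n.+1 * rnorm x)) =
  (n%:R ^+ 2 + 1 + n%:R) * (cabs h ^+ 2 * M ^+ n.+3) * rnorm x.
  by rewrite !exprS; ring.
apply: ler_wpM2r => //; apply: ler_wpM2r; first by rewrite mulr_ge0 // exprn_ge0.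
by have : 0 <= n%:R :> R by []; rewrite -natr1; nra.
Qed.

End OperatorPowers.

Lemma cnormE (R : realType) (a : R[i]) : `|a| = (cabs a)%:C.
Proof. exact: (@normE R R[i]^o a). Qed.

Section Resolvent.
Context {R : realType} {X : completeNormedModType R[i]}.
Variable T : X -> X.
Hypotheses (hT : bounded_linear T) (hsigma : spectrum T `<=` closed_unit_disc).

Local Notation Rs lambda := (resolvent lambda T).
Implicit Types (l m z : R[i]) (x y : X).

Lemma resolventP l : 1 < cabs l -> bounded_inverse (fun x => l *: x - T x) (Rs l).
Proof.
move=> l1; rewrite /resolvent; apply: getPex; apply: contrapT => h.
have := @hsigma l; rewrite /spectrum /closed_unit_disc /= => /(_ h).
by rewrite cnormE (lecR _ 1) leNgt l1.
Qed.

Lemma resolvent_linear l : 1 < cabs l -> linear (Rs l).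
Proof. by move=> /resolventP[[]]. Qed.

Lemma resolvent_bounded l : 1 < cabs l ->
  exists2 M : R, 0 <= M & forall x, rnorm (Rs l x) <= M * rnorm x.
Proof.
move=> /resolventP[[_ [M hM]] _ _]; exists `|M| => // x.
by rewrite (le_trans (hM x)) // ler_wpM2r ?rnorm_ge0 // ler_norm.
Qed.

Lemma resolvent_identity l m x : 1 < cabs l -> 1 < cabs m ->
  Rs l x - Rs m x = (m - l) *: Rs l (Rs m x).
Proof.
move=> l1 m1; have lR := resolvent_linear l1.
have [_ hl _] := resolventP l1; have [_ _ hm] := resolventP m1.
rewrite -(linear_scale lR) -{1}(hm x) -{3}(hl (Rs m x)) -(linear_sub lR).
congr (Rs l _); rewrite scalerBl opprB.
by rewrite [LHS](AC (2*2) ((1*4)*(2*3)))/= addNr addr0.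
Qed.

(** In R(m) = R(l) - (m - l) R(l) R(m) the last term has norm at most half that of R(m) x and is
    absorbed on the left. *)
Lemma resolvent_near l M : 1 < cabs l -> 0 <= M ->
  (forall x, rnorm (Rs l x) <= M * rnorm x) ->
  forall m, 1 < cabs m -> cabs (m - l) * (2 * M) <= 1 ->
  forall x, rnorm (Rs m x) <= 2 * M * rnorm x.
Proof.
move=> l1 M0 hM m m1 ml x.
have := resolvent_identity x l1 m1 => h.
have := rnorm_sub (Rs m x) (Rs l x); rewrite rdistC h rnormZ.
have := hM (Rs m x); have := hM x.
set A := rnorm (Rs m x); set D := cabs (m - l) in ml *.
have A0 : 0 <= A := rnorm_ge0 _; have D0 : 0 <= D := rnorm_ge0 _.
move=> h1 h2 h3.
have : D * rnorm (Rs l (Rs m x)) <= D * (M * A) by rewrite ler_wpM2l.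
have : D * (2 * M) * A <= 1 * A by rewrite ler_wpM2r.
have -> : D * (2 * M) * A = 2 * (D * (M * A)) by ring.
lra.
Qed.

(** Compactness of the annulus: the local bounds of [resolvent_near] are assembled by bisection in
    (u, t). *)
Lemma resolvent_annulus_bound (r s : R) : 1 < r -> r <= s ->
  exists2 M : R, 0 <= M & forall u t, r <= u <= s -> 0 <= t <= 2 * pi ->
    forall x, rnorm (Rs (pol u t) x) <= M * rnorm x.
Proof.
move=> r1 rs.
pose P (a b c d : R) := exists2 M : R, 0 <= M & forall u t, r <= u -> a <= u <= b -> c <= t <= d ->
    forall x, rnorm (Rs (pol u t) x) <= M * rnorm x.
suff : P r s 0 (2 * pi).
  move=> [M M0 h]; exists M => // u t usr tpi.
  by apply: h => //; case/andP: usr.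
apply: box_ind => //; first exact: twopi_ge0.
  move=> a b c d ab cd [M1 p1 h1] [M2 p2 h2] [M3 p3 h3] [M4 p4 h4].
  exists (M1 + M2 + M3 + M4); first by rewrite !addr_ge0.
  move=> u t ru /andP[au ub] /andP[ct td] x.
  have x0 : 0 <= rnorm x := rnorm_ge0 _.
  have [um|um] := leP u ((a + b) / 2); have [tm|tm] := leP t ((c + d) / 2).
  - have le : a <= u <= (a + b) / 2 by rewrite au.
    have lt' : c <= t <= (c + d) / 2 by rewrite ct.
    by apply: le_trans (h1 u t ru le lt' x) _; rewrite ler_wpM2r //; lra.
  - have le : a <= u <= (a + b) / 2 by rewrite au.
    have lt' : (c + d) / 2 <= t <= d by rewrite td ltW.
    by apply: le_trans (h3 u t ru le lt' x) _; rewrite ler_wpM2r //; lra.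
  - have le : (a + b) / 2 <= u <= b by rewrite ub ltW.
    have lt' : c <= t <= (c + d) / 2 by rewrite ct.
    by apply: le_trans (h2 u t ru le lt' x) _; rewrite ler_wpM2r //; lra.
  - have le : (a + b) / 2 <= u <= b by rewrite ub ltW.
    have lt' : (c + d) / 2 <= t <= d by rewrite td ltW.
    by apply: le_trans (h4 u t ru le lt' x) _; rewrite ler_wpM2r //; lra.
move=> u0 t0 /andP[u0r u0s] _.
have u01 : 1 < cabs (pol u0 t0) by rewrite cabs_pol; lra.
have [M M0 hM] := resolvent_bounded u01.
have s0 : 0 < s by lra.
(* If |u - u0| and |t - t0| are below 1 / K, the points are at distance at most 2 s / K = 1 / (2 (M
   + 1)), as [resolvent_near] requires. *)
pose K := s * (4 * (M + 1)).
have K0 : 0 < K by rewrite /K mulr_gt0 // mulr_gt0 //; lra.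
exists (K^-1); first by rewrite invr_gt0.
move=> a b c d ra /andP[au ub] bs c0 /andP[ct td] dpi ba dc; exists (2 * M).
  by rewrite mulr_ge0.
move=> u t ru /andP[au' ub'] /andP[ct' td'].
apply: (resolvent_near u01 M0 hM); first by rewrite cabs_pol; lra.
have d1 : cabs (pol u t - pol u0 t0) <= s * (`|u - u0| + `|t - t0|).
  by apply: pol_dist; lra.
have k1 : `|u - u0| < K^-1 by rewrite ltr_norml; apply/andP; split; lra.
have k2 : `|t - t0| < K^-1 by rewrite ltr_norml; apply/andP; split; lra.
have KK : K^-1 * s * (4 * (M + 1)) = 1 by rewrite -mulrA -/K mulVf // lt0r_neq0.
apply: (@le_trans _ _ (s * (2 * K^-1) * (2 * (M + 1)))).
  have M2 : 0 <= 2 * M by rewrite mulr_ge0.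
  have M3 : 2 * M <= 2 * (M + 1) by lra.
  apply: ler_pM (rnorm_ge0 _) M2 _ M3.
  by apply: le_trans d1 _; rewrite ler_wpM2l ?(ltW s0) //; lra.
have -> // : s * (2 * K^-1) * (2 * (M + 1)) = K^-1 * s * (4 * (M + 1)) by ring.
by rewrite KK.
Qed.

(** M bounds the norm of T. Both estimates come from l R(l) x = x + T R(l) x, with no Neumann
    series. *)
Lemma resolvent_infty : exists2 M : R, 0 <= M & forall l, 1 < cabs l -> M < cabs l ->
  forall x, rnorm (Rs l x) <= rnorm x / (cabs l - M) /\
    rnorm (l *: Rs l x - x) <= M * rnorm x / (cabs l - M).
Proof.
have [lT [M' hM']] := hT; pose M := `|M'|.
have hM x : rnorm (T x) <= M * rnorm x.
  by rewrite (le_trans (hM' x)) // ler_wpM2r ?rnorm_ge0 // ler_norm.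
exists M; first exact: normr_ge0.
move=> l l1 lM x; have [_ _ hl] := resolventP l1.
have lM0 : 0 < cabs l - M by rewrite subr_gt0.
have h1 : rnorm (Rs l x) <= rnorm x / (cabs l - M).
  rewrite ler_pdivlMr //.
  have := hl x => e; have := rnorm_sub (l *: Rs l x) (T (Rs l x)); rewrite e rnormZ.
  have := hM (Rs l x); lra.
split=> //.
have -> : l *: Rs l x - x = T (Rs l x) by rewrite -{2}(hl x) opprB addrC subrK.
apply: le_trans (hM _) _; rewrite -mulrA ler_wpM2l //; exact: normr_ge0.
Qed.

(** By the resolvent identity the first-order remainder is exactly (m - l)^2 R(m) R(l)^2 x. *)
Lemma resolvent_cdiff l x : 1 < cabs l -> cdiff (fun z => Rs z x) l.
Proof.
move=> l1; have [M M0 hM] := resolvent_bounded l1.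
pose M1 := M + 1; have M10 : 0 < M1 by rewrite /M1; lra.
have hM1 y : rnorm (Rs l y) <= M1 * rnorm y.
  by rewrite (le_trans (hM y)) // ler_wpM2r ?rnorm_ge0 // /M1 lerDl.
exists (- (Rs l (Rs l x))) => e e0.
pose C := 2 * M1 ^+ 3 * rnorm x + 1.
have C0 : 0 < C by rewrite ltr_pwDr // !mulr_ge0 ?rnorm_ge0 // ltW.
exists (Num.min (cabs l - 1) (Num.min ((2 * M1)^-1) (e / C))).
  by rewrite !lt_min subr_gt0 l1 invr_gt0 mulr_gt0 // divr_gt0.
move=> m; rewrite !lt_min => /andP[m1 /andP[m2 m3]].
have m11 : 1 < cabs m by have := cabs_sub l m; rewrite cdistC; lra.
have M20 : 0 < 2 * M1 by rewrite mulr_gt0.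
have hm := resolvent_near l1 (ltW M10) hM1 m11.
have {}hm : forall y, rnorm (Rs m y) <= 2 * M1 * rnorm y.
  by apply: hm; rewrite -ler_pdivlMr // mul1r ltW.
have -> : Rs m x - Rs l x - (m - l) *: - Rs l (Rs l x) =
   ((m - l) * (m - l)) *: Rs m (Rs l (Rs l x)).
  rewrite resolvent_identity // scalerN opprK.
  have -> : (l - m) *: Rs m (Rs l x) = - ((m - l) *: Rs m (Rs l x)).
    by rewrite -scaleNr opprB.
  rewrite addrC -scalerBr -scalerA; congr (_ *: _).
  by rewrite -opprB resolvent_identity // -scaleNr opprB.
rewrite rnormZ cabsM -mulrA mulrC ler_wpM2r ?rnorm_ge0 //.
move: m3; rewrite (ltr_pdivlMr _ _ C0) => m3.
apply: le_trans (_ : cabs (m - l) * (C - 1) <= _); last first.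
  apply: le_trans (ltW m3); rewrite ler_wpM2l ?rnorm_ge0 //; lra.
rewrite ler_wpM2l ?rnorm_ge0 //; apply: le_trans (hm _) _.
have -> : C - 1 = 2 * M1 * (M1 * (M1 * rnorm x)) by rewrite /C; ring.
rewrite ler_wpM2l ?(ltW M20) // (le_trans (hM1 _)) // ler_wpM2l ?(ltW M10) //.
Qed.

Lemma resolvent_lip l m M x : 1 < cabs l -> 1 < cabs m -> 0 <= M ->
  (forall y, rnorm (Rs l y) <= M * rnorm y) ->
  (forall y, rnorm (Rs m y) <= M * rnorm y) ->
  rnorm (Rs l x - Rs m x) <= cabs (l - m) * M ^+ 2 * rnorm x.
Proof.
move=> l1 m1 M0 hl hm; rewrite resolvent_identity // rnormZ cdistC -mulrA.
rewrite ler_wpM2l ?rnorm_ge0 // (le_trans (hl _)) // expr2 -mulrA ler_wpM2l //.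
Qed.

Lemma resolvent_pow_first_order l m (M : R) n x : 1 < cabs l -> 1 < cabs m -> 0 <= M ->
  (forall y, rnorm (Rs l y) <= M * rnorm y) ->
  (forall y, rnorm (Rs m y) <= M * rnorm y) ->
  rnorm (iter n (Rs m) x - iter n (Rs l) x) <=
    n%:R * (cabs (l - m) * M ^+ n.+1) * rnorm x /\
  rnorm (iter n (Rs m) x - iter n (Rs l) x - (n%:R * (l - m)) *: iter n.+1 (Rs l) x) <=
    n%:R ^+ 2 * (cabs (l - m) ^+ 2 * M ^+ n.+2) * rnorm x.
Proof.
move=> l1 m1 M0 hl hm; apply: op_pow_first_order => //; first exact: resolvent_linear.
by move=> y; exact: resolvent_identity.
Qed.

(** By R(z) x = R(l) x + (l - z) R(z) R(l) x one power of the kernel is traded for one power of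
    R(l); the other term, a scalar kernel times a fixed vector, is holomorphic inside the circle and
    integrates to 0. For n = 0, z R(z) x tends to x at infinity. *)
Lemma kernel_integral (rho : R) l n x : 1 < rho -> rho < cabs l ->
  circ (fun z => (l - z)^-1 ^+ n *: Rs z x) rho = (2 * pi)%:C *: iter n (Rs l) x.
Proof.
move=> rho1 rhol; have cX := @complete_seq_complete R X.
have r0 : 0 <= rho by lra.
have pol1 s t : rho <= s -> 1 < cabs (pol s t) by move=> ?; rewrite cabs_pol; lra.
have l1 : 1 < cabs l by lra.
have kd k z : cabs z <= rho -> cdiff (fun z => ((l - z)^-1 ^+ k : R[i]^o)) z.
  move=> zr; have zl : z != l by apply: contraTneq zr => ->; rewrite -ltNge.
  have := cdiff_scale (cdiff_cst ((-1) ^+ k : R[i]^o) z) (cdiff_invX k zl).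
  congr cdiff; apply/funext => w /=.
  by rewrite /GRing.scale /= -exprMn -invrN1 -invfM mulN1r opprB.
elim: n x => [|n IH] x.
  rewrite (_ : (fun z => _) = (fun z => Rs z x)); last first.
    by apply/funext => z; rewrite expr0 scale1r.
  apply: circ_infty => //; first by move=> s t rs; apply: resolvent_cdiff; exact: pol1.
  move=> e e0; have [M M0 hM] := resolvent_infty.
  have q0 : 0 <= M * rnorm x / e by rewrite divr_ge0 ?mulr_ge0 ?rnorm_ge0 // ltW.
  pose s := rho + M + M * rnorm x / e.
  have rs : rho <= s by rewrite /s; lra.
  have s0 : 0 <= s by lra.
  have sM : M < s by rewrite /s; lra.
  exists s => // t; have cs : cabs (pol s t) = s by rewrite cabs_pol.
  have sM' : M < cabs (pol s t) by rewrite cs.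
  apply: le_trans (hM _ (pol1 s t rs) sM' x).2 _.
  rewrite cs ler_pdivrMr ?subr_gt0 //.
  have -> : M * rnorm x = e * (M * rnorm x / e) by rewrite [RHS]mulrC divfK // lt0r_neq0.
  by rewrite ler_wpM2l ?(ltW e0) // /s; lra.
rewrite iterSr -IH.
have eqf z : 1 < cabs z -> z != l -> (l - z)^-1 ^+ n.+1 *: Rs z x =
   (l - z)^-1 ^+ n.+1 *: Rs l x + (l - z)^-1 ^+ n *: Rs z (Rs l x).
  move=> z1 zl; have lz : l - z != 0 by rewrite subr_eq0 eq_sym.
  have -> : Rs z x = Rs l x + (l - z) *: Rs z (Rs l x).
    by rewrite -resolvent_identity // addrC subrK.
  rewrite scalerDr scalerA; congr (_ + _ *: _).
  by rewrite exprSr -mulrA mulVf // mulr1.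
rewrite (@eq_circ _ _ _ (fun z => (l - z)^-1 ^+ n.+1 *: Rs l x + (l - z)^-1 ^+ n *: Rs z (Rs l x))); last first.
  move=> t; apply: eqf; first exact: pol1.
  by apply: contraTneq rhol => <-; rewrite cabs_pol // ltxx.
have pr t : cabs (pol rho t) <= rho by rewrite cabs_pol.
rewrite circD //.
- rewrite (circ0 cX r0) ?add0r // => s t /andP[s0 sr].
  by apply: cdiff_scale (cdiff_cst _ _); apply: kd; rewrite cabs_pol.
- by move=> t; apply: cdiff_ccont; apply: cdiff_scale (cdiff_cst _ _); exact: kd.
- move=> t; apply: cdiff_ccont; apply: cdiff_scale; first exact: kd.
  by apply: resolvent_cdiff; exact: pol1.
Qed.

End Resolvent.

(** * Sums over equally spaced points *)

Section UniformSums.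
Context {R : realType} {V : normedModType R[i]}.

Lemma rsum_upt (f : R -> V) (a b : R) n :
  rsum f n (upt a b n) (upt a b n) = ((b - a) / n%:R)%:C *: \sum_(i < n) f (upt a b n i).
Proof.
rewrite /rsum scaler_sumr; apply: eq_bigr => i _; congr (_%:C *: _).
by rewrite /upt -natr1 mulrDl mul1r opprD addrACA subrr add0r addrAC subrr add0r.
Qed.

Lemma integ_upt_sum (f : R -> V) (a b e dl : R) n : a <= b -> (0 < n)%N ->
  (b - a) / n%:R < dl -> has_integ f a b ->
  (forall u w, a <= u <= b -> a <= w <= b -> `|u - w| < dl -> rnorm (f u - f w) <= e) ->
  rnorm (integ f a b - ((b - a) / n%:R)%:C *: \sum_(i < n) f (upt a b n i)) <= e * (b - a).
Proof.
move=> ab n0 hn [H hH] hf; rewrite (integE ab hH) -rsum_upt.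
exact: near_prim_rsum (is_prim_near hH hf) (upt_partition ab n0 hn).
Qed.

Lemma circ_sum (f : nat -> R[i] -> V) (r : R) n : seq_complete V -> 0 <= r ->
  (forall j t, (j < n)%N -> ccont (f j) (pol r t)) ->
  (forall t, ccont (fun z => \sum_(j < n) f j z) (pol r t)) /\
  circ (fun z => \sum_(j < n) f j z) r = \sum_(j < n) circ (f j) r.
Proof.
move=> cV r0; elim: n => [|n IH] hf.
  have -> : (fun z => \sum_(j < 0) f j z) = (fun=> 0 *: 0).
    by apply/funext => z; rewrite big_ord0 scaler0.
  split; first by move=> t; apply: cdiff_ccont; exact: cdiff_cst.
  rewrite big_ord0 /circ (_ : (fun t => _) = fun=> 0).
    by rewrite integ_cst ?twopi_ge0 // scaler0.
  by apply/funext => t; rewrite !scaler0.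
have [|h1 h2] := IH; first by move=> j t jn; apply: hf; rewrite ltnS ltnW.
have -> : (fun z => \sum_(j < n.+1) f j z) = (fun z => \sum_(j < n) f j z + f n z).
  by apply/funext => z; rewrite big_ord_recr.
have hn t : ccont (f n) (pol r t) by exact: hf.
split; last by rewrite big_ord_recr /= circD // h2.
move=> t e e0; have [d1 d10 k1] := h1 t _ (half_gt0 e0).
have [d2 d20 k2] := hn t _ (half_gt0 e0).
exists (Num.min d1 d2); first by rewrite lt_min d10.
move=> w; rewrite lt_min => /andP[w1 w2]; rewrite opprD addrACA.
apply: le_trans (rnormD _ _) _; have := k1 w w1; have := k2 w w2; lra.
Qed.

End UniformSums.

Section KernelSums.
Context {R : realType}.

Lemma pol_lip (r u w : R) : 0 <= r -> cabs (pol r u - pol r w) <= r * `|u - w|.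
Proof.
move=> r0; rewrite /pol -mulrBr cabsM cabsC ger0_norm // ler_wpM2l //.
exact: expi_lip.
Qed.

Definition node (r : R) n j : R[i] := pol r (upt 0 (2 * pi) n j).

(** Riemann sums of Cauchy's formula for the m-th derivative, uniformly for w on the inner circle.
    Uniformity allows inserting them under the integral that defines the calculus. *)
Lemma kernel_rsum (phi : R[i] -> R[i]^o) (rho r : R) m : 0 <= rho -> rho < r ->
  (forall z, cabs z <= r -> cdiff phi z) ->
  forall e : R, 0 < e -> exists N, forall n, (N <= n)%N -> (0 < n)%N /\ forall w, cabs w = rho ->
   cabs (derive1n m phi w - m`!%:R / n%:R *
     \sum_(j < n) (node r n j * phi (node r n j)) * (node r n j - w)^-1 ^+ m.+1) <= e.
Proof.
move=> rho0 rhor hphi e e0.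
have r0 : 0 <= r by lra.
have cV := @scalar_seq_complete R.
pose p t : R[i]^o := pol r t * phi (pol r t).
have pc t : ccont phi (pol r t) by apply/cdiff_ccont/hphi; rewrite cabs_pol.
have up : ucont p 0 (2 * pi).
  have rK : 2 * r <= 2 * r by [].
  have := @curve_ucont _ _ phi _ _ _ 0 (2 * pi) twopi_ge0 (arc_curve 0 (2 * pi) r0 rK) (fun t _ => pc t).
  move=> h e1 e10; have [dl dl0 {}h] := h e1 e10; exists dl => // u w uab wab uw.
  have := h u w uab wab uw; congr (_ <= _).
  rewrite /p /GRing.scale /= -!mulrA -mulrBr cabsM cabs_i mul1r //.
have [Mp Mp0 hMp] := ucont_bounded twopi_ge0 up.
pose D := r - rho; have D0 : 0 < D by rewrite subr_gt0.
pose M := D^-1; have M0 : 0 < M by rewrite invr_gt0.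
pose B : R := m`!%:R; have B0 : 0 <= B by rewrite /B.
pose e1 := e / (B + 1).
have B1 : 0 < B + 1 by lra.
have e10 : 0 < e1 by rewrite divr_gt0.
(* A dominates the kernel, and L below dominates sup |p| times its Lipschitz constant in t; each
   accounts for half of e1 in the modulus of the product. *)
pose A := M ^+ m.+1 + 1; have A0 : 0 < A by rewrite ltr_pwDr // exprn_ge0 // ltW.
pose L := Mp * (m.+1%:R * (r * M ^+ m.+2)) + 1.
have L0 : 0 < L.
  have MX : 0 <= M ^+ m.+2 by rewrite exprn_ge0 // ltW.
  by rewrite ltr_pwDr //; apply: mulr_ge0 Mp0 (mulr_ge0 (ler0n _ _) (mulr_ge0 r0 MX)).
have [d1 d10 h1] := up _ (divr_gt0 (half_gt0 e10) A0).
pose dl := Num.min d1 (e1 / 2 / L).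
have dl0 : 0 < dl by rewrite lt_min d10 divr_gt0 // half_gt0.
have [N hN] := ex_fine_mesh twopi_ge0 dl0.
exists N => n /hN[n0 hn]; split=> // w wrho.
have wr : cabs w < r by rewrite wrho.
have zw t : D <= cabs (pol r t - w) by have := circle_dist t w r0; rewrite wrho.
have aM t : cabs (pol r t - w)^-1 <= M.
  by rewrite cabsV lef_pV2 ?posrE // (lt_le_trans D0).
pose G t : R[i]^o := p t * (pol r t - w)^-1 ^+ m.+1.
have GE : (fun t => pol r t *: (((pol r t - w)^-1 ^+ m.+1 : R[i]^o) *: phi (pol r t))) = G.
  by apply/funext => t; rewrite /G /p /GRing.scale /=; ring.
have hG := circ_has_integ cV r0 (kernel_ccont m.+1 wr hphi).
rewrite GE in hG.
have n0' : n%:R != 0 :> R[i] by rewrite pnatr_eq0 lt0n_neq0.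
have nr0 : n%:R != 0 :> R by rewrite pnatr_eq0 lt0n_neq0.
rewrite (@cauchy_derivative _ _ r) // /cauchy_term /cauchy_kernel /circ GE.
have hmod u v : 0 <= u <= 2 * pi -> 0 <= v <= 2 * pi -> `|u - v| < dl ->
    cabs (G u - G v) <= e1.
  move=> upi vpi; rewrite lt_min (ltr_pdivlMr _ _ L0) => /andP[uv1 uv2].
  have -> : G u - G v = (p u - p v) * (pol r u - w)^-1 ^+ m.+1 +
     p v * ((pol r u - w)^-1 ^+ m.+1 - (pol r v - w)^-1 ^+ m.+1).
    by rewrite /G; ring.
  apply: le_trans (cabsD _ _) _; rewrite (cabsM (p u - p v)) (cabsM (p v)) cabsX.
  have t1 : cabs (p u - p v) * cabs (pol r u - w)^-1 ^+ m.+1 <= e1 / 2.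
    apply: (@le_trans _ _ (e1 / 2 / A * A)); last by rewrite divfK // lt0r_neq0.
    apply: ler_pM; rewrite ?exprn_ge0 ?rnorm_ge0 //; first exact: h1.
    apply: (@le_trans _ _ (M ^+ m.+1)); last by rewrite /A; lra.
    by rewrite lerXn2r ?nnegrE ?rnorm_ge0 ?(ltW M0).
  have t2 : cabs (p v) * cabs ((pol r u - w)^-1 ^+ m.+1 - (pol r v - w)^-1 ^+ m.+1) <= e1 / 2.
    have := @pow_first_order _ (pol r v - w)^-1 (pol r u - w)^-1 (pol r v - pol r u) M m.+1.
    case=> //.
      have u0 : pol r u - w != 0 by rewrite subr_eq0 pol_neq.
      have v0 : pol r v - w != 0 by rewrite subr_eq0 pol_neq.
      by field; rewrite u0 v0.
    move=> h2 _; apply: le_trans (_ : Mp * (m.+1%:R * (r * `|u - v| * M ^+ m.+2)) <= _).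
      apply: ler_pM; rewrite ?rnorm_ge0 //; first exact: hMp.
      apply: le_trans h2 _; rewrite ler_wpM2l // ler_wpM2r ?exprn_ge0 ?(ltW M0) //.
      by rewrite cdistC pol_lip.
    apply: le_trans (ltW uv2).
    have -> : Mp * (m.+1%:R * (r * `|u - v| * M ^+ m.+2)) = `|u - v| * (L - 1).
      by rewrite /L; ring.
    by rewrite ler_wpM2l //; lra.
  lra.
have : cabs (integ G 0 (2 * pi) - ((2 * pi) / n%:R)%:C * \sum_(i < n) G (upt 0 (2 * pi) n i))
    <= e1 * (2 * pi).
  have := @integ_upt_sum _ _ G 0 (2 * pi) e1 dl n twopi_ge0 n0.
  by rewrite subr0 => /(_ hn hG hmod).
set S := \sum_(i < n) G _ => hS.
have -> : m`!%:R / (2 * pi)%:C * integ G 0 (2 * pi) - m`!%:R / n%:R * S =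
   (m`!%:R / (2 * pi)%:C) * (integ G 0 (2 * pi) - ((2 * pi) / n%:R)%:C * S).
  rewrite fmorph_div /= rmorph_nat; have := @twopiC_neq0 R.
  move: (m`!%:R) (integ G _ _) (2 * pi)%:C => x y q q0.
  by field; rewrite n0' q0.
rewrite cabsM cabsM cabsV -(rmorph_nat (real_complex R) m`!) !cabsC.
rewrite (ger0_norm twopi_ge0) (ger0_norm B0) -/B.
apply: (@le_trans _ _ (B / (2 * pi) * (e1 * (2 * pi)))).
  by rewrite ler_wpM2l // divr_ge0 // twopi_ge0.
have -> : B / (2 * pi) * (e1 * (2 * pi)) = B * e1.
  by have := lt0r_neq0 (@twopi_gt0 R); move: (2 * pi) => q q0; field.
by rewrite /e1 mulrC -mulrA ler_piMr ?(ltW e0) // ler_pdivrMl //; lra.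
Qed.

Lemma inv_pow_cdiff_at (l w : R[i]) k : w != l ->
  cdiff_at (fun u => (l - u)^-1 ^+ k : R[i]^o) w (k%:R * (l - w)^-1 ^+ k.+1).
Proof.
move=> wl e e0; pose D := cabs (l - w) / 2.
have lw0 : l - w != 0 by rewrite subr_eq0 eq_sym.
have D0 : 0 < D by rewrite half_gt0 // cabs_gt0.
have M0 : 0 < D^-1 by rewrite invr_gt0.
pose C := k%:R ^+ 2 * D^-1 ^+ k.+2 + 1.
have C0 : 0 < C by rewrite ltr_pwDr // mulr_ge0 ?exprn_ge0 // ltW.
exists (Num.min D (e / C)); first by rewrite lt_min D0 divr_gt0.
move=> u; rewrite lt_min (ltr_pdivlMr _ _ C0) => /andP[u1 u2].
have Du : D <= cabs (l - u).
  have := cdistD u l w; rewrite /D in u1 *; lra.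
have lu0 : l - u != 0 by rewrite -cabs_eq0 lt0r_neq0 // (lt_le_trans D0).
have bD (z : R[i]) : D <= cabs z -> cabs z^-1 <= D^-1.
  by move=> hz; rewrite cabsV lef_pV2 ?posrE // (lt_le_trans D0).
have Dw : D <= cabs (l - w) by rewrite /D; have := cabs_gt0 lw0; lra.
have := @pow_first_order _ (l - w)^-1 (l - u)^-1 (u - w) D^-1 k _ (bD _ Dw) (bD _ Du).
case; first by field; rewrite lu0 lw0.
move=> _; rewrite mulrAC [k%:R * _ * _]mulrC => h; apply: le_trans h _.
have h0 := rnorm_ge0 (u - w : R[i]^o).
have -> : k%:R ^+ 2 * (cabs (u - w) ^+ 2 * D^-1 ^+ k.+2) =
  cabs (u - w) * (C - 1) * cabs (u - w) by rewrite /C; ring.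
rewrite ler_wpM2r //; apply: le_trans (ltW u2); rewrite ler_wpM2l //; lra.
Qed.

Lemma cdiff_at_sum (n : nat) (f : 'I_n -> R[i] -> R[i]^o) (w : R[i]) (B : 'I_n -> R[i]^o) :
  (forall j, cdiff_at (f j) w (B j)) ->
  cdiff_at (fun z => \sum_j f j z) w (\sum_j B j).
Proof.
move=> hf e e0.
have n1 : 0 < n%:R + 1 :> R by rewrite ltr_pwDr.
have /choice[d hd] : forall j, exists dj : R, 0 < dj /\ forall u, cabs (u - w) < dj ->
   cabs (f j u - f j w - (u - w) * B j) <= e / (n%:R + 1) * cabs (u - w).
  by move=> j; have [dl dl0 h] := hf j _ (divr_gt0 e0 n1); exists dl.
exists (\big[Num.min/1]_j d j); first by apply: lt_bigmin => // j _; exact: (hd j).1.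
move=> u hu.
have -> : \sum_j f j u - \sum_j f j w - (u - w) *: (\sum_j B j : R[i]^o) =
   \sum_j (f j u - f j w - (u - w) * B j).
  by rewrite !sumrB -mulr_sumr.
apply: le_trans (@rnorm_sum _ R[i]^o _ _ _ _) _.
apply: (@le_trans _ _ (\sum_(j < n) e / (n%:R + 1) * cabs (u - w))).
  apply: ler_sum => j _; apply: (hd j).2; apply: lt_le_trans hu _.
  exact: bigmin_le_cond.
rewrite sumr_const card_ord -[leLHS]mulr_natr.
have -> : e / (n%:R + 1) * cabs (u - w) * n%:R = e * cabs (u - w) * (n%:R / (n%:R + 1)).
  by ring.
rewrite ler_piMr ?mulr_ge0 ?rnorm_ge0 ?(ltW e0) // ler_pdivrMr // mul1r; lra.
Qed.

Lemma derive1n_rational (n : nat) (c l : 'I_n -> R[i]) (s : R) (phi : R[i]^o -> R[i]^o) m w :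
  (forall j, s <= cabs (l j)) ->
  (forall z, cabs z < s -> phi z = \sum_j c j * (l j - z)^-1 ^+ 2) ->
  cabs w < s -> derive1n m phi w = m.+1`!%:R * \sum_j c j * (l j - w)^-1 ^+ m.+2.
Proof.
move=> sl hphi ws; rewrite mulr_sumr.
have ne u j : cabs u < s -> u != l j.
  by apply: contraTneq => ->; rewrite -leNgt.
apply: (@derive1n_local _ s phi
  (fun m w => \sum_j m.+1`!%:R * (c j * (l j - w)^-1 ^+ m.+2))) ws => [u us|k u us].
  by rewrite hphi //; apply: eq_bigr => j _; rewrite factS fact0 mul1r.
apply: cdiff_at_sum => j.
have -> : k.+2`!%:R * (c j * (l j - u)^-1 ^+ k.+3) =
   k.+1`!%:R * (c j * (k.+2%:R * (l j - u)^-1 ^+ k.+3)) :> R[i].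
  rewrite (factS k.+1) natrM.
  by move: (k.+1`!%:R) (k.+2%:R) (_ ^+ k.+3) => a1 a2 a3; ring.
by do 2 apply: cdiff_atZ; exact: inv_pow_cdiff_at (ne u j us).
Qed.

End KernelSums.

Section Calculus.
Context {R : realType} {X : completeNormedModType R[i]}.
Variable T : X -> X.
Hypotheses (hT : bounded_linear T) (hsigma : spectrum T `<=` closed_unit_disc).

Local Notation Rs lambda := (resolvent lambda T).

(** Passes from the operator-norm integral to circle integrals of vectors. On the circle the
    resolvent is bounded and Lipschitz, so the integrand has a modulus of continuity in operator
    norm. *)
Lemma op_circ (psi : R[i] -> R[i]^o) (rho : R) : 1 < rho ->
  (forall t, ccont psi (pol rho t)) ->
  op_integral (fun t y => (pol rho t * psi (pol rho t)) *: Rs (pol rho t) y) 0 (2 * pi) =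
  (fun x => circ (fun z => psi z *: Rs z x) rho).
Proof.
move=> rho1 hpsi; have r0 : 0 <= rho by lra.
have pol1 t : 1 < cabs (pol rho t) by rewrite cabs_pol.
pose q t : R[i]^o := pol rho t * psi (pol rho t).
have uq : ucont q 0 (2 * pi).
  have rK : 2 * rho <= 2 * rho by [].
  have h := @curve_ucont _ _ psi _ _ _ 0 (2 * pi) twopi_ge0 (arc_curve 0 (2 * pi) r0 rK)
    (fun t _ => hpsi t).
  move=> e e0; have [dl dl0 {}h] := h e e0; exists dl => // u w uab wab uw.
  have := h u w uab wab uw; congr (_ <= _).
  by rewrite /q /GRing.scale /= -!mulrA -mulrBr cabsM cabs_i mul1r.
have [Mq Mq0 hMq] := ucont_bounded twopi_ge0 uq.
have [M M0 hM] := resolvent_annulus_bound hsigma rho1 (lexx rho).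
have {}hM t : 0 <= t <= 2 * pi -> forall x, rnorm (Rs (pol rho t) x) <= M * rnorm x.
  by move=> ht x; apply: hM => //; rewrite lexx.
rewrite op_integral_eq.
- by apply/funext => x; apply: eq_integ => [|t _]; rewrite ?twopi_ge0 // scalerA.
- exact: complete_seq_complete.
- exact: twopi_ge0.
- move=> t k x y; have lR := resolvent_linear hsigma (pol1 t).
  by rewrite lR scalerDr !scalerA; congr (_ *: _ + _); rewrite mulrC.
- exists (Mq * M) => t tpi x; rewrite rnormZ -mulrA.
  by apply: ler_pM; rewrite ?rnorm_ge0 ?hM //; exact: hMq.
move=> e e0.
pose L := Mq * (rho * M ^+ 2) + 1; have L0 : 0 < L.
  by rewrite ltr_pwDr // mulr_ge0 // mulr_ge0 // exprn_ge0.
have M1 : 0 < M + 1 by lra.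
have [d1 d10 h1] := uq _ (divr_gt0 (half_gt0 e0) M1).
exists (Num.min d1 (e / 2 / L)); first by rewrite lt_min d10 divr_gt0 // half_gt0.
move=> u w upi wpi; rewrite lt_min (ltr_pdivlMr _ _ L0) => /andP[uw1 uw2] x.
have -> : (pol rho u * psi (pol rho u)) *: Rs (pol rho u) x -
   (pol rho w * psi (pol rho w)) *: Rs (pol rho w) x =
   (q u - q w) *: Rs (pol rho u) x + q w *: (Rs (pol rho u) x - Rs (pol rho w) x).
  by rewrite scalerBl scalerBr addrA subrK.
apply: le_trans (rnormD _ _) _; rewrite (rnormZ (q u - q w)) (rnormZ (q w)).
have x0 : 0 <= rnorm x := rnorm_ge0 x.
have t1 : rnorm (q u - q w) * rnorm (Rs (pol rho u) x) <= e / 2 * rnorm x.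
  apply: (@le_trans _ _ (e / 2 / (M + 1) * ((M + 1) * rnorm x))).
    apply: ler_pM; rewrite ?rnorm_ge0 //; first exact: h1.
    by apply: le_trans (hM u upi x) _; rewrite ler_wpM2r //; lra.
  by rewrite mulrA divfK // lt0r_neq0.
have t2 : rnorm (q w) * rnorm (Rs (pol rho u) x - Rs (pol rho w) x) <= e / 2 * rnorm x.
  apply: (@le_trans _ _ (Mq * (rho * `|u - w| * M ^+ 2 * rnorm x))).
    apply: ler_pM; rewrite ?rnorm_ge0 //; first exact: hMq.
    apply: le_trans (resolvent_lip hsigma x (pol1 u) (pol1 w) M0 (hM u upi) (hM w wpi)) _.
    rewrite ler_wpM2r // ler_wpM2r ?exprn_ge0 //; exact: pol_lip.
  have -> : Mq * (rho * `|u - w| * M ^+ 2 * rnorm x) = `|u - w| * (L - 1) * rnorm x.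
    by rewrite /L; ring.
  rewrite ler_wpM2r // (le_trans _ (ltW uw2)) // ler_wpM2l //; lra.
lra.
Qed.

Lemma kernel_sum_integral (n k : nat) (c l : nat -> R[i]) (rho : R) x : 1 < rho ->
  (forall j, (j < n)%N -> rho < cabs (l j)) ->
  circ (fun z => (\sum_(j < n) c j * (l j - z)^-1 ^+ k) *: Rs z x) rho =
  (2 * pi)%:C *: \sum_(j < n) c j *: iter k (Rs (l j)) x.
Proof.
move=> rho1 hl; have r0 : 0 <= rho by lra.
have cX := @complete_seq_complete R X.
have kc j t : (j < n)%N -> ccont (fun z => (l j - z)^-1 ^+ k *: Rs z x) (pol rho t).
  move=> jn; apply: cdiff_ccont; apply: cdiff_scale.
    have pl : pol rho t != l j.
      by have := hl j jn; apply: contraTneq => <-; rewrite cabs_pol // ltxx.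
    by exists (k%:R * (l j - pol rho t)^-1 ^+ k.+1); exact: inv_pow_cdiff_at.
  by apply: resolvent_cdiff => //; rewrite cabs_pol.
have kc' j t : (j < n)%N ->
    ccont (fun z => c j *: ((l j - z)^-1 ^+ k *: Rs z x)) (pol rho t).
  move=> jn e e0; have c0 : 0 < cabs (c j) + 1 by have := rnorm_ge0 (c j : R[i]^o); lra.
  have [dl dl0 h] := kc j t jn _ (divr_gt0 e0 c0); exists dl => // w /h hw.
  rewrite -scalerBr rnormZ; apply: le_trans (ler_wpM2l (rnorm_ge0 _) hw) _.
  by rewrite mulrCA ler_piMr ?(ltW e0) // ler_pdivrMr // mul1r; lra.
have [_ h] := circ_sum cX r0 kc'.
transitivity (circ (fun z => \sum_(j < n) c j *: ((l j - z)^-1 ^+ k *: Rs z x)) rho).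
  congr circ; apply/funext => z; rewrite scaler_suml; apply: eq_bigr => j _.
  exact: (esym (scalerA (c j) _ _)).
rewrite h scaler_sumr; apply: eq_bigr => j _.
rewrite scalerA mulrC -scalerA -(kernel_integral hT hsigma k x rho1 (hl j (ltn_ord j))).
rewrite /circ -integZ ?twopi_ge0 //; last first.
  by apply: (circ_has_integ cX (f := fun z => (l j - z)^-1 ^+ k *: Rs z x)) => // t; exact: kc.
by apply: eq_integ => [|t _]; rewrite ?twopi_ge0 // !scalerA [_ * c j]mulrC !mulrA.
Qed.

Lemma derivative_calculusE (phi : R[i]^o -> R[i]^o) m (rho r : R) x : 1 < rho -> rho < r ->
  (forall z, cabs z <= r -> cdiff phi z) ->
  derivative_calculus T m rho phi x =
  ((2 * pi)^-1)%:C *: circ (fun z => derive1n m phi z *: Rs z x) rho.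
Proof.
move=> rho1 rhor hphi; have r0 : 0 <= rho by lra.
have dc t : ccont (derive1n m phi : R[i] -> R[i]^o) (pol rho t).
  by apply: cdiff_ccont; apply: derive1n_cdiff hphi; rewrite cabs_pol.
by rewrite /derivative_calculus (op_circ rho1 dc).
Qed.

Lemma two_pi_cancel (y : X) : ((2 * pi)^-1)%:C *: ((2 * pi)%:C *: y) = y.
Proof.
by rewrite scalerA fmorphV /= mulVf ?scale1r // twopiC_neq0.
Qed.

(** The uniform sums of [kernel_rsum] replace the derivative of phi on the circle rho, and each
    kernel with node on the larger circle r integrates to a power of the resolvent. This is the
    operator Cauchy formula in discrete form, with an error relative to |x|. *)
Lemma derivative_calculus_approx (phi : R[i] -> R[i]^o) m (rho r : R) : 1 < rho -> rho < r ->
  (forall z, cabs z <= r -> cdiff phi z) ->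
  forall e : R, 0 < e -> exists N, forall n, (N <= n)%N -> (0 < n)%N /\ forall x,
    rnorm (derivative_calculus T m rho phi x - (m`!%:R / n%:R) *:
      \sum_(j < n) (node r n j * phi (node r n j)) *: iter m.+1 (Rs (node r n j)) x)
    <= e * rnorm x.
Proof.
move=> rho1 rhor hphi e e0; have r0 : 0 <= rho by lra.
have [M M0 hM] := resolvent_annulus_bound hsigma rho1 (lexx rho).
have L0 : 0 < rho * M + 1 by rewrite ltr_pwDr // mulr_ge0.
have [N hN] := kernel_rsum m r0 rhor hphi (divr_gt0 e0 L0).
exists N => n /hN[n0 {}hN]; split=> // x.
have cn j : rho < cabs (node r n j) by rewrite /node cabs_pol //; lra.
have cX := @complete_seq_complete R X.
pose a j := (m`!%:R / n%:R) * (node r n j * phi (node r n j)).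
pose psi z : R[i]^o := \sum_(j < n) a j * (node r n j - z)^-1 ^+ m.+1.
have hpsi : circ (fun z => psi z *: Rs z x) rho =
    (2 * pi)%:C *: \sum_(j < n) a j *: iter m.+1 (Rs (node r n j)) x.
  by rewrite -(@kernel_sum_integral n m.+1 a (node r n) rho x rho1 (fun j _ => cn j)).
rewrite (derivative_calculusE _ _ rho1 rhor hphi).
have -> : (m`!%:R / n%:R) *: \sum_(j < n) (node r n j * phi (node r n j)) *:
    iter m.+1 (Rs (node r n j)) x = ((2 * pi)^-1)%:C *: circ (fun z => psi z *: Rs z x) rho.
  rewrite hpsi two_pi_cancel scaler_sumr; apply: eq_bigr => j _.
  by rewrite scalerA.
rewrite -scalerBr rnormZr ?invr_ge0 ?twopi_ge0 //.
have c1 t : ccont (fun z => derive1n m phi z *: Rs z x) (pol rho t).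
  apply/cdiff_ccont/cdiff_scale; last by apply: resolvent_cdiff => //; rewrite cabs_pol.
  by apply: derive1n_cdiff hphi; rewrite cabs_pol.
have c2 t : ccont (fun z => psi z *: Rs z x) (pol rho t).
  apply/cdiff_ccont/cdiff_scale; last by apply: resolvent_cdiff => //; rewrite cabs_pol.
  exists (\sum_(j < n) a j * (m.+1%:R * (node r n j - pol rho t)^-1 ^+ m.+2)).
  apply: (@cdiff_at_sum _ n (fun j z => a j * (node r n j - z)^-1 ^+ m.+1)) => j.
  apply: cdiff_atZ; apply: inv_pow_cdiff_at.
  by have := cn j; apply: contraTneq => <-; rewrite cabs_pol // ltxx.
have i1 := circ_has_integ cX r0 c1; have i2 := circ_has_integ cX r0 c2.
rewrite /circ -(integB twopi_ge0 i1 i2).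
rewrite mulrC ler_pdivrMr ?twopi_gt0 //.
apply: (@le_trans _ _ (e * rnorm x * (2 * pi - 0))); last by rewrite subr0.
apply: integ_norm_le; first exact: twopi_ge0.
  exact: has_integB i1 i2.
move=> t tpi; rewrite -scalerBr -scalerBl !rnormZ cabs_pol //.
have -> : psi (pol rho t) = m`!%:R / n%:R *
     \sum_(j < n) (node r n j * phi (node r n j)) * (node r n j - pol rho t)^-1 ^+ m.+1.
  by rewrite mulr_sumr; apply: eq_bigr => j _; rewrite /a !mulrA.
have := hN (pol rho t); rewrite cabs_pol // => /(_ erefl) h.
have rr : rho <= rho <= rho by rewrite lexx.
have hR := hM rho t rr tpi x.
apply: (@le_trans _ _ (rho * (e / (rho * M + 1) * (M * rnorm x)))).
  by rewrite ler_wpM2l // ler_pM ?rnorm_ge0.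
have -> : rho * (e / (rho * M + 1) * (M * rnorm x)) =
   e * rnorm x * ((rho * M) / (rho * M + 1)) by ring.
rewrite ler_piMr ?mulr_ge0 ?rnorm_ge0 ?(ltW e0) //.
by rewrite ler_pdivrMr // mul1r; lra.
Qed.

Lemma derivative_calculus_rational (n : nat) (c l : nat -> R[i]) (rho s : R)
    (phi : R[i]^o -> R[i]^o) m x : 1 < rho -> rho < s ->
  (forall j, s <= cabs (l j)) ->
  (forall z, cabs z < s -> phi z = \sum_(j < n) c j * (l j - z)^-1 ^+ 2) ->
  derivative_calculus T m rho phi x =
  m.+1`!%:R *: \sum_(j < n) c j *: iter m.+2 (Rs (l j)) x.
Proof.
move=> rho1 rhos sl hphi; have r0 : 0 <= rho by lra.
pose psi z : R[i]^o := \sum_(j < n) (m.+1`!%:R * c j) * (l j - z)^-1 ^+ m.+2.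
have dE w : cabs w < s -> derive1n m phi w = psi w.
  move=> ws; rewrite (derive1n_rational m (fun j : 'I_n => sl j) hphi ws) mulr_sumr.
  by apply: eq_bigr => j _; rewrite mulrA.
have pE t : derive1n m phi (pol rho t) = psi (pol rho t) by rewrite dE // cabs_pol.
have pc t : ccont psi (pol rho t).
  apply: cdiff_ccont.
  exists (\sum_(j < n) m.+1`!%:R * c j * (m.+2%:R * (l j - pol rho t)^-1 ^+ m.+3)).
  apply: (@cdiff_at_sum _ n (fun j z => m.+1`!%:R * c j * (l j - z)^-1 ^+ m.+2)) => j.
  apply: cdiff_atZ; apply: inv_pow_cdiff_at.
  by have := sl j; apply: contraTneq => <-; rewrite cabs_pol // -ltNge.
have dc t : ccont (derive1n m phi : R[i] -> R[i]^o) (pol rho t).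
  apply: (@ccont_local _ _ psi _ _ (s - rho)) (pc t); first lra.
  move=> w hw; rewrite dE //; have := cabs_sub w (pol rho t); rewrite cabs_pol //; lra.
rewrite /derivative_calculus (op_circ rho1 dc).
rewrite (@eq_circ _ _ _ (fun z => psi z *: Rs z x)); last by move=> t; rewrite pE.
rewrite (@kernel_sum_integral n m.+2 (fun j => m.+1`!%:R * c j) l rho x rho1); last first.
  by move=> j _; apply: lt_le_trans (sl j).
rewrite two_pi_cancel scaler_sumr; apply: eq_bigr => j _; by rewrite scalerA.
Qed.

End Calculus.

(** * Equally spaced points on a circle and Riemann sums *)

Section RootsOfUnity.
Context {R : realType}.
Implicit Types (x z : R[i]).

Lemma expiX (t : R) n : expi t ^+ n = expi (n%:R * t).
Proof.
elim: n => [|n IH]; first by rewrite expr0 mul0r expi0.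
by rewrite exprS IH -expiD -natr1 mulrDl mul1r addrC.
Qed.

Lemma expi_neq1 (t : R) : 0 < t < 2 * pi -> expi t != 1.
Proof.
move=> /andP[t0 t2]; apply/eqP => /(congr1 (@complex.Re R)) /= ct.
have st : 0 < sin (t / 2) by apply: sin_gt0_pi; apply/andP; split; lra.
have : cos t = 1 - 2 * sin (t / 2) ^+ 2.
  by rewrite {1}(splitr t) cosD -!expr2; have := cos2Dsin2 (t / 2); lra.
have := exprn_gt0 2 st; rewrite ct; lra.
Qed.

Lemma sum_root_of_unity (v : R[i]) n : v ^+ n = 1 -> v != 1 ->
  \sum_(j < n) v ^+ j = 0.
Proof.
move=> vn v1; apply: (mulfI (x := v - 1)); first by rewrite subr_eq0.
by rewrite -subrX1 vn subrr mulr0.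
Qed.

Lemma nodeE (r : R) n j : node r n j = r%:C * expi (2 * pi / n%:R) ^+ j.
Proof. by rewrite /node /pol /upt add0r subr0 expiX. Qed.

(** With y = x v^j one has 1 / (1 - y) = (1 + y + ... + y^(n-1)) / (1 - x^n), as y^n = x^n for every
    j. Summed over j, all powers but the zeroth cancel. *)
Lemma sum_inv_root (v x : R[i]) n : (0 < n)%N -> v ^+ n = 1 ->
  (forall l, (0 < l < n)%N -> v ^+ l != 1) -> cabs x < 1 -> cabs v = 1 ->
  \sum_(j < n) (1 - x * v ^+ j)^-1 = n%:R / (1 - x ^+ n).
Proof.
move=> n0 vn vl x1 v1.
have lt1 (y : R[i]) : cabs y < 1 -> 1 - y != 0.
  by move=> y1; rewrite subr_eq0 eq_sym; apply: contraTneq y1 => ->; rewrite cabs1 ltxx.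
have xn : 1 - x ^+ n != 0.
  by apply: lt1; rewrite cabsX exprn_ilt1 ?rnorm_ge0 // -lt0n.
have step j : (1 - x * v ^+ j)^-1 = (\sum_(l < n) x ^+ l * (v ^+ l) ^+ j) / (1 - x ^+ n).
  have y0 : 1 - x * v ^+ j != 0 by apply: lt1; rewrite cabsM cabsX v1 expr1n mulr1.
  apply: (mulIf xn); rewrite divfK //; apply: (mulfI y0); rewrite mulrA mulfV // mul1r.
  have -> : 1 - x ^+ n = - ((x * v ^+ j) ^+ n - 1).
    by rewrite exprMn -exprM mulnC exprM vn expr1n mulr1 opprB.
  rewrite subrX1 -mulNr opprB; congr (_ * _); apply: eq_bigr => l _.
  by rewrite exprMn -!exprM mulnC.
under eq_bigr do rewrite step.
rewrite -mulr_suml; congr (_ / _).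
rewrite exchange_big /= (bigD1 (Ordinal n0)) //= [X in _ + X]big1 ?addr0.
  rewrite (eq_bigr (fun=> 1)); last by move=> j _; rewrite !expr0 expr1n mulr1.
  by rewrite sumr_const card_ord.
move=> l l0; rewrite -mulr_sumr sum_root_of_unity ?mulr0 //.
  by rewrite -exprM mulnC exprM vn expr1n.
by apply: vl; rewrite ltn_ord lt0n andbT; apply: contraNneq l0 => l0; apply/eqP/val_inj.
Qed.

(** The Poisson kernel as the real part of (1 + y) / (1 - y); being affine in 1 / (1 - y), it can be
    summed over the nodes by [sum_inv_root]. *)
Lemma Re_inv_sub1 (y : R[i]) : 1 - y != 0 ->
  2 * complex.Re (1 - y)^-1 - 1 = (1 - cabs y ^+ 2) * (cabs (1 - y))^-1 ^+ 2.
Proof.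
move=> y0; have := cabs_gt0 y0; rewrite exprVn !cabs_sqr => c0.
have : 0 < cabs (1 - y) ^+ 2 by rewrite exprn_gt0.
rewrite cabs_sqr; move: y {y0 c0} => [a b] /= d0.
by have := lt0r_neq0 d0; rewrite sub0r => d1; field.
Qed.

Lemma Re_sum n (F : 'I_n -> R[i]) :
  complex.Re (\sum_j F j) = \sum_j complex.Re (F j).
Proof. by apply: (big_morph (@complex.Re R)) => // -[a b] [c d]. Qed.

Lemma node_inv_sqr_sum (s r : R) : 0 < s -> s < r -> exists N, forall n, (N <= n)%N ->
  (0 < n)%N /\ forall z, cabs z < s ->
    \sum_(j < n) (cabs (node r n j - z))^-1 ^+ 2 <= 2 * n%:R / (r ^+ 2 - s ^+ 2).
Proof.
move=> s0 sr; have r0 : 0 < r by lra.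
pose q := s / r; have q0 : 0 <= q by rewrite divr_ge0 // ltW.
have q1 : q < 1 by rewrite /q ltr_pdivrMr // mul1r.
(* Then |n / (1 - x^n)| <= 3 n / 2, and the sum of the Poisson kernels is at most 2 (3 n / 2) - n =
   2 n. *)
have [N hN] : exists N, forall n, (N <= n)%N -> q ^+ n <= 1 / 3.
  have := @cvg_expr R q; rewrite ger0_norm // => /(_ q1) /cvgrPdist_le.
  move=> /(_ (1 / 3)); rewrite divr_gt0 // => /(_ isT)[N _ h].
  exists N => n /h /=; rewrite sub0r normrN ger0_norm //; exact: exprn_ge0.
exists (maxn N 1) => n; rewrite geq_max => /andP[Nn n0]; split=> // z zs.
(* The inverse of the root that generates the nodes, so that z_j - z = z_j (1 - x v^j) with x = z /
   r. *)
pose v : R[i] := expi (- (2 * pi / n%:R)).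
have nn0 : n%:R != 0 :> R by rewrite pnatr_eq0 lt0n_neq0.
have vinv : v = (expi (2 * pi / n%:R))^-1.
  apply: (mulIf (expi_neq0 (2 * pi / n%:R))).
  by rewrite mulVf ?expi_neq0 // /v -expiD addNr expi0.
have vn : v ^+ n = 1.
  rewrite vinv exprVn expiX mulrC divfK // expi2pi invr1 //.
have vl l : (0 < l < n)%N -> v ^+ l != 1.
  move=> /andP[l0 ln]; rewrite vinv exprVn expiX invr_eq1.
  apply: expi_neq1; rewrite mulr_gt0 ?ltr0n ?divr_gt0 ?twopi_gt0 ?ltr0n //=.
  rewrite mulrCA gtr_pMr ?twopi_gt0 // ltr_pdivrMr ?ltr0n // mul1r ltr_nat //.
have v1 : cabs v = 1 by exact: cabs_expi.
pose x := z / r%:C.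
have rC0 : r%:C != 0 :> R[i] by rewrite -cabs_eq0 cabsC normr_eq0 lt0r_neq0.
have xq : cabs x <= q.
  by rewrite /x cabsM cabsV cabsC gtr0_norm // ler_pM2r ?invr_gt0 // ltW.
have x1 : cabs x < 1 by apply: le_lt_trans q1.
have hs := sum_inv_root n0 vn vl x1 v1.
have y0 j : 1 - x * v ^+ j != 0.
  rewrite subr_eq0 eq_sym; apply: contraTneq x1 => h.
  by rewrite -leNgt -[leLHS](cabs1 (R:=R)) -h cabsM cabsX v1 expr1n mulr1.
have nodey j : node r n j - z = r%:C * expi (2 * pi / n%:R) ^+ j * (1 - x * v ^+ j).
  rewrite nodeE vinv exprVn /x; field; rewrite rC0 expf_neq0 ?expi_neq0 //.
have cnode j : (cabs (node r n j - z))^-1 ^+ 2 = r^-1 ^+ 2 * (cabs (1 - x * v ^+ j))^-1 ^+ 2.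
  rewrite nodey !cabsM cabsX cabs_expi expr1n mulr1 cabsC gtr0_norm //.
  by rewrite invfM exprMn.
under eq_bigr do rewrite cnode.
rewrite -mulr_sumr.
have xv j : cabs (x * v ^+ j) = cabs x by rewrite cabsM cabsX v1 expr1n mulr1.
have key : (1 - cabs x ^+ 2) * \sum_(j < n) (cabs (1 - x * v ^+ j))^-1 ^+ 2 <= 2 * n%:R.
  rewrite mulr_sumr (eq_bigr (fun j : 'I_n => 2 * complex.Re (1 - x * v ^+ j)^-1 - 1)); last first.
    by move=> j _; rewrite Re_inv_sub1 // xv.
  rewrite sumrB -mulr_sumr -Re_sum hs sumr_const card_ord.
  have := le_trans (ler_norm _) (cabs_Re (n%:R / (1 - x ^+ n))).
  rewrite cabsM cabsV -(rmorph_nat (real_complex R) n) cabsC ger0_norm //.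
  have xn : cabs (x ^+ n) <= 1 / 3.
    by rewrite cabsX (le_trans _ (hN n Nn)) // lerXn2r ?nnegrE ?rnorm_ge0.
  have c1 := cabs_sub 1 (x ^+ n); rewrite cabs1 in c1.
  have c2 : (cabs (1 - x ^+ n))^-1 <= 3 / 2.
    have p : 0 < cabs (1 - x ^+ n) by lra.
    by rewrite -[3 / 2]invrK lef_pV2 ?posrE ?invr_gt0 ?divr_gt0 //; lra.
  have := ler_wpM2l (ler0n R n) c2; lra.
have x2 : cabs x ^+ 2 <= q ^+ 2 by rewrite lerXn2r ?nnegrE ?rnorm_ge0.
have q2 : 0 < 1 - q ^+ 2 by rewrite subr_gt0 exprn_ilt1.
have -> : 2 * n%:R / (r ^+ 2 - s ^+ 2) = r^-1 ^+ 2 * (2 * n%:R / (1 - q ^+ 2)).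
  rewrite /q; field; rewrite lt0r_neq0 //= subr_eq0; apply/eqP; nra.
rewrite ler_wpM2l ?exprn_ge0 ?invr_ge0 ?(ltW r0) //.
rewrite ler_pdivlMr // mulrC; apply: le_trans key.
rewrite ler_wpM2r //; last lra.
by apply: sumr_ge0 => j _; rewrite exprn_ge0 // invr_ge0 rnorm_ge0.
Qed.

End RootsOfUnity.

(** * Lebesgue integrals as limits of Riemann sums *)

Section LebesgueRiemann.
Context {R : realType}.
Local Notation mu := (@lebesgue_measure R).

(** One cell is appended to [a, u]. Both bounds avoid subtraction, since the integrals are extended
    reals not yet known to be finite. *)
Lemma integral_itv_step (h : R -> R) (a u w c e : R) : a <= u -> u <= w ->
  measurable_fun setT h -> (forall t, 0 <= h t) ->
  (forall t, u < t <= w -> c - e <= h t <= c + e) -> 0 <= c -> 0 <= e ->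
  (\int[mu]_(t in `[a, w]) (h t)%:E <=
     \int[mu]_(t in `[a, u]) (h t)%:E + ((w - u) * (c + e))%:E)%E /\
  (\int[mu]_(t in `[a, u]) (h t)%:E + ((w - u) * c)%:E <=
     \int[mu]_(t in `[a, w]) (h t)%:E + ((w - u) * e)%:E)%E.
Proof.
move=> au uw mh h0 hc c0 e0.
have mE D : measurable_fun D (fun t => (h t)%:E) by apply/measurable_EFinP/measurable_funTS.
have -> : `[a, w]%classic = `[a, u] `|` `]u, w] :> set R.
  apply/seteqP; split => t /=; rewrite !in_itv /=.
    by move=> /andP[at_ tw]; have [tu|tu] := leP t u; [left|right]; rewrite ?at_.
  by case=> /andP[h1 h2]; apply/andP; split; lra.
rewrite ge0_integral_setU //=; last 2 first.
- by move=> t _; rewrite lee_fin.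
- apply/disj_setPS => t /=; rewrite !in_itv /= => -[/andP[_ h1] /andP[h2 _]].
  by move: h1; rewrite leNgt h2.
have muc k : (\int[mu]_(t in `]u, w]) k%:E = ((w - u) * k)%:E)%E.
  rewrite integral_cst //= lebesgue_measure_itv /= lte_fin.
  case: ltP => [_|wu]; first by rewrite -EFinB -EFinM mulrC.
  have -> : w = u by apply/eqP; rewrite eq_le uw wu.
  by rewrite mule0 subrr mul0r.
have le1 : (\int[mu]_(t in `]u, w]) (h t)%:E <= ((w - u) * (c + e))%:E)%E.
  rewrite -muc; apply: ge0_le_integral => //=.
  - by move=> t _; rewrite lee_fin.
  - exact: mE.
  - by move=> t; rewrite in_itv /= lee_fin => /hc /andP[].
have le2 : (((w - u) * c)%:E <= \int[mu]_(t in `]u, w]) (h t)%:E + ((w - u) * e)%:E)%E.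
  rewrite -!muc -ge0_integralD //=; last 2 first.
  - by move=> t _; rewrite lee_fin.
  - exact: mE.
  apply: ge0_le_integral => //=.
  - by apply: emeasurable_funD; [exact: mE|exact: measurable_cst].
  - by move=> t; rewrite in_itv /= -EFinD lee_fin => /hc /andP[? _]; lra.
  split; first exact: leeD2l.
  by apply: le_trans (leeD2l _ le2) _; rewrite addeA.
exact: mE.
Qed.

(** Continuity of f on the whole line makes its norm measurable on all of R; the two inequalities
    then accumulate cell by cell an error e' per unit length. *)
Lemma leb_riemann (V : normedModType R[i]) (f : R -> V) (a b : R) : a <= b ->
  (forall x (e : R), 0 < e -> exists2 dl : R, 0 < dl & forall u, `|u - x| < dl ->
     rnorm (f u - f x) <= e) ->
  forall e : R, 0 < e -> exists N, forall n, (N <= n)%N -> (0 < n)%N /\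
    let S := (b - a) / n%:R * \sum_(i < n) rnorm (f (upt a b n i)) in
    (\int[mu]_(t in `[a, b]) (rnorm (f t))%:E <= (S + e)%:E)%E /\
    (S%:E <= \int[mu]_(t in `[a, b]) (rnorm (f t))%:E + e%:E)%E.
Proof.
move=> ab hf e e0; pose h t := rnorm (f t).
have ch : continuous h.
  move=> x; apply/cvgrPdist_le => e1 e10; have [dl dl0 hdl] := hf x e1 e10.
  apply/nbhs_ballP; exists dl => // u; rewrite /ball /= distrC => ux.
  by rewrite distrC; apply: le_trans (rnorm_sub_abs _ _) _; exact: hdl.
have mh := continuous_measurable_fun ch.
have h0 t : 0 <= h t := rnorm_ge0 _.
have uf : ucont f a b.
  apply: cont_ucont => // x _ e1 e10; have [dl dl0 hdl] := hf x e1 e10.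
  by exists dl => // u _; exact: hdl.
pose e' := e / (b - a + 1).
have ba1 : 0 < b - a + 1 by lra.
have e'0 : 0 < e' by rewrite divr_gt0.
have [dl dl0 hdl] := uf e' e'0.
have ba : 0 <= b - a by rewrite subr_ge0.
have [N hN] := ex_fine_mesh ba dl0.
exists N => n /hN[n0 hn]; split=> //.
have [p0 pn pt] := upt_partition ab n0 hn.
have mono k : (k <= n)%N -> a <= upt a b n k <= b := upt_itv ab n0.
pose l := (b - a) / n%:R.
have stepl k : upt a b n k.+1 - upt a b n k = l by rewrite /upt -natr1 /l; ring.
have ind k : (k <= n)%N ->
   (\int[mu]_(t in `[a, upt a b n k]) (h t)%:E <=
     (l * \sum_(i < k) h (upt a b n i) + k%:R * (l * e'))%:E)%E /\
   ((l * \sum_(i < k) h (upt a b n i))%:E <=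
     \int[mu]_(t in `[a, upt a b n k]) (h t)%:E + (k%:R * (l * e'))%:E)%E.
  elim: k => [|k IH] kn.
    by rewrite p0 set_itv1 integral_set1 big_ord0 mulr0 mul0r addr0 adde0.
  have [IH1 IH2] := IH (ltnW kn); have [/andP[_ uw] wu] := pt k kn.
  have /andP[k1 k2] := mono k (ltnW kn); have /andP[k3 k4] := mono k.+1 kn.
  have hc t : upt a b n k < t <= upt a b n k.+1 ->
      h (upt a b n k) - e' <= h t <= h (upt a b n k) + e'.
    move=> /andP[t1 t2]; have := rnorm_sub_abs (f t) (f (upt a b n k)).
    have : rnorm (f t - f (upt a b n k)) <= e'.
      apply: hdl; first by apply/andP; split; lra.
        by apply/andP; split; lra.
      by rewrite ger0_norm; lra.
    rewrite -/(h t) -/(h (upt a b n k)) => q1; rewrite ler_norml => /andP[q2 q3].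
    by apply/andP; split; lra.
  have [s1 s2] := integral_itv_step k1 uw mh h0 hc (h0 _) (ltW e'0).
  rewrite stepl in s1 s2.
  rewrite big_ord_recr /= -natr1 !mulrDl mul1r !mulrDr; split.
    apply: le_trans s1 _; apply: le_trans (leeD2r _ IH1) _.
    by rewrite -EFinD lee_fin; lra.
  have s3 := leeD2r (l * h (upt a b n k))%:E IH2; rewrite -EFinD in s3.
  move: s2 s3; set I1 := integral _ _ _; set I2 := integral _ _ _.
  move: I1 I2 => I1 I2 s2 s3; apply: le_trans s3 _.
  by rewrite addeAC EFinD addeA [leRHS]addeAC; exact: leeD2r.
have [i1 i2] := ind n (leqnn n).
have nl : n%:R * (l * e') <= e.
  have -> : n%:R * (l * e') = (b - a) * e'.
    by rewrite mulrA /l [n%:R * _]mulrC divfK // pnatr_eq0 lt0n_neq0.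
  by rewrite /e' mulrC -mulrA ler_piMr ?(ltW e0) // ler_pdivrMl // mulr1; lra.
rewrite pn in i1 i2; split.
  by apply: le_trans i1 _; rewrite lee_fin lerD2l.
by apply: le_trans i2 _; apply: leeD2l; rewrite lee_fin.
Qed.

End LebesgueRiemann.

(** * The integrand of the GFS condition and its dependence on the radius *)

Section Weights.
Context {R : realType} {X : completeNormedModType R[i]}.
Variable T : X -> X.
Hypotheses (hT : bounded_linear T) (hsigma : spectrum T `<=` closed_unit_disc).
Local Notation Rs lambda := (resolvent lambda T).

Lemma resolvent_pow_cont l n x : 1 < cabs l -> ccont (fun z => iter n (Rs z) x) l.
Proof.
move=> l1 e e0; have [M M0 hM] := resolvent_bounded hsigma l1.
pose M1 := M + 1; have M10 : 0 < M1 by rewrite /M1; lra.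
have hM1 y : rnorm (Rs l y) <= M1 * rnorm y.
  by rewrite (le_trans (hM y)) // ler_wpM2r ?rnorm_ge0 // /M1 lerDl.
have M20 : 0 < 2 * M1 by rewrite mulr_gt0.
pose C := n%:R * (2 * M1) ^+ n.+1 * rnorm x + 1.
have C0 : 0 < C.
  by rewrite ltr_pwDr // mulr_ge0 ?rnorm_ge0 // mulr_ge0 // exprn_ge0 // ltW.
exists (Num.min (cabs l - 1) (Num.min ((2 * M1)^-1) (e / C))).
  by rewrite !lt_min subr_gt0 l1 invr_gt0 M20 divr_gt0.
move=> m; rewrite !lt_min => /andP[m1 /andP[m2 m3]].
have m11 : 1 < cabs m by have := cabs_sub l m; rewrite cdistC; lra.
have hm y : rnorm (Rs m y) <= 2 * M1 * rnorm y.
  apply: (resolvent_near hsigma l1 (ltW M10) hM1 m11).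
  by rewrite -ler_pdivlMr // mul1r ltW.
have hl y : rnorm (Rs l y) <= 2 * M1 * rnorm y.
  by apply: le_trans (hM1 y) _; rewrite ler_wpM2r ?rnorm_ge0 //; lra.
apply: le_trans (resolvent_pow_first_order hsigma n x l1 m11 (ltW M20) hl hm).1 _.
move: m3; rewrite (ltr_pdivlMr _ _ C0) (cdistC m l) => m3.
have -> : n%:R * (cabs (l - m) * (2 * M1) ^+ n.+1) * rnorm x = cabs (l - m) * (C - 1).
  by rewrite /C; ring.
by apply: le_trans (ltW m3); rewrite ler_wpM2l ?rnorm_ge0 //; lra.
Qed.

Definition wgt m (r : R) (xs : X -> R[i]^o) x (t : R) : R[i]^o :=
  xs (((r + 1) * (r - 1) ^+ m)%:C *: iter m.+1 (Rs (pol r t)) x).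

Definition wsum m (r : R) (xs : X -> R[i]^o) x n : R :=
  (2 * pi) / n%:R * \sum_(i < n) cabs (wgt m r xs x (upt 0 (2 * pi) n i)).

Lemma wgtE m r xs x t : 1 < r -> linear xs ->
  cabs (wgt m r xs x t) =
  (r + 1) * (r - 1) ^+ m * cabs (xs (iter m.+1 (Rs (pol r t)) x)).
Proof.
move=> r1 lxs; rewrite /wgt (linear_scale lxs) rnormZr //.
by rewrite mulr_ge0 ?exprn_ge0 //; lra.
Qed.

Lemma wgt_cont m r xs x : 1 < r -> bounded_linear xs -> forall t (e : R), 0 < e ->
  exists2 dl : R, 0 < dl & forall u, `|u - t| < dl ->
    rnorm (wgt m r xs x u - wgt m r xs x t) <= e.
Proof.
move=> r1 [lxs [M hM]] t e e0; have r0 : 0 < r by lra.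
have p1 : 1 < cabs (pol r t) by rewrite cabs_pol // ltW.
pose c : R := (r + 1) * (r - 1) ^+ m.
have c0 : 0 <= c by rewrite /c mulr_ge0 ?exprn_ge0 //; lra.
pose D := `|M| * c + 1; have D0 : 0 < D by rewrite ltr_pwDr // mulr_ge0.
have [dl dl0 h] := resolvent_pow_cont m.+1 x p1 (divr_gt0 e0 D0).
exists (dl / r); first by rewrite divr_gt0.
move=> u; rewrite ltr_pdivlMr // => ut.
have := h (pol r u); have := pol_lip u t (ltW r0) => h1.
move=> /(_ (le_lt_trans h1 _)); rewrite mulrC => /(_ ut) {}h.
rewrite /wgt -(linear_sub lxs) -scalerBr (linear_scale lxs) -/c rnormZr //.
apply: le_trans (ler_wpM2l c0 (hM _)) _.
apply: le_trans (_ : c * (`|M| * (e / D)) <= _).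
  rewrite ler_wpM2l //; apply: le_trans (_ : `|M| * rnorm (iter m.+1 (Rs (pol r u)) x -
    iter m.+1 (Rs (pol r t)) x) <= _); first by rewrite ler_wpM2r ?rnorm_ge0 // ler_norm.
  by rewrite ler_wpM2l.
have -> : c * (`|M| * (e / D)) = e * ((D - 1) / D) by rewrite /D; ring.
by rewrite ler_piMr ?(ltW e0) // ler_pdivrMr // mul1r; lra.
Qed.

(** The integral over s > r as a finite sum: s_j = 1 + (r - 1)(1 + j / K) runs in steps (r - 1) / K
    up to S = 1 + (r - 1)(1 + L). Here e pays for the tail at S and E / K for the second-order
    errors. L and E depend neither on t nor on K, so that K can be chosen last. *)
Lemma wgt_step m (r : R) (xs : X -> R[i]^o) x : 1 < r -> bounded_linear xs ->
  forall e : R, 0 < e -> exists L0 : nat, forall L, (L0 <= L)%N ->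
  exists2 E : R, 0 <= E & forall K t, (0 < K)%N -> 0 <= t <= 2 * pi ->
  cabs (wgt m r xs x t) <= \sum_(j < L * K)
     m.+1%:R / K%:R * (1 + j%:R / K%:R)^-1 ^+ m.+1 *
       cabs (wgt m.+1 (1 + (r - 1) * (1 + j%:R / K%:R)) xs x t) + e + E / K%:R.
Proof.
move=> r1 bxs e e0; have [lxs [M' hM']] := bxs.
pose Mx := `|M'|; have Mx0 : 0 <= Mx := normr_ge0 _.
have hMx y : cabs (xs y) <= Mx * rnorm y.
  by rewrite (le_trans (hM' y)) // ler_wpM2r ?rnorm_ge0 // ler_norm.
pose c : R := (r + 1) * (r - 1) ^+ m.
have rm1 : 0 < r - 1 by lra.
have c0 : 0 <= c by rewrite /c mulr_ge0 ?exprn_ge0 //; lra.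
have [MT MT0 hMT] := resolvent_infty hT hsigma.
have x0 : 0 <= rnorm x := rnorm_ge0 x.
pose A := c * (Mx * rnorm x).
have A0 : 0 <= A by apply: mulr_ge0 c0 (mulr_ge0 Mx0 x0).
(* L > q forces S - MT > 1 + A / e, and the weighted tail is at most A / (S - MT). *)
pose q := (MT + 1 + A / e) / (r - 1).
have Ae0 : 0 <= A / e by rewrite divr_ge0 // ltW.
exists (Num.bound q).+1 => L hL.
have q0 : 0 <= q by rewrite divr_ge0 ?(ltW rm1) //; lra.
have Lq : q < L%:R.
  by rewrite (lt_le_trans (archi_boundP q0)) // ler_nat ltnW.
pose S := 1 + (r - 1) * (1 + L%:R).
have Sbig : MT + 1 + A / e < S.
  by move: Lq; rewrite /q ltr_pdivrMr // /S => Lq; lra.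
have rS : r <= S.
  have : 0 <= (r - 1) * L%:R by rewrite mulr_ge0 // ltW.
  by rewrite /S; lra.
have [M M0 hM] := resolvent_annulus_bound hsigma r1 rS.
(* One step has error at most F / K^2, hence L K steps at most L F / K. *)
pose F := m.+1%:R ^+ 2 * ((r - 1) ^+ 2 * M ^+ m.+3) * (Mx * rnorm x).
have F0 : 0 <= F.
  apply: mulr_ge0 (mulr_ge0 Mx0 x0); apply: mulr_ge0; first exact: exprn_ge0.
  by apply: mulr_ge0; [apply: exprn_ge0; exact: ltW|exact: exprn_ge0].
exists (c * (L%:R * F)) => [|K t K0 tpi]; first exact: mulr_ge0 c0 (mulr_ge0 (ler0n _ _) F0).
have Kr : 0 < K%:R :> R by rewrite ltr0n.
have Kn0 : K%:R != 0 :> R by rewrite lt0r_neq0.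
pose s j := 1 + (r - 1) * (1 + j%:R / K%:R).
pose u j := cabs (xs (iter m.+1 (Rs (pol (s j) t)) x)).
pose v j := cabs (xs (iter m.+2 (Rs (pol (s j) t)) x)).
have s0 : s 0%N = r by rewrite /s mul0r addr0 mulr1; ring.
have sJ : s (L * K)%N = S by rewrite /s /S natrM mulfK.
have sS j : s j.+1 - s j = (r - 1) / K%:R by rewrite /s -natr1; field.
have jK j : 0 <= j%:R / K%:R :> R by rewrite divr_ge0.
have rs j : r <= s j.
  by rewrite /s; have := mulr_ge0 (ltW rm1) (jK j); lra.
have s1 j : 1 < s j := lt_le_trans r1 (rs j).
have sle j : (j <= L * K)%N -> s j <= S.
  move=> jLK; rewrite /s /S lerD2l ler_wpM2l ?(ltW rm1) // lerD2l.
  by rewrite ler_pdivrMr // -natrM ler_nat.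
have stepu j : (j < L * K)%N ->
    u j <= u j.+1 + m.+1%:R * ((r - 1) / K%:R) * v j + F / K%:R ^+ 2.
  move=> jlt.
  have pj k : (k <= L * K)%N -> forall y, rnorm (Rs (pol (s k) t) y) <= M * rnorm y.
    by move=> kL y; apply: hM; rewrite ?rs ?sle.
  have p1 k : 1 < cabs (pol (s k) t) by rewrite cabs_pol //; have := s1 k; lra.
  have [_] := resolvent_pow_first_order hsigma m.+1 x (p1 j) (p1 j.+1) M0
     (pj j (ltnW jlt)) (pj j.+1 jlt).
  have dist : pol (s j) t - pol (s j.+1) t = - ((r - 1) / K%:R)%:C * expi t.
    by rewrite /pol -mulrBl -rmorphB /= -opprB sS rmorphN.
  have cd : cabs (pol (s j) t - pol (s j.+1) t) = (r - 1) / K%:R.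
    rewrite dist cabsM cabs_expi mulr1 cabsN cabsC ger0_norm // divr_ge0 //.
    exact: ltW.
  rewrite cd; set a := iter m.+1 (Rs (pol (s j.+1) t)) x.
  set b := iter m.+1 (Rs (pol (s j) t)) x; set d := iter m.+2 (Rs (pol (s j) t)) x.
  set w := (m.+1%:R * _) => h.
  have cw : cabs w = m.+1%:R * ((r - 1) / K%:R).
    by rewrite /w cabsM cd -(rmorph_nat (real_complex R) m.+1) cabsC ger0_norm.
  have e1 : xs b = xs a - w *: xs d - xs (a - b - w *: d).
    rewrite !(linear_sub lxs) (linear_scale lxs) !opprB.
    by rewrite [RHS](AC (2*(1*2)) ((1*5)*(2*3)*4))/= subrr addNr !add0r.
  have h2 := le_trans (hMx _) (ler_wpM2l Mx0 h).
  have e2 : Mx * (m.+1%:R ^+ 2 * (((r - 1) / K%:R) ^+ 2 * M ^+ m.+3) * rnorm x) = F / K%:R ^+ 2.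
    by rewrite /F; field.
  rewrite e2 in h2.
  rewrite /u -/a -/b e1; apply: le_trans (rnormB _ _) _.
  apply: lerD h2; apply: le_trans (rnormB _ _) _.
  by rewrite (rnormZ w) cw.
have ind j : (j <= L * K)%N -> u 0%N <= u j +
    \sum_(i < j) m.+1%:R * ((r - 1) / K%:R) * v i + j%:R * (F / K%:R ^+ 2).
  elim: j => [|j IH] jlt; first by rewrite big_ord0 mul0r !addr0.
  have := IH (ltnW jlt); have := stepu j jlt.
  by rewrite big_ord_recr /= -natr1 mulrDl mul1r; lra.
have {ind} := ind _ (leqnn _).
have -> : (L * K)%:R * (F / K%:R ^+ 2) = L%:R * F / K%:R by rewrite natrM; field.
have uJ : c * u (L * K)%N <= e.
  rewrite /u sJ; have S1 : 1 < cabs (pol S t) by rewrite cabs_pol; lra.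
  have S2 : MT < cabs (pol S t) by rewrite cabs_pol; lra.
  have Rb y : rnorm (Rs (pol S t) y) <= (S - MT)^-1 * rnorm y.
    by have := (hMT _ S1 S2 y).1; rewrite cabs_pol ?[_^-1 * _]mulrC //; lra.
  have SM : 1 + A / e < S - MT by lra.
  have SM0 : 0 < S - MT by lra.
  have i0 : 0 <= (S - MT)^-1 by rewrite invr_ge0 ltW.
  have h1 : rnorm (iter m.+1 (Rs (pol S t)) x) <= (S - MT)^-1 * rnorm x.
    apply: le_trans (iter_bound m.+1 x i0 Rb) _; rewrite ler_wpM2r // exprS.
    by rewrite ler_piMr // exprn_ile1 // invf_le1 //; lra.
  apply: le_trans (ler_wpM2l c0 (le_trans (hMx _) (ler_wpM2l Mx0 h1))) _.
  have -> : c * (Mx * ((S - MT)^-1 * rnorm x)) = A / (S - MT) by rewrite /A; ring.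
  rewrite ler_pdivrMr //; apply: le_trans (_ : e * (A / e) <= _).
    by rewrite [leRHS]mulrC divfK // lt0r_neq0.
  by rewrite ler_wpM2l ?(ltW e0) //; lra.
rewrite (wgtE _ _ _ r1 lxs) -/c => hu.
have -> : cabs (xs (iter m.+1 (Rs (pol r t)) x)) = u 0%N by rewrite /u s0.
apply: le_trans (ler_wpM2l c0 hu) _; rewrite !mulrDr.
have -> : c * (L%:R * F / K%:R) = c * (L%:R * F) / K%:R by ring.
rewrite lerD2r addrC lerD //.
rewrite mulr_sumr; apply: ler_sum => j _.
rewrite (wgtE _ _ _ (s1 j) lxs) -/(s j) -/(v j).
have a0 : 0 < 1 + j%:R / K%:R :> R by have := jK j; lra.
have -> : m.+1%:R / K%:R * (1 + j%:R / K%:R)^-1 ^+ m.+1 *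
    ((s j + 1) * (s j - 1) ^+ m.+1 * v j) =
    (s j + 1) * (m.+1%:R / K%:R * ((r - 1) ^+ m.+1 * v j)).
  have -> : s j - 1 = (r - 1) * (1 + j%:R / K%:R) by rewrite /s; ring.
  rewrite [X in (s j + 1) * X]exprMn.
  have : (1 + j%:R / K%:R)^-1 ^+ m.+1 * (1 + j%:R / K%:R) ^+ m.+1 = 1 :> R.
    by rewrite -exprMn mulVf ?expr1n // lt0r_neq0.
  move: ((1 + j%:R / K%:R)^-1 ^+ m.+1) ((1 + j%:R / K%:R) ^+ m.+1) ((r - 1) ^+ m.+1) => a b d ab.
  by rewrite -[RHS]mul1r -ab; ring.
have -> : c * (m.+1%:R * ((r - 1) / K%:R) * v j) =
    (r + 1) * (m.+1%:R / K%:R * ((r - 1) ^+ m.+1 * v j)).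
  by rewrite /c exprSr; ring.
(* The powers of r - 1 match exactly; only r + 1 <= s_j + 1 is given away. *)
apply: ler_wpM2r; last by have := rs j; lra.
apply: mulr_ge0; first exact: divr_ge0.
by rewrite mulr_ge0 ?exprn_ge0 ?rnorm_ge0 // ltW.
Qed.

End Weights.

(** * The GFS condition with Riemann sums, and the descent from m + 1 to m *)

Section DiscreteGFS.
Context {R : realType} {d : measure_display} {Sigma : measurableType d}.
Variables (P : probability Sigma R) (g : nat -> Sigma -> R[i]).
Context {X : completeNormedModType R[i]}.
Variable T : X -> X.
Hypotheses (hT : bounded_linear T) (hsigma : spectrum T `<=` closed_unit_disc).

Lemma gamma_norm_ge0 N (x : 'I_N -> X) : (0 <= gamma_norm P g x)%E.
Proof. exact: sqrte_ge0. Qed.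

Lemma gamma_norm0 N : gamma_norm P g (fun _ : 'I_N => 0 : X) = 0%E.
Proof.
rewrite /gamma_norm (eq_integral (cst 0%E)) ?integral0 ?sqrte0 //.
by move=> w _; rewrite big1 ?rnorm0 ?expr0n // => k _; rewrite scaler0.
Qed.

Lemma gamma'_norm_ge0 N (xs : 'I_N -> X -> R[i]^o) : (forall k, linear (xs k)) ->
  (0 <= gamma'_norm P g xs)%E.
Proof.
move=> lxs; apply: ereal_sup_ubound; exists (fun=> 0); first by rewrite /= gamma_norm0.
by rewrite big1 ?rnorm0 // => k _; rewrite bounded_linear0.
Qed.

(* [gamma_GFS] with uniform Riemann sums in place of the integrals. *)
Definition disc_GFS m := exists2 C : R, 0 < C &
  forall (N : nat) (r : 'I_N -> R) (x : 'I_N -> X) (xs : 'I_N -> X -> R[i]^o),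
    (1 <= N)%N -> (forall k, 1 < r k) -> (forall k, bounded_linear (xs k)) ->
    forall e : R, 0 < e -> exists n0 : nat, forall n, (n0 <= n)%N -> (0 < n)%N /\
      ((\sum_(k < N) wsum T m (r k) (xs k) (x k) n)%:E <=
        C%:E * gamma_norm P g x * gamma'_norm P g xs + e%:E)%E.

Lemma ex_common_rank N (Q : 'I_N -> nat -> Prop) :
  (forall k, exists n0 : nat, forall n, (n0 <= n)%N -> Q k n) ->
  exists n0 : nat, forall n, (n0 <= n)%N -> forall k, Q k n.
Proof.
move=> /choice[f hf]; exists (\max_k f k) => n hn k; apply: hf.
by apply: leq_trans hn; exact: leq_bigmax.
Qed.

Lemma GFS_sum_close m N (r : 'I_N -> R) (x : 'I_N -> X) (xs : 'I_N -> X -> R[i]^o) :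
  (1 <= N)%N -> (forall k, 1 < r k) -> (forall k, bounded_linear (xs k)) ->
  forall e : R, 0 < e -> exists n0 : nat, forall n, (n0 <= n)%N -> (0 < n)%N /\
    let S := (\sum_(k < N) wsum T m (r k) (xs k) (x k) n)%R in
    let I := (\sum_(k < N) \int[lebesgue_measure]_(t in `[0%R, (2 * pi)%R])
          (rnorm (xs k (((r k + 1) * (r k - 1) ^+ m)%:C *:
             iter m.+1 (resolvent ((r k)%:C * expi t) T) (x k))))%R%:E)%E in
    (S%:E <= I + e%:E)%E /\ (I <= S%:E + e%:E)%E.
Proof.
move=> N1 r1 bxs e e0; have N0 : 0 < N%:R :> R by rewrite ltr0n.
have [n0 hn0] := @ex_common_rank N (fun k n => (0 < n)%N /\
   let S := wsum T m (r k) (xs k) (x k) n in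
   let I := (\int[lebesgue_measure]_(t in `[0%R, (2 * pi)%R])
       (rnorm (wgt T m (r k) (xs k) (x k) t))%:E)%E in
   (I <= (S + e / N%:R)%:E)%E /\ (S%:E <= I + (e / N%:R)%:E)%E)
   (fun k => ltac:(have := leb_riemann twopi_ge0 (wgt_cont hsigma m (x k) (r1 k) (bxs k))
      (divr_gt0 e0 N0); rewrite subr0; exact)).
exists n0 => n nn.
have n_gt0 : (0 < n)%N by have [] := hn0 n nn (Ordinal N1).
split=> //.
have sume : (\sum_(k < N) (e / N%:R)%:E)%E = e%:E.
  by rewrite sumEFin sumr_const card_ord -(mulr_natr (e / N%:R)) divfK // lt0r_neq0.
split.
  rewrite -sumEFin -sume -big_split /=; apply: lee_sum => k _.
  by have [_ []] := hn0 n nn k.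
rewrite -sumEFin -sume -big_split /=; apply: lee_sum => k _.
by have [_ []] := hn0 n nn k.
Qed.

(** For fixed data the sums converge to the integrals, and the error e is arbitrary; the constant C
    is the same on both sides. *)
Lemma GFS_disc m : gamma_GFS P g m T <-> disc_GFS m.
Proof.
split=> [[_ [C C0 hC]]|[C C0 hC]].
  exists C => // N r x xs N1 r1 bxs e e0.
  have [n0 h] := GFS_sum_close m x N1 r1 bxs e0; exists n0 => n /h[n_gt0 [h1 _]].
  by split=> //; apply: le_trans h1 _; apply: leeD2r; exact: hC.
split=> //; exists C => // N r x xs N1 r1 bxs; apply/lee_addgt0Pr => e e0.
have [n0 h] := GFS_sum_close m x N1 r1 bxs (half_gt0 e0).
have [n1 h'] := hC N r x xs N1 r1 bxs (e / 2) (half_gt0 e0).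
have [n_gt0 [_ h2]] := h _ (leq_maxl n0 n1).
have [_ h3] := h' _ (leq_maxr n0 n1).
apply: le_trans h2 _; apply: le_trans (leeD2r _ h3) _.
by rewrite -addeA -EFinD -splitr.
Qed.

(** With a_j = 1 + j / K, a_(j+1) <= 2 a_j gives K^-1 a_j^-2 <= 2 (1 / a_j - 1 / a_(j+1)), and the
    right side telescopes. *)
Lemma sum_inv_sqr_le (K J : nat) : (0 < K)%N ->
  \sum_(j < J) K%:R^-1 * (1 + j%:R / K%:R)^-1 ^+ 2 <= 2 :> R.
Proof.
move=> K0; have Kr : 0 < K%:R :> R by rewrite ltr0n.
have K1 : 1 <= K%:R :> R by rewrite ler1n.
pose a j : R := 1 + j%:R / K%:R.
have a1 j : 1 <= a j by rewrite /a lerDl divr_ge0.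
suff : \sum_(j < J) K%:R^-1 * (a j)^-1 ^+ 2 <= 2 * (1 - (a J)^-1).
  move/le_trans; apply; rewrite ler_piMr // gerBl invr_ge0; have := a1 J; lra.
elim: J => [|J IH].
  by rewrite big_ord0 /a mul0r addr0 invr1 subrr mulr0.
rewrite big_ord_recr /=; apply: le_trans (lerD IH (lexx _)) _.
have aS : a J.+1 = a J + K%:R^-1 by rewrite /a -natr1; ring.
have k1 : K%:R^-1 <= 1 :> R by rewrite invf_le1.
have k0 : 0 < K%:R^-1 :> R by rewrite invr_gt0.
have a0 : 0 < a J by have := a1 J; lra.
have aS0 : 0 < a J.+1 by have := a1 J.+1; lra.
suff : K%:R^-1 * (a J)^-1 ^+ 2 <= 2 * ((a J)^-1 - (a J.+1)^-1) by lra.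
have -> : (a J)^-1 - (a J.+1)^-1 = K%:R^-1 * ((a J)^-1 * (a J.+1)^-1).
  rewrite aS; move: k0 a0; move: (a J) (K%:R^-1) => p q q0 p0.
  by field; rewrite !lt0r_neq0 // addr_gt0.
have -> : 2 * (K%:R^-1 * ((a J)^-1 * (a J.+1)^-1)) =
   K%:R^-1 * ((a J)^-1 * (2 * (a J.+1)^-1)) by ring.
rewrite expr2 ler_wpM2l ?(ltW k0) // ler_wpM2l ?invr_ge0 ?(ltW a0) //.
rewrite -[2]invrK -invfM lef_pV2 ?posrE ?mulr_gt0 ?invr_gt0 //.
by rewrite aS; have := a1 J; lra.
Qed.

Lemma wsum_step m (r : R) (xs : X -> R[i]^o) x : 1 < r -> bounded_linear xs ->
  forall e : R, 0 < e -> exists L0 : nat, forall L, (L0 <= L)%N ->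
  exists2 E : R, 0 <= E & forall K n, (0 < K)%N -> (0 < n)%N ->
  wsum T m r xs x n <= \sum_(j < L * K)
     m.+1%:R / K%:R * (1 + j%:R / K%:R)^-1 ^+ m.+1 *
       wsum T m.+1 (1 + (r - 1) * (1 + j%:R / K%:R)) xs x n + e + E / K%:R.
Proof.
move=> r1 bxs e e0; have tp := @twopi_gt0 R.
have [L0 hL0] := wgt_step hT hsigma m x r1 bxs (divr_gt0 e0 tp).
exists L0 => L /hL0[E E0 hE]; exists ((2 * pi) * E); first by rewrite mulr_ge0 // ltW.
move=> K n K0 n0; have nr0 : n%:R != 0 :> R by rewrite pnatr_eq0 lt0n_neq0.
rewrite /wsum.
have c0 : 0 <= (2 * pi) / n%:R :> R by rewrite divr_ge0 // ltW.
apply: (@le_trans _ _ ((2 * pi) / n%:R * \sum_(i < n) (\sum_(j < L * K)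
     m.+1%:R / K%:R * (1 + j%:R / K%:R)^-1 ^+ m.+1 *
       cabs (wgt T m.+1 (1 + (r - 1) * (1 + j%:R / K%:R)) xs x (upt 0 (2 * pi) n i))
     + e / (2 * pi) + E / K%:R))).
  rewrite ler_wpM2l //; apply: ler_sum => i _; apply: hE => //.
  exact: upt_itv twopi_ge0 n0 (ltnW (ltn_ord i)).
rewrite !big_split /= !sumr_const card_ord 2!mulrDr.
have -> : (2 * pi) / n%:R * (e / (2 * pi) *+ n) = e.
  rewrite -(mulr_natr (e / _)); have := lt0r_neq0 tp; move: (2 * pi) => q q0.
  by field; rewrite nr0 q0.
have -> : (2 * pi) / n%:R * (E / K%:R *+ n) = 2 * pi * E / K%:R.
  have K0' : K%:R != 0 :> R by rewrite pnatr_eq0 lt0n_neq0.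
  by rewrite -(mulr_natr (E / _)); field; rewrite nr0 K0'.
rewrite !lerD2r exchange_big /= mulr_sumr; apply: ler_sum => j _.
by rewrite -mulr_sumr mulrCA.
Qed.

Lemma wsum_ge0 m r xs x n : 0 <= wsum T m r xs x n.
Proof.
rewrite mulr_ge0 ?divr_ge0 ?twopi_ge0 //; apply: sumr_ge0 => i _; exact: rnorm_ge0.
Qed.

(** For each j the hypothesis is applied to the N radii s_(k,j) at once; the weights are the same
    for all k and, as m + 1 >= 2, dominated by the summable ones of [sum_inv_sqr_le]. This yields
    the constant 2 (m + 1) C. *)
Lemma disc_GFS_pred m : (1 <= m)%N -> disc_GFS m.+1 -> disc_GFS m.
Proof.
move=> m1 [C C0 hC]; exists (2 * m.+1%:R * C); first by rewrite !mulr_gt0.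
move=> N r x xs N1 r1 bxs e e0.
have Nr : 0 < N%:R :> R by rewrite ltr0n.
set B := (_ * gamma'_norm P g xs)%E.
pose B0 := (C%:E * gamma_norm P g x * gamma'_norm P g xs)%E.
have BE : B = ((2 * m.+1%:R)%:E * B0)%E by rewrite /B /B0 EFinM !muleA.
have B00 : (0 <= B0)%E.
  rewrite !mule_ge0 ?lee_fin ?(ltW C0) ?gamma_norm_ge0 //.
  by apply: gamma'_norm_ge0 => k; case: (bxs k).
(* The dual norm may be infinite, in which case the bound is trivial; otherwise everything below is
   real arithmetic. *)
have [binf|bfin] := eqVneq B0 +oo%E.
  exists 1%N => n n1; split=> //; rewrite BE binf gt0_muley ?lte_fin ?mulr_gt0 //.
  by rewrite addye // leey.
have [b bE] : exists b : R, B0 = b%:E.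
  by case: B0 B00 bfin {BE} => // b _ _; exists b.
have b0 : 0 <= b by rewrite -lee_fin -bE.
pose M2 : R := 2 * m.+1%:R; have M20 : 0 < M2 by rewrite mulr_gt0.
have e30 : 0 < e / 3 by rewrite divr_gt0.
have [L hL] : exists L : nat, forall k, exists2 E : R, 0 <= E & forall K n, (0 < K)%N -> (0 < n)%N ->
    wsum T m (r k) (xs k) (x k) n <= \sum_(j < L * K)
     m.+1%:R / K%:R * (1 + j%:R / K%:R)^-1 ^+ m.+1 *
       wsum T m.+1 (1 + (r k - 1) * (1 + j%:R / K%:R)) (xs k) (x k) n + e / 3 / N%:R + E / K%:R.
  have [L0 hL0] := @ex_common_rank N _ (fun k => wsum_step m (x k) (r1 k) (bxs k) (divr_gt0 e30 Nr)).
  by exists L0; exact: hL0.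
have /choice[E hE] : forall k, exists E : R, 0 <= E /\ forall K n, (0 < K)%N -> (0 < n)%N ->
    wsum T m (r k) (xs k) (x k) n <= \sum_(j < L * K)
     m.+1%:R / K%:R * (1 + j%:R / K%:R)^-1 ^+ m.+1 *
       wsum T m.+1 (1 + (r k - 1) * (1 + j%:R / K%:R)) (xs k) (x k) n + e / 3 / N%:R + E / K%:R.
  by move=> k; have [E ? ?] := hL k; exists E.
pose Et := \sum_k E k.
have Et0 : 0 <= Et by apply: sumr_ge0 => k _; exact: (hE k).1.
(* K is fixed here, making the total of the E_k / K less than e / 3; then n is taken large for all L
   K families of radii simultaneously. *)
have [K0 hK] := ex_fine_mesh Et0 e30.
have [K_gt0 hEK] := hK K0 (leqnn _).
have Kr : 0 < K0%:R :> R by rewrite ltr0n.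
pose s k j := 1 + (r k - 1) * (1 + j%:R / K0%:R).
have s1 k j : 1 < s k j.
  have j0 : 0 <= j%:R / K0%:R :> R by rewrite divr_ge0.
  by rewrite /s ltrDl mulr_gt0 ?subr_gt0 //; lra.
have e3M : 0 < e / 3 / M2 by rewrite divr_gt0.
have [n0 hn0] : exists n0 : nat, forall n, (n0 <= n)%N -> forall j : 'I_(L * K0),
    (0 < n)%N /\ ((\sum_(k < N) wsum T m.+1 (s k j) (xs k) (x k) n)%:E <=
      B0 + (e / 3 / M2)%:E)%E.
  by apply: ex_common_rank => j; apply: hC.
exists n0.+1 => n nn; have n_gt0 : (0 < n)%N by apply: leq_trans nn.
split=> //; rewrite BE bE -EFinM -EFinD lee_fin.
apply: (@le_trans _ _ (\sum_(k < N) (\sum_(j < L * K0)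
     m.+1%:R / K0%:R * (1 + j%:R / K0%:R)^-1 ^+ m.+1 *
       wsum T m.+1 (s k j) (xs k) (x k) n + e / 3 / N%:R + E k / K0%:R))).
  by apply: ler_sum => k _; exact: (hE k).2.
rewrite !big_split /= sumr_const card_ord -(mulr_natr (e / 3 / N%:R)).
rewrite divfK ?lt0r_neq0 // -mulr_suml -/Et.
have main : \sum_(k < N) \sum_(j < L * K0) m.+1%:R / K0%:R *
   (1 + j%:R / K0%:R)^-1 ^+ m.+1 * wsum T m.+1 (s k j) (xs k) (x k) n <= M2 * (b + e / 3 / M2).
  rewrite exchange_big /=.
  apply: (@le_trans _ _ (\sum_(j < L * K0) m.+1%:R * (b + e / 3 / M2) *
     (K0%:R^-1 * (1 + j%:R / K0%:R)^-1 ^+ 2))).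
    apply: ler_sum => j _; rewrite -mulr_sumr.
    have [_] := hn0 n (ltnW nn) j; rewrite bE -EFinD lee_fin => hj.
    have a1 : 1 <= 1 + j%:R / K0%:R :> R by rewrite lerDl divr_ge0.
    have a0 : 0 < 1 + j%:R / K0%:R :> R by lra.
    set a := (1 + _)^-1; have a01 : 0 <= a <= 1.
      by rewrite invr_ge0 (ltW a0) invf_le1.
    have am : a ^+ m.+1 <= a ^+ 2 by case/andP: a01 => ? ?; apply: ler_wiXn2l.
    have aX : 0 <= a ^+ m.+1 by rewrite exprn_ge0 //; case/andP: a01.
    have mK : 0 <= m.+1%:R / K0%:R :> R by rewrite divr_ge0.
    have -> : m.+1%:R * (b + e / 3 / M2) * (K0%:R^-1 * a ^+ 2) =
      (m.+1%:R / K0%:R * a ^+ 2) * (b + e / 3 / M2) by ring.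
    apply: ler_pM hj; rewrite ?mulr_ge0 //; last by rewrite ler_wpM2l.
    by apply: sumr_ge0 => k _; exact: wsum_ge0.
  rewrite -mulr_sumr /M2.
  have := sum_inv_sqr_le (L * K0) K_gt0 => hsq.
  have p0 : 0 <= m.+1%:R * (b + e / 3 / M2).
    by rewrite mulr_ge0 // addr_ge0 // ltW.
  apply: le_trans (ler_wpM2l p0 hsq) _.
  by rewrite le_eqVlt /M2; apply/orP; left; apply/eqP; ring.
have e1 : M2 * (b + e / 3 / M2) = M2 * b + e / 3.
  by rewrite mulrDr [M2 * (_ / _)]mulrC divfK // lt0r_neq0.
rewrite e1 in main; rewrite -/M2.
have := ltW hEK; lra.
Qed.

End DiscreteGFS.

(** * Gaussian sums *)

Section NormalMoment.
Context {R : realType}.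
Local Notation mu := (@lebesgue_measure R).

(** The Radon-Nikodym derivative of the normal law and [normal_pdf] have equal integrals over every
    measurable set, so they agree almost everywhere. *)
Lemma ge0_integral_normal_prob (m s : R) (f : R -> \bar R) :
  measurable_fun setT f -> (forall x, 0 <= f x)%E ->
  (\int[normal_prob m s]_x f x = \int[mu]_x (f x * (normal_pdf m s x)%:E))%E.
Proof.
move=> mf f0; have dom := normal_prob_dominates m s.
rewrite -(Radon_Nikodym_SigmaFinite.change_of_variables dom) //.
have mR := measurable_int _ (Radon_Nikodym_SigmaFinite.f_integrable dom).
have mN : measurable_fun setT (EFin \o normal_pdf m s).
  by apply/measurable_EFinP; exact: measurable_normal_pdf.
apply: ae_eq_integral => //; [exact: emeasurable_funM..|].
apply: ae_eqe_mul2l; apply: integral_ae_eq => //.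
  exact: Radon_Nikodym_SigmaFinite.f_integrable.
by move=> E _ mE; rewrite -Radon_Nikodym_SigmaFinite.f_integral.
Qed.

(** Finiteness suffices. At variance 1/2 the density is proportional to exp(- y^2): one half of the
    exponent absorbs y^2, the other leaves a multiple of the standard normal density. *)
Lemma normal_second_moment : exists M : R,
  (\int[normal_prob (0 : R) (Num.sqrt 2^-1)]_y (y ^+ 2)%:E <= M%:E)%E.
Proof.
set s := Num.sqrt _; have s2 : s ^+ 2 = 2^-1 by rewrite sqr_sqrtr // invr_ge0.
have s0 : s != 0 by rewrite gt_eqF // sqrtr_gt0 invr_gt0.
set K := 2 * normal_peak s / normal_peak (1 : R).
have K0 : 0 <= K by rewrite !mulr_ge0 ?normal_peak_ge0 // invr_ge0 normal_peak_ge0.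
have p1 := normal_peak_gt0 (oner_neq0 R).
exists K; rewrite ge0_integral_normal_prob; last 2 first.
- by apply/measurable_EFinP; exact: measurable_funX.
- by move=> y; rewrite lee_fin sqr_ge0.
apply: (@le_trans _ _ (\int[mu]_y (K%:E * (normal_pdf 0 1 y)%:E))%E).
  apply: ge0_le_integral => //.
  - by move=> y _; rewrite lee_fin mulr_ge0 ?sqr_ge0 // normal_pdf_ge0.
  - apply/measurable_EFinP; apply: measurable_funM; first exact: measurable_funX.
    exact: measurable_normal_pdf.
  - apply/measurable_EFinP; apply: measurable_funM => //.
    exact: measurable_normal_pdf.
  move=> y _; rewrite lee_fin !normal_pdfE ?oner_neq0 //.
  rewrite /normal_fun s2 expr1n subr0 /K.
  rewrite (_ : - y ^+ 2 / (2^-1 *+ 2) = - (y ^+ 2 / 2) + - (y ^+ 2 / 2)); last by field.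
  rewrite mulNr expRD.
  have h : y ^+ 2 / 2 * expR (- (y ^+ 2 / 2)) <= 1.
    rewrite expRN ler_pdivrMr ?expR_gt0 // mul1r.
    by apply: le_trans (expR_ge1Dx _); rewrite lerDr.
  rewrite [X in _ <= X](_ : _ = normal_peak s * (2 * expR (- (y ^+ 2 / 2)))); last first.
    by field; rewrite gt_eqF.
  rewrite mulrCA ler_wpM2l ?normal_peak_ge0 // mulrA ler_wpM2r ?expR_ge0 //.
  by move: h; lra.
rewrite ge0_integralZl ?integral_normal_pdf ?mule1 //.
- by apply/measurable_EFinP; exact: measurable_normal_pdf.
- by move=> y _; rewrite lee_fin normal_pdf_ge0.
Qed.

(** If the probability were 0, the positive density would vanish almost everywhere on an interval of
    positive length. *)
Lemma normal_prob_itv_gt0 (m s a b : R) : s != 0 -> a < b ->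
  (0 < normal_prob m s `]a, b[)%E.
Proof.
move=> s0 ab; rewrite lt0e; apply/andP; split; last exact: measure_ge0.
apply/negP => /eqP h.
have mN : measurable_fun `]a, b[ (EFin \o normal_pdf m s).
  by apply/measurable_EFinP; apply: measurable_funTS; exact: measurable_normal_pdf.
have /ae_eq_integral_abs : (\int[mu]_(x in `]a, b[) `|(EFin \o normal_pdf m s) x| = 0)%E.
  rewrite -h; apply: eq_integral => x _ /=.
  by rewrite ger0_norm // normal_pdf_ge0.
move=> /(_ (measurable_itv _) mN)[N [mN' N0 sub]].
have : (mu `]a, b[ <= 0)%E.
  rewrite -N0; apply: le_measure; rewrite ?inE //.
  move=> x xab; apply: sub => /= q; have [] := q xab; apply/eqP.
  by rewrite normal_pdfE // mulf_neq0 // gt_eqF ?normal_peak_gt0 // expR_gt0.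
by rewrite lebesgue_measure_itv /= lte_fin ab EFinN -EFinB lee_fin leNgt subr_gt0 ab.
Qed.
End NormalMoment.

Lemma measurable_fun_lt_ray {R : realType} d (S : measurableType d) (f : S -> R) :
  (forall c, measurable [set w | f w < c]) -> measurable_fun setT f.
Proof.
move=> h mD; apply: (measurability _ (RGenCInfty.measurableE R)) => //.
move=> _ [_ [c ->] <-]; rewrite setTI.
rewrite (_ : _ @^-1` _ = ~` [set w | f w < c]); first exact: measurableC.
by apply/seteqP; split=> w /=; rewrite in_itv /= andbT leNgt => /negP.
Qed.

(* No separability of [X] is assumed: the norm is Lipschitz in each coefficient,
   so a strict sublevel set is a union over the rational values of one of them. *)
Lemma measurable_rnorm_real_comb {R : realType} {X : normedModType R[i]}
    d (S : measurableType d) N (a : 'I_N -> S -> R) (y : 'I_N -> X) v :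
  (forall i, measurable_fun setT (a i)) ->
  measurable_fun setT (fun w => rnorm (v + \sum_(i < N) (a i w)%:C *: y i)).
Proof.
elim: N a y v => [|N IH] a y v ma.
  by under eq_fun do rewrite big_ord0; exact: measurable_cst.
pose b i := a (lift ord0 i); pose f (u : R) w : R :=
  rnorm (v + u%:C *: y ord0 + \sum_(i < N) (b i w)%:C *: y (lift ord0 i)).
have mf u : measurable_fun setT (f u) by apply: IH => i; exact: ma.
have fE w : rnorm (v + \sum_(i < N.+1) (a i w)%:C *: y i) = f (a ord0 w) w.
  by rewrite /f big_ord_recl addrA.
under eq_fun do rewrite fE.
set L := rnorm (y ord0); have L0 : 0 <= L := rnorm_ge0 _.
have flip u u' w : f u w <= f u' w + L * `|u - u'|.
  rewrite /f; set z := \sum_(i < N) _.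
  have -> : v + u%:C *: y ord0 + z =
     (v + u'%:C *: y ord0 + z) + (u - u')%:C *: y ord0.
    by rewrite rmorphB scalerBl [RHS](AC (3*2) ((1*4*3)*(2*5)))/= subrr addr0.
  by apply: le_trans (rnormD _ _) _; rewrite (rnormZ (u - u')%:C) cabsC mulrC.
apply: measurable_fun_lt_ray => c.
rewrite (_ : [set w | _] = \bigcup_(q : rat)
   [set w | f (ratr q) w + L * `|a ord0 w - ratr q| < c]).
  apply: bigcupT_measurable_rat => q.
  have m : measurable_fun setT (fun w => f (ratr q) w + L * `|a ord0 w - ratr q|).
    apply: measurable_funD => //; apply: measurable_funM => //.
    by apply: measurableT_comp => //; apply: measurable_funB => //; exact: ma.
  have := m measurableT _ (measurable_itv `]-oo, c[); rewrite setTI.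
  rewrite (_ : _ @^-1` _ = [set w | f (ratr q) w + L * `|a ord0 w - ratr q| < c]) //.
apply/seteqP; split=> w /=.
  move=> h; set u := a ord0 w in h *.
  (* For a rational q near u, f q + L |u - q| <= f u + 2 L |u - q|, which must stay below c. *)
  have e0 : 0 < (c - f u w) / (2 * L + 1) by rewrite divr_gt0 ?subr_gt0 //; lra.
  have /rat_in_itvoo[q] : u - (c - f u w) / (2 * L + 1) < u by lra.
  rewrite in_itv /= => /andP[h1 h2]; exists q => //=.
  have h3 : `|u - ratr q| < (c - f u w) / (2 * L + 1).
    by rewrite ger0_norm; [lra|rewrite subr_ge0 ltW].
  have := flip (ratr q) u w; rewrite distrC => h4.
  move: h3; rewrite ltr_pdivlMr; last lra.
  by have := normr_ge0 (u - ratr q); move: (`|u - ratr q|) h4 => t h4 t0; nra.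
by case=> q _ /=; apply: le_lt_trans; exact: flip.
Qed.

Section GaussianNorm.
Context {R : realType} {d : measure_display} {Sigma : measurableType d}.
Variable P : probability Sigma R.

Definition L2 (f : Sigma -> R) : \bar R := sqrte (\int[P]_w ((f w) ^+ 2)%:E)%E.

(** Makes Minkowski's inequality and the vanishing criterion for L^p norms available for the
    square-root form used in [gamma_norm]. *)
Lemma L2_Lnorm (f : Sigma -> R) : L2 f = Lnorm P 2%:E (EFin \o f).
Proof.
rewrite unlock /= /L2.
have -> : (\int[P]_w `|(f w)%:E| `^ 2)%E = (\int[P]_w ((f w) ^+ 2)%:E)%E.
  apply: eq_integral => w _; rewrite /= powR_mulrn // real_normK //.
  exact: num_real.
have : (0 <= \int[P]_w ((f w) ^+ 2)%:E)%E.
  by apply: integral_ge0 => w _; rewrite lee_fin sqr_ge0.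
case: (integral _ _ _) => [r r0||//]; first by rewrite poweR_EFin powR12_sqrt.
by move=> _; rewrite poweRyr // invr_eq0 pnatr_eq0.
Qed.

Lemma L2_le (f h : Sigma -> R) : measurable_fun setT f -> measurable_fun setT h ->
  (forall w, 0 <= f w <= h w) -> (L2 f <= L2 h)%E.
Proof.
move=> mf mh fh; rewrite lee_sqrt; last first.
  by apply: integral_ge0 => w _; rewrite lee_fin sqr_ge0.
apply: ge0_le_integral => //.
- by move=> w _; rewrite lee_fin sqr_ge0.
- by apply/measurable_EFinP; exact: measurable_funX.
- by apply/measurable_EFinP; exact: measurable_funX.
move=> w _; have /andP[f0 fh'] := fh w.
by rewrite lee_fin ler_sqr ?nnegrE // (le_trans f0).
Qed.

Lemma L2D (f h : Sigma -> R) : measurable_fun setT f -> measurable_fun setT h ->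
  (L2 (fun w => f w + h w)%R <= L2 f + L2 h)%E.
Proof. by move=> mf mh; rewrite !L2_Lnorm; apply: minkowski_EFin => //; rewrite ler1n. Qed.

Lemma L2Z (a : R) (f : Sigma -> R) : 0 <= a -> measurable_fun setT f ->
  L2 (fun w => a * f w) = (a%:E * L2 f)%E.
Proof.
move=> a0 mf; rewrite /L2.
under eq_integral do rewrite exprMn EFinM.
rewrite ge0_integralZl //.
- by rewrite sqrteM ?lee_fin ?sqr_ge0 //= sqrtr_sqr ger0_norm.
- by apply/measurable_EFinP; exact: measurable_funX.
- by move=> w _; rewrite lee_fin sqr_ge0.
- by rewrite lee_fin sqr_ge0.
Qed.

Lemma L2_eq0 (f : Sigma -> R) : measurable_fun setT f -> L2 f = 0%E ->
  exists N, [/\ measurable N, P N = 0%E & forall w, ~ N w -> f w = 0].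
Proof.
move=> mf; rewrite L2_Lnorm => h.
have p2 : (0 < 2%:E :> \bar R)%E by rewrite lte_fin ltr0n.
have mf' : measurable_fun setT (EFin \o f) by apply/measurable_EFinP.
have [N [mN N0 sub]] := Lnorm_eq0_eq0 mf' p2 h.
exists N; split=> // w Nw; apply: contrapT => fw; apply: Nw; apply: sub => /= q.
by apply: fw; have := q I => -[].
Qed.

Variable g : nat -> Sigma -> R[i].
Hypothesis hg : gaussian_sequence P g.

Lemma measurable_Re_gaussian k : measurable_fun setT (fun w => complex.Re (g k w)).
Proof. by have [/(_ k)[/(_ false)]] := hg. Qed.

Lemma measurable_Im_gaussian k : measurable_fun setT (fun w => complex.Im (g k w)).
Proof. by have [/(_ k)[/(_ true)]] := hg. Qed.

Lemma gaussian_part_moment k : exists M : R,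
  (\int[P]_w ((complex.Re (g k w)) ^+ 2)%:E <= M%:E)%E /\
  (\int[P]_w ((complex.Im (g k w)) ^+ 2)%:E <= M%:E)%E.
Proof.
have [M hM] := @normal_second_moment R; exists M.
have part f : measurable_fun setT f ->
    (forall B, measurable B -> P (f @^-1` B) = normal_prob 0 (Num.sqrt 2^-1) B) ->
    (\int[P]_w ((f w) ^+ 2)%:E <= M%:E)%E.
  move=> mf hf; apply: le_trans hM.
  rewrite (_ : (\int[P]_w _)%E = (\int[P]_(w in f @^-1` setT) ((fun y => (y ^+ 2)%:E) \o f) w)%E) //.
  rewrite -(@ge0_integral_pushforward _ _ _ _ R f mf P) //; last 2 first.
  - by apply/measurable_EFinP; exact: measurable_funX.
  - by move=> y _; rewrite lee_fin sqr_ge0.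
  by rewrite (@eq_measure_integral _ _ _ _ (normal_prob (0 : R) (Num.sqrt 2^-1))) // => A mA _; exact: hf.
have [/(_ k)[_ hp _] _] := hg; split; apply: part.
- exact: measurable_Re_gaussian.
- exact: hp false.
- exact: measurable_Im_gaussian.
- exact: hp true.
Qed.

Context {X : completeNormedModType R[i]}.
Local Notation gnorm := (@gamma_norm _ _ _ P g X).

(** N complex coefficients are treated as 2 N real ones, with vectors x_k and i x_k. *)
Lemma measurable_gaussian_sum N (x : 'I_N -> X) v :
  measurable_fun setT (fun w => rnorm (v + \sum_(k < N) g k w *: x k)).
Proof.
pose a (i : 'I_(N + N)) (w : Sigma) : R := match fintype.split i with
  inl k => complex.Re (g k w) | inr k => complex.Im (g k w) end.
pose y (i : 'I_(N + N)) : X := match fintype.split i with inl k => x k | inr k => 'i *: x k end.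
rewrite (_ : (fun w => _) = fun w => rnorm (v + \sum_(i < N + N) (a i w)%:C *: y i)).
  apply: measurable_rnorm_real_comb => i; rewrite /a.
  by case: fintype.split => k; [exact: measurable_Re_gaussian|exact: measurable_Im_gaussian].
apply/funext => w; rewrite big_split_ord; congr (rnorm (_ + _)).
transitivity (\sum_(k < N) ((a (lshift N k) w)%:C *: y (lshift N k) +
    (a (rshift N k) w)%:C *: y (rshift N k))); last by rewrite big_split.
apply: eq_bigr => k _; rewrite /a /y (unsplitK (inl k)) (unsplitK (inr k)).
by rewrite scalerA -scalerDl mulrC -complexE.
Qed.

Lemma measurable_gaussian_sum0 N (x : 'I_N -> X) :
  measurable_fun setT (fun w => rnorm (\sum_(k < N) g k w *: x k)).
Proof. by have := measurable_gaussian_sum x 0; under eq_fun do rewrite add0r. Qed.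

Lemma gamma_norm_L2 N (x : 'I_N -> X) :
  gnorm x = L2 (fun w => rnorm (\sum_(k < N) g k w *: x k)).
Proof. by []. Qed.

Lemma gamma_normD N (x y : 'I_N -> X) :
  (gnorm (fun k => x k + y k)%R <= gnorm x + gnorm y)%E.
Proof.
rewrite !gamma_norm_L2; apply: le_trans (L2D _ _); try exact: measurable_gaussian_sum0.
apply: L2_le; first exact: measurable_gaussian_sum0.
  by apply: measurable_funD; exact: measurable_gaussian_sum0.
move=> w; rewrite rnorm_ge0; under eq_bigr do rewrite scalerDr.
by rewrite big_split rnormD.
Qed.

Lemma gamma_normZ N (a : R[i]) (x : 'I_N -> X) :
  gnorm (fun k => a *: x k) = ((cabs a)%:E * gnorm x)%E.
Proof.
rewrite !gamma_norm_L2 -L2Z ?rnorm_ge0 //; last exact: measurable_gaussian_sum0.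
congr L2; apply/funext => w; rewrite -rnormZ scaler_sumr; congr rnorm.
by apply: eq_bigr => k _; rewrite !scalerA mulrC.
Qed.

(** Makes the inclusion of each coordinate into X^N bounded for gamma; the boundedness of the
    functionals x_k^* given by the Hahn-Banach theorem rests on it. *)
Lemma gamma_norm_single N (j : 'I_N) : exists C : R, forall y : X,
  (gnorm (fun k => if k == j then y else 0)%R <= (C * rnorm y)%:E)%E.
Proof.
have [M [h1 h2]] := gaussian_part_moment j.
have mX h : measurable_fun setT h -> measurable_fun [set: Sigma] (fun w => ((h w : R) ^+ 2)%:E).
  by move=> mh; apply/measurable_EFinP; exact: measurable_funX.
exists (Num.sqrt (M + M)) => y; rewrite /gamma_norm.
have -> : (\int[P]_w ((rnorm (\sum_(k < N) g k w *: (if k == j then y else 0)%R)) ^+ 2)%R%:E =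
   (rnorm y ^+ 2)%:E * \int[P]_w ((complex.Re (g j w) ^+ 2)%:E + (complex.Im (g j w) ^+ 2)%:E))%E.
  rewrite -ge0_integralZl ?lee_fin ?sqr_ge0 //.
  - apply: eq_integral => w _; rewrite (bigD1 j) //= eqxx big1 ?addr0; last first.
      by move=> k /negbTE->; rewrite scaler0.
    by rewrite rnormZ exprMn cabs_sqr -EFinD -EFinM mulrC.
  - by apply: emeasurable_funD; apply: mX; [exact: measurable_Re_gaussian|exact: measurable_Im_gaussian].
  - by move=> w _; rewrite -EFinD lee_fin addr_ge0 ?sqr_ge0.
rewrite sqrteM ?lee_fin ?sqr_ge0 // [sqrte (_)%:E]/= sqrtr_sqr ger0_norm ?rnorm_ge0 //.
rewrite mulrC EFinM lee_wpmul2l ?lee_fin ?rnorm_ge0 //.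
have h3 : (\int[P]_w ((complex.Re (g j w) ^+ 2)%:E + (complex.Im (g j w) ^+ 2)%:E) <= (M + M)%:E)%E.
  rewrite ge0_integralD //; first by rewrite EFinD; exact: leeD.
  - by move=> w _; rewrite lee_fin sqr_ge0.
  - by apply: mX; exact: measurable_Re_gaussian.
  - by move=> w _; rewrite lee_fin sqr_ge0.
  - by apply: mX; exact: measurable_Im_gaussian.
have h0 : (0 <= \int[P]_w ((complex.Re (g j w) ^+ 2)%:E + (complex.Im (g j w) ^+ 2)%:E))%E.
  by apply: integral_ge0 => w _; rewrite -EFinD lee_fin addr_ge0 ?sqr_ge0.
rewrite (_ : (Num.sqrt (M + M))%:E = sqrte (M + M)%:E) // lee_sqrt //.
exact: le_trans h3.
Qed.

(** By the triangle inequality over the coordinates. Finiteness lets gamma be read as a real-valued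
    seminorm. *)
Lemma gamma_norm_fin N (x : 'I_N -> X) : gnorm x \is a fin_num.
Proof.
rewrite ge0_fin_numE; last exact: sqrte_ge0.
suff h (s : seq 'I_N) : (gnorm (fun k => \sum_(j <- s) (if k == j then x j else 0))%R < +oo)%E.
  rewrite (_ : x = fun k => \sum_(j <- index_enum 'I_N) (if k == j then x j else 0)) //.
  apply/funext => k; rewrite (bigD1 k) //= eqxx big1 ?addr0 // => j /negbTE.
  by rewrite eq_sym => ->.
elim: s => [|j s IH].
  rewrite (_ : (fun k => _) = fun=> 0); last by apply/funext => k; rewrite big_nil.
  by have := gamma_norm0 P g (X := X) N => ->.
rewrite (_ : (fun k => _) = fun k => (if k == j then x j else 0) +
   \sum_(i <- s) (if k == i then x i else 0)); last by apply/funext => k; rewrite big_cons.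
apply: le_lt_trans (gamma_normD _ _) _; rewrite lte_add_pinfty //.
by have [C h] := gamma_norm_single j; apply: le_lt_trans (h _) _; rewrite ltry.
Qed.

End GaussianNorm.

Lemma prode_gt0 {R : realType} (I : Type) (s : seq I) (f : I -> \bar R) :
  (forall i, 0 < f i)%E -> (0 < \prod_(i <- s) f i)%E.
Proof.
by move=> f0; elim/big_ind : _ => [|x y x0 y0|//]; rewrite ?lte_fin ?ltr01 ?mule_gt0.
Qed.

(** * The gamma norm vanishes only at 0 *)

Section Nondegeneracy.
Context {R : realType} {d : measure_display} {Sigma : measurableType d}.
Variables (P : probability Sigma R) (g : nat -> Sigma -> R[i]).
Hypothesis hg : gaussian_sequence P g.
Context {X : completeNormedModType R[i]}.

Definition open_box (c : R[i]) (e : R) : set (R * R) :=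
  `]complex.Re c - e, complex.Re c + e[ `*` `]complex.Im c - e, complex.Im c + e[.

Lemma measurable_open_box c e : measurable (open_box c e).
Proof. by apply: measurableX; exact: measurable_itv. Qed.

Local Notation re_im k := (fun w => (complex.Re (g k w), complex.Im (g k w)) : R * R).

Lemma gaussian_box_gt0 k c e : 0 < e -> (0 < P (re_im k @^-1` open_box c e))%E.
Proof.
move=> e0; have [/(_ k)[_ hp hi] _] := hg.
have s0 : Num.sqrt 2^-1 != 0 :> R by rewrite gt_eqF // sqrtr_gt0 invr_gt0.
pose B (b : bool) : set R := let u := if b then complex.Im c else complex.Re c in
  [set` `]u - e, u + e[].
have mB b : measurable (B b) by exact: measurable_itv.
have B0 b : (0 < normal_prob (0 : R) (Num.sqrt 2^-1) (B b))%E.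
  by apply: normal_prob_itv_gt0 => //; lra.
have := hi [:: false; true] B isT (fun b _ => mB b).
rewrite !big_cons !big_nil setIT mule1 => h.
rewrite (_ : _ @^-1` _ = (fun w => complex.Re (g k w)) @^-1` B false `&`
   (fun w => complex.Im (g k w)) @^-1` B true) //.
rewrite [X in (_ < X)%E]h; apply: mule_gt0; first by have := hp false _ (mB false) => ->.
by have := hp true _ (mB true) => ->.
Qed.

Lemma gaussian_boxes_gt0 N (c : nat -> R[i]) e : 0 < e ->
  (0 < P [set w | forall k, (k < N)%N -> open_box (c k) e (re_im k w)])%E.
Proof.
move=> e0; have [_ hi] := hg.
have := hi (iota 0 N) (fun k => open_box (c k) e) (iota_uniq _ _)
  (fun k _ => measurable_open_box (c k) e).
rewrite (_ : \big[setI/setT]_(j <- iota 0 N) _ =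
  [set w | forall k, (k < N)%N -> open_box (c k) e (re_im k w)]).
  by move=> ->; apply: prode_gt0 => k; exact: gaussian_box_gt0.
rewrite -bigcap_seq; apply/seteqP; split=> w /= h k; first by move=> kN; apply: h; rewrite /= mem_iota.
by rewrite /= mem_iota => kN; exact: h.
Qed.

Lemma measurable_gaussian_boxes N (c : nat -> R[i]) e :
  measurable [set w | forall k, (k < N)%N -> open_box (c k) e (re_im k w)].
Proof.
rewrite (_ : [set w | _] = \bigcap_(k in [set k | (k < N)%N]) (re_im k @^-1` open_box (c k) e)) //.
apply: bigcap_measurableType => k _; rewrite -[X in measurable X]setTI.
apply: (@measurable_fun_pair _ _ _ Sigma R R _ _ (measurable_Re_gaussian hg k) (measurable_Im_gaussian hg k)) => //.
exact: measurable_open_box.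
Qed.

(* With positive probability all [g k] are within [e'] of [(k == j)%:R]; there
   the Gaussian sum is close to [x j]. *)
Lemma gamma_norm_eq0 N (x : 'I_N -> X) : gamma_norm P g x = 0%E -> forall j, x j = 0.
Proof.
rewrite gamma_norm_L2 => /L2_eq0[|Z [mZ Z0 hZ] j].
  exact: (measurable_gaussian_sum0 hg).
apply: rnorm_eq0; apply/eqP; rewrite eq_le rnorm_ge0 andbT.
set S := \sum_(k < N) rnorm (x k).
have S0 : 0 <= S by apply: sumr_ge0 => k _; exact: rnorm_ge0.
apply/ler_addgt0Pr => e e0; rewrite add0r.
pose e' := e / (2 * (S + 1)); pose c k : R[i] := (k == j :> nat)%:R.
have e'0 : 0 < e' by rewrite divr_gt0 //; lra.
have [w [wb wZ]] : exists w,
    (forall k, (k < N)%N -> open_box (c k) e' (re_im k w)) /\ ~ Z w.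
  apply: contrapT => h; have := gaussian_boxes_gt0 N c e'0; apply/negP.
  rewrite -leNgt -Z0; apply: le_measure; rewrite ?inE //.
    exact: measurable_gaussian_boxes.
  by move=> w wb; apply: contrapT => wZ; apply: h; exists w.
have /rnorm_eq0 s0 := hZ w wZ.
(* The Gaussian sum is 0 at w, and the sum of the c_k x_k is x j. *)
have -> : x j = \sum_(k < N) (c k - g k w) *: x k.
  under eq_bigr do rewrite scalerBl; rewrite sumrB s0 subr0 (bigD1 j) //= /c eqxx scale1r.
  by rewrite big1 ?addr0 // => k /negbTE; rewrite -val_eqE /= => ->; rewrite scale0r.
apply: le_trans (rnorm_sum _ _ _) _.
apply: (@le_trans _ _ (\sum_(k < N) (2 * e') * rnorm (x k))).
  apply: ler_sum => k _; rewrite rnormZ ler_wpM2r ?rnorm_ge0 //.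
  apply: le_trans (cabs_leD _) _.
  have [] := wb k (ltn_ord k); rewrite /= !in_itv /= => /andP[a1 a2] /andP[b1 b2].
  rewrite !raddfB /=.
  have h1 : `|complex.Re (c k) - complex.Re (g k w)| <= e' by rewrite ler_norml; apply/andP; split; lra.
  have h2 : `|complex.Im (c k) - complex.Im (g k w)| <= e' by rewrite ler_norml; apply/andP; split; lra.
  by move: h1 h2; lra.
have S1 : 0 < S + 1 by lra.
rewrite -mulr_sumr -/S (_ : 2 * e' * S = e * (S / (S + 1))); last first.
  by rewrite /e'; field; rewrite gt_eqF.
by rewrite ler_piMr ?(ltW e0) // ler_pdivrMr //; lra.
Qed.
End Nondegeneracy.

(** * The Hahn-Banach theorem *)

Section HahnBanach.
Context {R : realType} {V : lmodType R[i]}.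
Implicit Types (p q : V -> R) (x y v : V).

(** V is regarded here as a real vector space. Equality in the homogeneity follows by applying the
    inequality to 1 / a as well. *)
Definition sublinear p := (forall x y, p (x + y) <= p x + p y) /\
  (forall (a : R) x, 0 < a -> p (a%:C *: x) <= a * p x).

Lemma sublinear0 p : sublinear p -> p 0 = 0.
Proof.
case=> _ hZ; have h1 := hZ 2 0 ltac:(lra); have h2 := hZ (1 / 2) 0 ltac:(lra).
by move: h1 h2; rewrite !scaler0; lra.
Qed.

Lemma sublinearN p x : sublinear p -> - p (- x) <= p x.
Proof.
move=> hp; have [hD _] := hp; have := hD x (- x).
by rewrite subrr sublinear0 //; lra.
Qed.

(** Subadditivity of the infimum involves two points, so the family need only be directed downwards
    at two points at a time; b keeps the infimum finite. *)
Lemma sublinear_inf (A : set (V -> R)) (b : V -> R) : A !=set0 ->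
  (forall q, A q -> sublinear q /\ forall x, b x <= q x) ->
  (forall q1 q2, A q1 -> A q2 -> forall x y, exists2 q, A q & q x <= q1 x /\ q y <= q2 y) ->
  exists2 q, sublinear q & (forall q', A q' -> forall x, q x <= q' x) /\ forall x, b x <= q x.
Proof.
move=> [q0 A0] hA dir; pose E x : set R := [set q x | q in A].
have lb x : has_lbound (E x) by exists (b x) => _ [q /hA[_ h] <-].
have ne x : E x !=set0 by exists (q0 x), q0.
have infle q x : A q -> inf (E x) <= q x by move=> Aq; apply: ge_inf => //; exists q.
exists (fun x => inf (E x)); last first.
  split=> [q Aq x|x]; first exact: infle.
  by apply: lb_le_inf => // _ [q /hA[_ h] <-].
split=> [x y|a x a0].
  rewrite -lerBlDr; apply: lb_le_inf => // _ [q1 A1 <-].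
  rewrite lerBlDr -lerBlDl; apply: lb_le_inf => // _ [q2 A2 <-].
  have [q Aq [h1 h2]] := dir q1 q2 A1 A2 x y.
  have [[hD _] _] := hA _ Aq.
  by have := infle _ (x + y) Aq; have := hD x y; lra.
rewrite /= mulrC -ler_pdivrMr //; apply: lb_le_inf => // _ [q Aq <-].
rewrite ler_pdivrMr // mulrC; apply: le_trans (infle _ _ Aq) _.
by have [[_ hZ] _] := hA _ Aq; exact: hZ.
Qed.

(** Take the infimum over t >= 0 of q(x + t v) - t q(v), bounded below by - q(- x). The value t = 0
    gives q' <= q, and t = 1 gives the bound at - v. *)
Lemma sublinear_shift q v : sublinear q -> exists2 q', sublinear q' &
  (forall x, q' x <= q x) /\ q' (- v) <= - q v.
Proof.
move=> hq; have [hD hZ] := hq.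
pose B x : set R := [set q (x + t%:C *: v) - t * q v | t in [set t : R | 0 <= t]].
have qt (t : R) : 0 <= t -> q (t%:C *: v) <= t * q v.
  rewrite le_eqVlt => /predU1P[<-|/hZ //].
  by rewrite scale0r sublinear0 // mul0r.
have qt' (t : R) : 0 <= t -> t * q v <= q (t%:C *: v).
  rewrite le_eqVlt => /predU1P[<-|t0]; first by rewrite scale0r sublinear0 // mul0r.
  have := hZ t^-1 (t%:C *: v); rewrite invr_gt0 scalerA -rmorphM /= mulVf ?gt_eqF //.
  by rewrite scale1r => /(_ t0); rewrite mulrC ler_pdivlMr // mulrC.
have lb x : has_lbound (B x).
  exists (- q (- x)) => _ [t t0 <-]; have := hD (x + t%:C *: v) (- x).
  by rewrite addrAC subrr add0r => h; have := qt' t t0; lra.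
have ne x : B x !=set0 by exists (q (x + 0%:C *: v) - 0 * q v), 0 => /=.
have infle t x : 0 <= t -> inf (B x) <= q (x + t%:C *: v) - t * q v.
  by move=> t0; apply: ge_inf => //; exists t.
exists (fun x => inf (B x)); last first.
  split=> [x|]; first by have := infle 0 x (lexx _); rewrite scale0r addr0 mul0r subr0.
  by have := infle 1 (- v) ler01; rewrite scale1r addNr sublinear0 // mul1r sub0r.
split=> [x y|a x a0].
  rewrite -lerBlDr; apply: lb_le_inf => // _ [t t0 <-].
  rewrite lerBlDr -lerBlDl; apply: lb_le_inf => // _ [s s0 <-].
  have := infle (t + s) (x + y) (addr_ge0 t0 s0).
  have := hD (x + t%:C *: v) (y + s%:C *: v).
  by rewrite addrACA -scalerDl -rmorphD /=; lra.
rewrite /= mulrC -ler_pdivrMr //; apply: lb_le_inf => // _ [t t0 <-].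
rewrite ler_pdivrMr // mulrC.
apply: le_trans (infle (a * t) _ (mulr_ge0 (ltW a0) t0)) _.
have := hZ a (x + t%:C *: v) a0.
by rewrite scalerDr scalerA -rmorphM /= mulrBr mulrA; lra.
Qed.

Lemma minimal_sublinear p : sublinear p -> exists2 q, sublinear q &
  (forall x, q x <= p x) /\
  forall q', sublinear q' -> (forall x, q' x <= q x) -> forall x, q x <= q' x.
Proof.
move=> hp; pose Q := {q : V -> R | sublinear q /\ forall x, q x <= p x}.
pose p0 : Q := exist _ p (conj hp (fun x => lexx _)).
(* The order is reversed, so that a maximal element in Zorn's lemma is a minimal functional. *)
pose leQ (s t : Q) := `[< forall x, sval t x <= sval s x >].
have [||A tot|[q [sq qp]] min] := @ZL_preorder Q p0 leQ.
- by move=> t; apply/asboolP => x.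
- move=> r s t /asboolP h1 /asboolP h2; apply/asboolP => x.
  exact: le_trans (h1 x).
- have [[a Aa]|nA] := pselect (A !=set0); last first.
    by exists p0 => s As; exfalso; apply: nA; exists s.
  have [||q1 q2 [s1 A1 <-] [s2 A2 <-] x y|q sq [hq hb]] :=
    @sublinear_inf [set sval s | s in A] (fun x => - p (- x)).
  + by exists (sval a), a.
  + move=> _ [[q [sq qp]] Aq <-] /=; split=> // x.
    by have := sublinearN x sq; have := qp (- x); lra.
  + have [/asboolP h|/asboolP h] := tot s1 s2 A1 A2.
      by exists (sval s2); [exists s2|split].
    by exists (sval s1); [exists s1|split].
  have qp x : q x <= p x.
    by apply: le_trans (hq (sval a) _ x) _; [exists a|case: (svalP a)].
  exists (exist _ q (conj sq qp)) => s As; apply/asboolP => x /=.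
  by apply: hq; exists s.
exists q => //; split=> // q' sq' le x.
have qp' y : q' y <= p y by apply: le_trans (le y) _.
have /asboolP := min (exist _ q' (conj sq' qp')) ltac:(apply/asboolP; exact: le).
exact.
Qed.

(* A minimal sublinear functional is linear, since shifting it in a direction
   [v] cannot decrease it. *)
Lemma real_hahn_banach p y : sublinear p -> exists f : V -> R,
  [/\ forall u v, f (u + v) = f u + f v, forall (a : R) v, f (a%:C *: v) = a * f v,
      forall v, f v <= p v & f y = p y].
Proof.
(* Minimizing below p shifted along y forces f(- y) <= - p y, hence f y = p y. *)
move=> hp; have [p1 sp1 [p1p p1y]] := sublinear_shift y hp.
have [f sf [fp1 fmin]] := minimal_sublinear sp1.
have [hD hZ] := sf.
have fN v : f (- v) = - f v.
  have [q sq [qf qv]] := sublinear_shift v sf.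
  apply/eqP; rewrite eq_le; apply/andP; split.
    exact: le_trans (fmin q sq qf _) qv.
  by have := sublinearN v sf; lra.
have fD u v : f (u + v) = f u + f v.
  apply/eqP; rewrite eq_le hD /=.
  by have := hD (u + v) (- v); rewrite addrK fN; lra.
have fZ (a : R) v : 0 < a -> f (a%:C *: v) = a * f v.
  move=> a0; apply/eqP; rewrite eq_le hZ //=.
  by have := hZ a (- v) a0; rewrite scalerN !fN; lra.
exists f; split=> // [a v|v|].
- have [a0|a0|->] := ltgtP a 0.
  + have := fZ (- a) v; rewrite oppr_gt0 rmorphN scaleNr fN => h.
    by apply: oppr_inj; rewrite h // mulNr.
  + exact: fZ.
  + by rewrite scale0r mul0r sublinear0.
- exact: le_trans (fp1 _) (p1p _).
apply/eqP; rewrite eq_le (le_trans (fp1 _) (p1p _)) /=.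
by have := le_trans (fp1 _) p1y; rewrite fN lerN2.
Qed.

(** The complex functional F v = f v - i f(i v) has real part f. Rotating v by a phase c with F(c v)
    = |F v| bounds the modulus by the real case. *)
Theorem hahn_banach p y : (forall u v, p (u + v) <= p u + p v) ->
  (forall (a : R[i]) v, p (a *: v) = cabs a * p v) ->
  exists f : V -> R[i],
  [/\ forall (a : R[i]) u v, f (a *: u + v) = a * f u + f v,
      forall v, cabs (f v) <= p v & cabs (f y) = p y].
Proof.
move=> pD pZ.
have sp : sublinear p.
  by split=> // a x a0; rewrite pZ cabsC ger0_norm // ltW.
have [f [fD fZ fp fy]] := real_hahn_banach y sp.
pose F v : R[i] := f v +i* - f ('i *: v).
have FD u v : F (u + v) = F u + F v.
  by rewrite /F scalerDr !fD opprD.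
have FZr (a : R) v : F (a%:C *: v) = a%:C * F v.
  rewrite /F scalerA mulrC -scalerA !fZ; apply/eqP.
  by rewrite eq_complex /= !mul0r subr0 addr0 mulrN !eqxx.
have FZi v : F ('i *: v) = 'i * F v.
  rewrite /F scalerA -expr2 sqr_i -(rmorphN1 (real_complex R)) fZ mulN1r opprK.
  by apply/eqP; rewrite eq_complex /= !mul0r !mul1r sub0r opprK add0r !eqxx.
have FZ (a : R[i]) v : F (a *: v) = a * F v.
  by rewrite {1}[a]complexE scalerDl FD -scalerA FZi !FZr mulrA -mulrDl -complexE.
have FE v : complex.Re (F v) = f v by [].
have Fp v : cabs (F v) <= p v.
  have [->|F0] := eqVneq (cabs (F v)) 0.
    have := sublinearN v sp; have := pZ (-1) v; rewrite scaleN1r cabsN cabs1 mul1r => ->.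
    by lra.
  pose c := (cabs (F v))%:C / F v.
  have nz : F v != 0 by apply: contra_neq F0 => ->; rewrite rnorm0.
  have c1 : cabs c = 1 by rewrite /c cabsM cabsV cabsC ger0_norm ?rnorm_ge0 // divff.
  have -> : cabs (F v) = f (c *: v) by rewrite -FE FZ /c divfK.
  by apply: le_trans (fp _) _; rewrite pZ c1 mul1r.
exists F; split=> // [a u v|]; first by rewrite FD FZ.
apply/eqP; rewrite eq_le Fp /= -fy -FE.
exact: le_trans (ler_norm _) (cabs_Re _).
Qed.
End HahnBanach.

Section GammaDuality.
Context {R : realType} {d : measure_display} {Sigma : measurableType d}.
Variables (P : probability Sigma R) (g : nat -> Sigma -> R[i]).
Hypothesis hg : gaussian_sequence P g.
Context {X : completeNormedModType R[i]}.

Lemma gamma_duality N (x : 'I_N -> X) (xs : 'I_N -> X -> R[i]^o) :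
  (forall k, linear (xs k)) ->
  ((cabs (\sum_(k < N) xs k (x k)))%:E <= gamma_norm P g x * gamma'_norm P g xs)%E.
Proof.
move=> lxs; have /fineK xE := gamma_norm_fin hg x.
(* If gamma is 0 the right side is 0 even when the dual norm is infinite, so x itself must vanish;
   this is where nondegeneracy enters. Otherwise x is normalized. *)
have [/eqP x0|x0] := boolP (gamma_norm P g x == 0%E).
  by rewrite x0 mul0e big1 ?rnorm0 // => k _; rewrite (gamma_norm_eq0 hg x0) bounded_linear0.
set a := fine _ in xE; have a0 : 0 < a.
  rewrite fine_gt0 // lt_def x0 gamma_norm_ge0 /= ltey_eq.
  by rewrite gamma_norm_fin.
rewrite -xE -lee_pdivrMl //; apply: ereal_sup_ubound; exists (fun k => a^-1%:C *: x k).
  rewrite /= gamma_normZ // cabsC ger0_norm ?invr_ge0 ?(ltW a0) //.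
  by rewrite -xE -EFinM mulVf // gt_eqF.
rewrite -EFinM; congr (_%:E).
under eq_bigr do rewrite linear_scale //.
by rewrite -scaler_sumr rnormZ cabsC ger0_norm // invr_ge0 ltW.
Qed.

(** A norming functional on X^N is the sum of its N coordinate functionals, and its bound by gamma
    is precisely the bound 1 on the dual norm. *)
Lemma gamma_norming N (x : 'I_N -> X) : exists xs : 'I_N -> X -> R[i]^o,
  [/\ forall k, bounded_linear (xs k), (gamma'_norm P g xs <= 1)%E &
      gamma_norm P g x = (cabs (\sum_(k < N) xs k (x k)))%:E].
Proof.
pose p (x : 'I_N -> X) := fine (gamma_norm P g x).
have pE y : (p y)%:E = gamma_norm P g y by rewrite fineK // gamma_norm_fin.
have [||f [fl fp fx]] := @hahn_banach R ('I_N -> X) p x.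
- by move=> u v; rewrite -lee_fin EFinD !pE; exact: gamma_normD.
- by move=> a v; apply: EFin_inj; rewrite EFinM !pE; exact: gamma_normZ.
pose inj k v : 'I_N -> X := fun i => if i == k then v else 0.
pose xs k v : R[i]^o := f (inj k v).
have f0 : f 0 = 0.
  have := fl 1 0 0; rewrite scaler0 addr0 mul1r => h.
  by have := subrr (f 0); rewrite {1}h addrK.
have fD u v : f (u + v) = f u + f v by have := fl 1 u v; rewrite scale1r mul1r.
have fsum (y : 'I_N -> X) : \sum_(k < N) xs k (y k) = f y.
  rewrite /xs -(big_morph f fD f0); congr f; apply/funext => i.
  rewrite fct_sumE (bigD1 i) //= /inj eqxx big1 ?addr0 // => k /negbTE.
  by rewrite eq_sym => ->.
exists xs; split.
- move=> k; split.
    move=> a u v; rewrite /xs -[RHS]fl; congr f; apply/funext => i; rewrite /inj /=.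
    by rewrite !fctE; case: ifP => // _; rewrite scaler0 addr0.
  have [C hC] := gamma_norm_single hg (X := X) k; exists C => v.
  by apply: le_trans (fp _) _; rewrite -lee_fin pE; exact: hC.
- apply: ge_ereal_sup => _ [y /= y1 <-]; apply: le_trans y1.
  by rewrite -pE lee_fin fsum.
by rewrite fsum fx pE.
Qed.
End GammaDuality.

(** * The three implications *)

Section DiscGFSToCalculus.
Context {R : realType} {X : completeNormedModType R[i]}.
Variable T : X -> X.
Hypotheses (hT : bounded_linear T) (hsigma : spectrum T `<=` closed_unit_disc).

Lemma disc_cabs (r : R) z : disc r z <-> cabs z < r.
Proof. by rewrite /disc /= cnormE ltcR. Qed.

Lemma Hinfty_norm_le1 (r : R) phi : (Hinfty_norm r phi <= 1)%E ->
  forall z, cabs z < r -> cabs (phi z) <= 1.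
Proof.
move=> h z zr; rewrite -lee_fin; apply: le_trans h.
by apply: ereal_sup_ubound; exists z => //; apply/disc_cabs.
Qed.

(** The nodes lie on the circle of radius r' = (rho + r) / 2 < r, where |phi| <= 1. Since rho > 1, r
    - 1 <= 2 (r' - 1), whence 2^m; m! / (2 pi) is Cauchy's constant, and the factor r' from dz is
    below the weight r' + 1. *)
Lemma calculus_le_wsum m (r rho : R) phi (xs : X -> R[i]^o) x : 1 < r -> 1 < rho < r ->
  Hinfty r phi -> (Hinfty_norm r phi <= 1)%E -> bounded_linear xs ->
  forall e : R, 0 < e -> exists n0 : nat, forall n, (n0 <= n)%N -> (0 < n)%N /\
    cabs (xs (((r - 1) ^+ m)%:C *: derivative_calculus T m rho phi x)) <=
    2 ^+ m * m`!%:R / (2 * pi) * wsum T m ((rho + r) / 2) xs x n + e.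
Proof.
move=> r1 /andP[rho1 rhor] [dphi _] /Hinfty_norm_le1 phi1 [lxs [M0 hM0]] e e0.
set r' := (rho + r) / 2; have rho_r' : rho < r' by rewrite /r'; lra.
have r'r : r' < r by rewrite /r'; lra.
have r1m : 0 <= (r - 1) ^+ m by rewrite exprn_ge0 //; lra.
set M := `|M0|; have hM y : cabs (xs y) <= M * rnorm y.
  by apply: le_trans (hM0 y) _; rewrite ler_wpM2r ?rnorm_ge0 // ler_norm.
have Mge0 : 0 <= M := normr_ge0 _.
set D := (r - 1) ^+ m * M * rnorm x + 1.
have D0 : 0 < D by rewrite ltr_wpDl // !mulr_ge0 ?rnorm_ge0.
have [|n0 hn] := derivative_calculus_approx (phi := phi) hT hsigma m rho1 rho_r' _
  (divr_gt0 e0 D0).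
  move=> z zr'; apply: derivable_cdiff; apply: dphi; apply/disc_cabs.
  exact: le_lt_trans r'r.
exists n0 => n /hn[n_gt0 {}hn]; split=> //.
have n_gt0r : 0 < n%:R :> R by rewrite ltr0n.
rewrite (linear_scale lxs) rnormZr //.
set A := derivative_calculus T m rho phi x; set S : X := (m`!%:R / n%:R) *: \sum_(j < n) (node r' n j * phi (node r' n j)) *:
  iter m.+1 (resolvent (node r' n j) T) x.
have hA : rnorm (A - S) <= e / D * rnorm x := hn x.
have AE : cabs (xs A) <= cabs (xs S) + M * (e / D * rnorm x).
  have -> : A = S + (A - S) by rewrite addrC subrK.
  rewrite (linear_add lxs); apply: le_trans (cabsD _ _) _; rewrite lerD2l.
  by apply: le_trans (hM _) _; rewrite ler_wpM2l.
apply: le_trans (ler_wpM2l r1m AE) _; rewrite mulrDr; apply: lerD; last first.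
  have -> : (r - 1) ^+ m * (M * (e / D * rnorm x)) =
    e * (((r - 1) ^+ m * M * rnorm x) / D) by ring.
  by rewrite ler_piMr ?(ltW e0) // ler_pdivrMr // mul1r /D lerDl.
have SE : cabs (xs S) <= m`!%:R / n%:R * \sum_(j < n)
    r' * cabs (xs (iter m.+1 (resolvent (node r' n j) T) x)).
  rewrite /S (linear_scale lxs) rnormZ.
  have -> : (m`!%:R / n%:R : R[i]) = (m`!%:R / n%:R : R)%:C.
    by rewrite rmorphM /= fmorphV /= !rmorph_nat.
  rewrite cabsC ger0_norm ?divr_ge0 // ler_wpM2l ?divr_ge0 //.
  rewrite (linear_bigsum lxs); apply: le_trans (rnorm_sum _ _ _) _.
  apply: ler_sum => j _; rewrite (linear_scale lxs) rnormZ ler_wpM2r ?rnorm_ge0 //.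
  have nr : cabs (node r' n j) = r' by rewrite /node cabs_pol //; lra.
  by rewrite cabsM nr ler_piMr ?phi1 ?nr //; lra.
apply: le_trans (ler_wpM2l r1m SE) _.
rewrite /wsum; under [X in _ <= _ * (_ * X)]eq_bigr => j _.
  rewrite wgtE //; last lra.
  over.
rewrite -!mulr_sumr -!/(node _ _ _); set Q := \sum_(i < n) _.
have Q0 : 0 <= Q by apply: sumr_ge0 => j _; exact: rnorm_ge0.
have -> : 2 ^+ m * m`!%:R / (2 * pi) * (2 * pi / n%:R * ((r' + 1) * (r' - 1) ^+ m * Q)) =
  (2 * (r' - 1)) ^+ m * (m`!%:R / n%:R * ((r' + 1) * Q)).
  rewrite exprMn; have := @pi_gt0 R; move: (@pi R) (2 ^+ m) ((r' - 1) ^+ m) (m`!%:R) => p a b c p0.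
  by move: (n%:R : R) n_gt0r => k k0; field; rewrite !lt0r_neq0.
apply: ler_pM => //.
- by rewrite !mulr_ge0 ?divr_ge0 //; lra.
- by rewrite lerXn2r ?nnegrE /r'; lra.
rewrite ler_wpM2l ?divr_ge0 // ler_wpM2r //; lra.
Qed.

Context {d : measure_display} {Sigma : measurableType d}.
Variables (P : probability Sigma R) (g : nat -> Sigma -> R[i]).
Hypothesis hg : gaussian_sequence P g.

Lemma disc_GFS_calculus m : disc_GFS P g T m -> derivative_gamma_bounded_calculus P g m T.
Proof.
move=> [C C0 hC]; set K : R := 2 ^+ m * m`!%:R / (2 * pi).
have K0 : 0 < K by rewrite divr_gt0 ?twopi_gt0 // mulr_gt0 ?exprn_gt0 ?ltr0n ?fact_gt0.
exists (K * C); first by rewrite mulr_ge0 // ltW.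
(* [disc_GFS] requires N >= 1; for the empty family the left side is 0. *)
move=> N S x hS; case: N => [|N] in S x hS *.
  rewrite (_ : (fun n => _) = fun=> 0); last by apply/funext => -[].
  by rewrite gamma_norm0 mule_ge0 ?gamma_norm_ge0 // lee_fin mulr_ge0 // ltW.
have /choice[r /choice[rho /choice[phi hphi]]] := hS.
have [xs [bxs xs1 ->]] := gamma_norming hg (fun n => S n (x n)).
have xE := fineK (gamma_norm_fin hg x); set a := fine _ in xE.
have a0 : 0 <= a by rewrite fine_ge0 // gamma_norm_ge0.
apply/lee_addgt0Pr => e e0; rewrite -xE -EFinM -EFinD lee_fin.
have N0 : 0 < N.+1%:R :> R by rewrite ltr0n.
have e1 : 0 < e / 2 / N.+1%:R by rewrite (divr_gt0 (half_gt0 e0)).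
have e2 : 0 < e / 2 / K by rewrite (divr_gt0 (half_gt0 e0)).
have [n1 h1] := ex_common_rank (fun k => let: And5 a b c d _ := hphi k in
  calculus_le_wsum m (x k) a b c d (bxs k) e1).
have r1 k : 1 < (rho k + r k) / 2 by have [? /andP[? ?] _ _ _] := hphi k; lra.
have [n2 h2] := hC N.+1 (fun k => (rho k + r k) / 2) x xs isT r1 bxs _ e2.
have hw := (h2 _ (leq_maxr n1 n2)).2; have {}h1 := h1 _ (leq_maxl n1 n2).
set n := maxn n1 n2 in hw h1; set W := \sum_(k < _) _ in hw.
have {}hw : W <= C * a + e / 2 / K.
  rewrite -lee_fin EFinD; apply: le_trans hw _; apply: leeD2r.
  by rewrite -xE EFinM -[leRHS]mule1 lee_wpmul2l // lee_fin mulr_ge0 // ltW.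
apply: le_trans (rnorm_sum _ _ _) _.
apply: (@le_trans _ _ (K * W + e / 2)).
  rewrite /W mulr_sumr; apply: (@le_trans _ _ (\sum_(k < N.+1)
    (K * wsum T m ((rho k + r k) / 2) (xs k) (x k) n + e / 2 / N.+1%:R))).
    apply: ler_sum => k _; have [_] := h1 k.
    by have [_ _ _ _ ->] := hphi k.
  by rewrite big_split /= lerD2l sumr_const card_ord -(mulr_natr (e / 2 / _)) divfK ?gt_eqF.
have := ler_wpM2l (ltW K0) hw; rewrite mulrDr (mulrC K (e / 2 / K)) divfK ?gt_eqF //.
by rewrite mulrA; lra.
Qed.
End DiscGFSToCalculus.

Section CalculusToDiscGFS.
Context {R : realType} {X : completeNormedModType R[i]}.
Variable T : X -> X.
Hypotheses (hT : bounded_linear T) (hsigma : spectrum T `<=` closed_unit_disc).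

Lemma ex_phase (z : R[i]) : exists u : R[i], cabs u = 1 /\ u * z = (cabs z)%:C.
Proof.
have [->|z0] := eqVneq z 0; first by exists 1; rewrite cabs1 mulr0 rnorm0.
exists ((cabs z)%:C / z); rewrite divfK // cabsM cabsV cabsC ger0_norm ?rnorm_ge0 //.
by rewrite divff // gt_eqF // cabs_gt0.
Qed.

Definition half_radius (r : R) : R := (1 + r) / 2.

(** With s = (1 + r) / 2 the right side is (r - 1)(r + s), and s >= 1. *)
Lemma half_radius_gap (r : R) : 1 < r ->
  (r + 1) * (r - 1) <= 2 * (r ^+ 2 - half_radius r ^+ 2).
Proof. by move=> r1; rewrite /half_radius !expr2; nra. Qed.

(** The coefficient (r^2 - s^2) / (2 n) is the inverse of the bound in [node_inv_sqr_sum]. The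
    phases may change with n, as the nodes do. *)
Lemma test_function (r : R) (eps : nat -> nat -> R[i]) : 1 < r ->
  (forall n j, cabs (eps n j) = 1) ->
  exists N : nat, forall n, (N <= n)%N -> (0 < n)%N /\
    let c j := ((r ^+ 2 - half_radius r ^+ 2) / (2 * n%:R))%:C * eps n j in
    let phi : R[i]^o -> R[i]^o := fun z => \sum_(j < n) c j * (node r n j - z)^-1 ^+ 2 in
    Hinfty (half_radius r) phi /\ (Hinfty_norm (half_radius r) phi <= 1)%E.
Proof.
move=> r1 eps1; set s := half_radius r.
have s1 : 1 < s by rewrite /s /half_radius; lra.
have sr : s < r by rewrite /s /half_radius; lra.
have [N hN] := @node_inv_sqr_sum R s r ltac:(lra) sr; exists N => n /hN[n0 {}hN]; split=> //.
have n0r : 0 < n%:R :> R by rewrite ltr0n.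
rewrite -/s => c phi.
have D0 : 0 < r ^+ 2 - s ^+ 2 by rewrite subr_gt0 ltr_pXn2r ?nnegrE //; lra.
have phi1 z : cabs z < s -> cabs (phi z) <= 1.
  move=> zs; apply: le_trans (@rnorm_sum _ R[i]^o _ _ _ _) _.
  have -> : \sum_(j < n) rnorm (c j * (node r n j - z)^-1 ^+ 2 : R[i]^o) =
      (r ^+ 2 - s ^+ 2) / (2 * n%:R) * \sum_(j < n) (cabs (node r n j - z))^-1 ^+ 2.
    rewrite mulr_sumr; apply: eq_bigr => j _.
    rewrite cabsM /c cabsM eps1 mulr1 cabsC ger0_norm ?divr_ge0 ?(ltW D0) //.
    by rewrite cabsX cabsV.
  apply: le_trans (ler_wpM2l _ (hN z zs)) _; first by rewrite divr_ge0 ?(ltW D0).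
  rewrite le_eqVlt; apply/orP; left; apply/eqP.
  by move: (r ^+ 2 - s ^+ 2) D0 => a a0; move: (n%:R : R) n0r => k k0; field; rewrite !lt0r_neq0.
split; last by apply: ge_ereal_sup => _ [z /disc_cabs zs <-]; rewrite lee_fin; exact: phi1.
split; last by exists 1 => z /disc_cabs; exact: phi1.
move=> z /disc_cabs zs; apply: cdiff_at_derivable; apply: cdiff_at_sum => j.
apply: cdiff_atZ; apply: inv_pow_cdiff_at; apply: contraTneq zs => ->.
by rewrite /node cabs_pol -?leNgt; lra.
Qed.

(** The phases are chosen so that every term of the pairing is nonnegative; then the pairings for
    different k can be added without cancellation. *)
Lemma wsum_le_calculus m (r : R) (xs : X -> R[i]^o) x : 1 < r -> linear xs ->
  exists N : nat, forall n, (N <= n)%N -> (0 < n)%N /\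
  exists (rho : R) (phi : R[i]^o -> R[i]^o),
    let s := half_radius r in
    let y := ((s - 1) ^+ m)%:C *: derivative_calculus T m rho phi x in
    [/\ 1 < s, 1 < rho < s, Hinfty s phi, (Hinfty_norm s phi <= 1)%E &
      xs y = (cabs (xs y))%:C /\
      wsum T m.+1 r xs x n <= 8 * pi * 2 ^+ m * cabs (xs y)].
Proof.
move=> r1 lxs; set s := half_radius r.
have s1 : 1 < s by rewrite /s /half_radius; lra.
have sr : s < r by rewrite /s /half_radius; lra.
pose v n j := xs (iter m.+2 (resolvent (node r n j) T) x).
have /choice[eps heps] n : exists e : nat -> R[i], forall j,
    cabs (e j) = 1 /\ e j * v n j = (cabs (v n j))%:C.
  by have /choice[e he] := fun j => ex_phase (v n j); exists e.
have [N hN] := test_function r1 (fun n j => (heps n j).1).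
exists N => n /hN[n0 hphi].
pose c j : R[i] := ((r ^+ 2 - s ^+ 2) / (2 * n%:R))%:C * eps n j.
pose phi : R[i]^o -> R[i]^o := fun z => \sum_(j < n) c j * (node r n j - z)^-1 ^+ 2.
have [h1 h2] : Hinfty s phi /\ (Hinfty_norm s phi <= 1)%E := hphi.
split=> //; exists (half_radius s), phi => /=.
have rho1 : 1 < half_radius s by rewrite /half_radius; lra.
have rhos : half_radius s < s by rewrite /half_radius; lra.
split=> //; first by rewrite rho1.
have n0r : 0 < n%:R :> R by rewrite ltr0n.
set a := (r ^+ 2 - s ^+ 2) / (2 * n%:R).
have a0 : 0 < a.
  by rewrite divr_gt0 ?mulr_gt0 // subr_gt0 ltr_pXn2r ?nnegrE //; lra.
set V := \sum_(j < n) cabs (v n j).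
have V0 : 0 <= V by apply: sumr_ge0 => j _; exact: rnorm_ge0.
have E : xs (((s - 1) ^+ m)%:C *: derivative_calculus T m (half_radius s) phi x) =
   ((s - 1) ^+ m * (m.+1`!%:R * (a * V)))%:C.
  rewrite (@derivative_calculus_rational _ _ _ hT hsigma n c (node r n) _ s) //; last first.
    by move=> j; rewrite /node cabs_pol ?(ltW sr) //; lra.
  have CE (p q u w : R) : (p * (q * (u * w)))%:C = p%:C * (q%:C * (u%:C * w%:C)).
    by rewrite !rmorphM.
  rewrite !(linear_scale lxs) (linear_bigsum lxs) CE rmorph_nat.
  congr (_ * (_ * _)); rewrite rmorph_sum mulr_sumr /=; apply: eq_bigr => j _.
  rewrite (linear_scale lxs) /c -(heps n j).2; exact/esym/mulrA.
have b0 : 0 <= (s - 1) ^+ m * (m.+1`!%:R * (a * V)).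
  apply: mulr_ge0; first by rewrite exprn_ge0 //; lra.
  by apply: mulr_ge0 => //; apply: mulr_ge0 => //; exact: ltW.
rewrite E cabsC ger0_norm //; split=> //.
rewrite /wsum; under eq_bigr => j _ do rewrite wgtE //.
rewrite -mulr_sumr -/V.
have f1 : 1 <= m.+1`!%:R :> R by rewrite ler1n fact_gt0.
have gap : (r + 1) * (r - 1) <= 4 * n%:R * a.
  apply: le_trans (half_radius_gap r1) _; rewrite -/s le_eqVlt /a; apply/orP; left; apply/eqP.
  by move: (r ^+ 2 - s ^+ 2) => b; move: (n%:R : R) n0r => k k0; field; rewrite lt0r_neq0.
have rm : 0 <= (r - 1) ^+ m by rewrite exprn_ge0 //; lra.
(* The 2 pi is the length of the interval, 4 comes from [gap], and 2^m from r - 1 = 2 (s - 1); the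
   factor (m + 1)! is bounded below by 1. *)
have -> : 8 * pi * 2 ^+ m * ((s - 1) ^+ m * (m.+1`!%:R * (a * V))) =
    2 * pi * (4 * a) * m.+1`!%:R * ((r - 1) ^+ m * V).
  have -> : r - 1 = 2 * (s - 1) by rewrite /s /half_radius; lra.
  by rewrite exprMn; ring.
have -> : 2 * pi / n%:R * ((r + 1) * (r - 1) ^+ m.+1 * V) =
    2 * pi * ((r + 1) * (r - 1) / n%:R) * 1 * ((r - 1) ^+ m * V).
  by rewrite exprS; ring.
rewrite ler_wpM2r ?mulr_ge0 //; apply: ler_pM => //.
  rewrite mulr_ge0 ?divr_ge0 ?mulr_ge0 ?pi_ge0 //; lra.
rewrite ler_wpM2l ?mulr_ge0 ?pi_ge0 // ler_pdivrMr //.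
by rewrite mulrAC.
Qed.

Context {d : measure_display} {Sigma : measurableType d}.
Variables (P : probability Sigma R) (g : nat -> Sigma -> R[i]).
Hypothesis hg : gaussian_sequence P g.

Lemma calculus_disc_GFS m : derivative_gamma_bounded_calculus P g m T ->
  disc_GFS P g T m.+1.
Proof.
move=> [C C0 hC]; set K : R := 8 * pi * 2 ^+ m.
have K0 : 0 <= K by rewrite !mulr_ge0 ?pi_ge0 ?exprn_ge0.
(* Gamma-boundedness provides C >= 0 only, while the GFS constant must be positive. *)
exists (K * C + 1); first by rewrite ltr_wpDl // mulr_ge0.
move=> N r x xs N1 r1 bxs e e0.
have lxs k : linear (xs k) by have [] := bxs k.
have [n0 hn0] := ex_common_rank (fun k => wsum_le_calculus m (x k) (r1 k) (lxs k)).
exists n0 => n /hn0 {}hn0; split; first by have [] := hn0 (Ordinal N1).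
have /choice[rho /choice[phi hphi]] := fun k => (hn0 k).2.
pose S k (y : X) := ((half_radius (r k) - 1) ^+ m)%:C *:
  derivative_calculus T m (rho k) (phi k) y.
have Sx : (gamma_norm P g (fun k => S k (x k)) <= C%:E * gamma_norm P g x)%E.
  apply: hC => k; exists (half_radius (r k)), (rho k), (phi k).
  by have [h1 h2 h3 h4 _] := hphi k.
have g'0 := gamma'_norm_ge0 P g lxs; have g0 := gamma_norm_ge0 P g x.
apply: (@le_trans _ _ (K%:E * (gamma_norm P g (fun k => S k (x k)) * gamma'_norm P g xs))%E).
  apply: (@le_trans _ _ (K%:E * (cabs (\sum_(k < N) xs k (S k (x k))))%:E)%E); last first.
    by rewrite lee_wpmul2l ?lee_fin //; exact: gamma_duality.
  (* Each pairing equals its modulus, so duality controls the sum of the moduli. *)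
  have -> : \sum_(k < N) xs k (S k (x k)) = (\sum_(k < N) cabs (xs k (S k (x k))))%:C.
    by rewrite rmorph_sum; apply: eq_bigr => k _; have [_ _ _ _ []] := hphi k.
  rewrite cabsC ger0_norm; last by apply: sumr_ge0 => k _; exact: rnorm_ge0.
  rewrite -EFinM lee_fin mulr_sumr; apply: ler_sum => k _.
  by have [_ _ _ _ []] := hphi k.
apply: (@le_trans _ _ ((K * C + 1)%:E * gamma_norm P g x * gamma'_norm P g xs)%E); last first.
  by rewrite leeDl // lee_fin ltW.
rewrite muleA lee_wpmul2r // (@le_trans _ _ (K%:E * (C%:E * gamma_norm P g x))%E) //.
  by rewrite lee_wpmul2l // lee_fin.
by rewrite muleA -EFinM lee_wpmul2r // lee_fin lerDl.
Qed.
End CalculusToDiscGFS.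

Theorem theorem4p16 (R : realType) (d : measure_display)
    (Sigma : measurableType d) (P : probability Sigma R)
    (g : nat -> Sigma -> R[i]) (hg : gaussian_sequence P g)
    (X : completeNormedModType R[i]) (T : X -> X) (hT : bounded_linear T)
    (hsigma : spectrum T `<=` closed_unit_disc) (m : nat) (hm : (1 <= m)%N) :
  (gamma_GFS P g m T <-> derivative_gamma_bounded_calculus P g 1 T) /\
  (derivative_gamma_bounded_calculus P g 1 T <->
   derivative_gamma_bounded_calculus P g m T).
Proof.
have cal k : disc_GFS P g T k -> derivative_gamma_bounded_calculus P g k T.
  exact: disc_GFS_calculus.
have gfs k : derivative_gamma_bounded_calculus P g k T -> disc_GFS P g T k.+1.
  exact: calculus_disc_GFS.
have pred k : (1 <= k)%N -> disc_GFS P g T k.+1 -> disc_GFS P g T k.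
  exact: disc_GFS_pred.
(* One goes down by [pred] and up by [cal] followed by [gfs]; at k = 1 [cal] and [gfs] with [pred]
   close the loop. *)
have equiv1 k : (1 <= k)%N ->
    disc_GFS P g T k <-> derivative_gamma_bounded_calculus P g 1 T.
  elim: k => [//|[|k] IH] _; first by split=> [/cal //|/gfs]; exact: pred.
  by split=> [/(pred k.+1 isT)/(IH isT)|/(IH isT)/cal/gfs].
split; first by apply: iff_trans (equiv1 m hm); exact: GFS_disc.
by split=> [/(equiv1 m hm)/cal|/gfs/(pred m hm)/(equiv1 m hm)].
Qed.
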